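(* Let $d\geq 4$. Let $\Delta$ be either (i) a normal $(d-1)$-pseudomanifold without boundary with a generic $d$-embedding $p$, or (ii) the boundary complex $\partial P$ of a simplicial $d$-polytope $P$ with its natural embedding $p$. In both cases assume that $\Delta$ has no missing faces of dimension $\geq d-2$. Then $$\mathrm{Span}\{\partial_{x_v}\omega:\ \omega\in\mathrm{Stress}^a_2(\Delta,p),\ v\in V(\Delta)\}=\mathrm{Stress}^a_1(\Delta,p),$$ so the space $\mathrm{Stress}^a_2(\Delta,p)$ determines $\mathrm{Stress}^a_1(\Delta,p)$. In particular, $\mathrm{Stress}^a_2(\Delta,p)$ determines the positions of the vertices of $\Delta$ up to affine equivalence.
   Context: A pseudomanifold without boundary is a pure $(d-1)$-dimensional complex in which every $(d-2)$-face lies in exactly two facets; it is normal if the link $\mathrm{lk}(F)=\{\sigma:\sigma\cup F\in\Delta,\sigma\cap F=\emptyset\}$ of every face $F$ of dimension $\leq d-3$ (including $\emptyset$) is connected. A missing face is a vertex set $M\notin\Delta$ all of whose proper subsets are faces; its dimension is $|M|-1$. A $d$-embedding $p:V(\Delta)\to\mathbb{R}^d$ is generic if the multiset of all coordinates of the $p(v)$ is algebraically independent over $\mathbb{Q}$. $\partial P$ is the complex of vertex sets of proper faces of $P$, with $p$ the position vectors. Stresses: $\mathbb{R}[X]=\mathbb{R}[x_v:v\in V]$, $\theta_m=\sum_vp(v)_mx_v$ ($m=1,\dots,d$), $c=\sum_vx_v$, $\partial_\ell=\sum_v\ell_v\partial/\partial x_v$. A homogeneous degree-$k$ polynomial $\lambda$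 is an affine $k$-stress on $(\Delta,p)$ if each monomial with nonzero coefficient has support a face of $\Delta$, $\partial_{\theta_m}\lambda=0$ for all $m$, and $\partial_c\lambda=0$; $\mathrm{Stress}^a_k(\Delta,p)$ is their space. ''Determines'' means: the equality expresses $\mathrm{Stress}^a_1$ as a function of $\mathrm{Stress}^a_2$; $\mathrm{Stress}^a_1(\Delta,p)$ is the space of affine dependences of the points $p(v)$, which determines $p$ up to an invertible affine transformation. *)

(* Defs.v *)
From mathcomp Require Import all_boot all_order all_algebra.
From mathcomp Require Import boolp classical_sets reals.
From mathcomp Require Import mpoly.

Set Implicit Arguments.
Unset Strict Implicit.
Unset Printing Implicit Defensive.

Import Order.TTheory GRing.Theory Num.Theory.

Local Open Scope ring_scope.

(* A face [F] has dimension [#|F| - 1]; dimensions are expressed below through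
   cardinals, so that the empty face (dimension -1) needs no special case. *)

Section Complexes.
Variable n : nat.
Implicit Types (D : {set {set 'I_n}}) (F G M s : {set 'I_n}).

(* Every element of ['I_n] is required to be a vertex, so V(D) = 'I_n. *)
Definition simplicial_complex D : Prop :=
  [/\ finset.set0 \in D,
      (forall v : 'I_n, [set v]%SET \in D)
    & (forall F G, F \in D -> G \subset F -> G \in D)].

Definition facet D F : bool := maxset (fun G => G \in D) F.

Definition pure_of_card D (d : nat) : Prop := forall F, facet D F -> #|F| = d.

Definition link D F : {set {set 'I_n}} :=
  [set s | (s :|: F \in D) && [disjoint s & F]]%SET.

(* Connectedness of the 1-skeleton, equivalently of the geometric
   realization. *)
Definition connected_complex D : Prop :=
  forall u v : 'I_n, [set u]%SET \in D -> [set v]%SET \in D ->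
    connect (fun x y => [set x; y]%SET \in D) u v.

Definition normal_pseudomanifold (d : nat) D : Prop :=
  [/\ simplicial_complex D,
      pure_of_card D d,
      (forall F, F \in D -> #|F| = d.-1 ->
         #|[set G | facet D G && (F \subset G)]%SET| = 2%N)
    & (forall F, F \in D -> (#|F| <= d - 2)%N ->
         connected_complex (link D F))].

Definition missing_face D M : Prop :=
  M \notin D /\ (forall F, F \proper M -> F \in D).

Definition no_missing_face_of_dim_ge D (k : nat) : Prop :=
  forall M, missing_face D M -> ~~ (k.+1 <= #|M|)%N.

End Complexes.

Section Polytopes.
Variables (R : realType) (d : nat).
Implicit Types (P F : set 'rV[R]_d).

Definition dot (a x : 'rV[R]_d) : R := \sum_(j < d) a 0 j * x 0 j.

Definition conv_hull m (q : 'I_m -> 'rV[R]_d) : set 'rV[R]_d :=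
  fun x => exists w : 'I_m -> R,
    [/\ (forall i, 0 <= w i), \sum_i w i = 1 & x = \sum_i w i *: q i].

Definition affinely_independent m (q : 'I_m -> 'rV[R]_d) : Prop :=
  forall w : 'I_m -> R,
    \sum_i w i = 0 -> \sum_i w i *: q i = 0 -> forall i, w i = 0.

Definition polytope P : Prop :=
  exists (m : nat) (q : 'I_m -> 'rV[R]_d), P = conv_hull q.

Definition full_dimensional P : Prop :=
  exists2 q : 'I_d.+1 -> 'rV[R]_d,
    affinely_independent q & forall i, P (q i).

(* The case a = 0 is allowed: it yields the faces set0 (b = 1) and P (b = 0). *)
Definition polytope_face P F : Prop :=
  exists (a : 'rV[R]_d) (b : R),
    (forall x, P x -> dot a x <= b) /\ F = (fun x => P x /\ dot a x = b).

Definition proper_face P F : Prop := polytope_face P F /\ F <> P.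

Definition simplex F : Prop :=
  exists (m : nat) (q : 'I_m -> 'rV[R]_d),
    affinely_independent q /\ F = conv_hull q.

Definition simplicial_polytope P : Prop :=
  [/\ polytope P, full_dimensional P & forall F, proper_face P F -> simplex F].

Definition polytope_vertex P (x : 'rV[R]_d) : Prop :=
  polytope_face P (classical_sets.set1 x).

Variable n : nat.

Definition natural_embedding P (p : 'I_n -> 'rV[R]_d) : Prop :=
  injective p /\ (forall x, polytope_vertex P x <-> exists v, p v = x).

Definition boundary_complex P (p : 'I_n -> 'rV[R]_d)
    (D : {set {set 'I_n}}) : Prop :=
  forall S : {set 'I_n}, S \in D <->
    exists2 F, proper_face P F & forall v, v \in S <-> F (p v).

(* [mxvec] lists all n * d coordinates, with repetitions, so [f] ranges over
   the rational polynomial relations of the whole multiset. *)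
Definition generic (p : 'I_n -> 'rV[R]_d) : Prop :=
  forall f : {mpoly rat[n * d]},
    (map_mpoly ratr f).@[fun k => mxvec (\matrix_(v < n, j < d) p v 0 j) 0 k]
      = 0 :> R ->
    f = 0.

Definition affinely_equivalent (p p' : 'I_n -> 'rV[R]_d) : Prop :=
  exists (A : 'M[R]_d) (b : 'rV[R]_d),
    A \in unitmx /\ forall v, p' v = p v *m A + b.

End Polytopes.

Definition lin_span (R : realType) (M : lmodType R) (S : set M) : set M :=
  fun x => exists (k : nat) (c : 'I_k -> R) (f : 'I_k -> M),
    (forall i, S (f i)) /\ x = \sum_i c i *: f i.

Section Stresses.
Variables (R : realType) (n : nat).

Definition lin_deriv (l : 'I_n -> R) (f : {mpoly R[n]}) : {mpoly R[n]} :=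
  \sum_(v < n) l v *: f^`M(v).

Definition mon_supp (m : 'X_{1..n}) : {set 'I_n} := [set v | m v != 0%N]%SET.

Definition affine_stress (d k : nat) (D : {set {set 'I_n}})
    (p : 'I_n -> 'rV[R]_d) : set {mpoly R[n]} :=
  fun lam =>
    [/\ lam \is k.-homog,
        (forall m, m \in msupp lam -> mon_supp m \in D),
        (forall j : 'I_d, lin_deriv (fun v => p v 0 j) lam = 0)
      & lin_deriv (fun=> 1) lam = 0].

Definition partials_span (W : set {mpoly R[n]}) : set {mpoly R[n]} :=
  lin_span (fun mu => exists2 om, W om & exists v : 'I_n, mu = om^`M(v)).

Definition stress_hypotheses (d : nat) (D : {set {set 'I_n}})
    (p : 'I_n -> 'rV[R]_d) : Prop :=
  ((normal_pseudomanifold d D /\ generic p) \/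
   (exists P : set 'rV[R]_d,
      [/\ simplicial_polytope P, natural_embedding P p
        & boundary_complex P p D])) /\
  no_missing_face_of_dim_ge D (d - 2).

End Stresses.

(* Main.v *)
(* Write [P v] for [(p v, 1)]. Affine 2-stresses are the symmetric matrices [W]
   supported on faces with [W *m P = 0], and their partial derivatives are the
   rows of [W]; so by duality it suffices that every [q] with [W q = 0] for all
   such [W] is affine, i.e. [q v = <P v, e>]. Dualizing again, for each vertex
   [z] there is a vector field [l] with
     [<P x, l y> + <P y, l x> = q y [x = z] + q x [y = z]]
   on all edges [xy]: an infinitesimal motion stretching only the edges at [z].
   On a facet avoiding [z] it is given by a skew matrix, [l v = P v A].

   Let [G] be a ridge such that [z] is outside [G] and [z |: G] is not a face.
   Then [z |: G] contains a missing face, of size at most [d - 2], so some face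
   [rho] of [G] of size [d - 3] has a star avoiding [z]. If stars of
   such [rho] are infinitesimally rigid, [A] propagates across [G]. A parity
   count around the codimension two faces of the facets containing [z] then
   yields [l v = P v A] at all vertices opposite to a ridge of [F] through [z],
   whence [q] is affine near each facet [F], and globally by strong
   connectivity.

   Rigidity of the star of [rho] reduces to that of its link, a surface in
   dimension three. Given a motion, the jumps of the angular velocities of
   the triangles across edges form a self-stress [s]; it must be shown to vanish.
   - For a polytope the surface is convex. With velocities [m], positions [u]
     and [w x = \sum_y s x y (m y - m x)], the sum over [x] of [<o - u x, w x>]
     vanishes by symmetry, while each term is nonpositive for [o] inside, and
     zero only if [s] vanishes at [x].
   - For generic [p] it is enough to treat independent coordinates in
     characteristic two. There the pairing of [s] with the motion becomes
     [\sum_e s_e ^ 2 D_0 e D_1 e D_2 e = 0], with [D e] the edge vector; squares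
     are constants for derivations, and differentiating in three
     coordinates isolates [s_e ^ 2 = 0]. *)

Require Import Defs.
From mathcomp Require Import boolp classical_sets reals.
From mathcomp Require Import all_boot all_order all_algebra.
From mathcomp Require Import mpoly.
From mathcomp Require Import ring lra zify.

Set Implicit Arguments.
Unset Strict Implicit.
Unset Printing Implicit Defensive.

Import Order.TTheory GRing.Theory Num.Theory.

Local Open Scope ring_scope.

(** * Vectors in dimension three *)

Section Vec3.
Variable K : comNzRingType.
Implicit Types a b c : 'rV[K]_3.

(** Passing from [p v] to [hat (p v)] makes affine functionals linear, so that trivial motions are
    [P v *m A] with [A] skew and the link of a face is seen in the quotient by its span. The bound
    on missing faces is what leaves room for a [rho] with [d - 3] vertices, whose link is a surface
    in dimension three; a larger [rho] would leave a polygon in the plane, which flexes in general.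

    Once a facet is pinned, however, rigidity says that a linear system with integer polynomials as
    coefficients has full rank, that is, that some maximal minor is not the zero polynomial. One
    placement over one field is enough to see this, which permits special positions of [rho] and
    characteristic two, where signs and orientations disappear.

    The parity count is a handshake argument: it replaces a walk around a codimension two face
    without any description of the link of that face.

    The two cases meet in four properties: [closed_pseudomanifold], [star_connected],
    [adjacent_facets_span] and [rigid_stars]. *)

Definition i0 : 'I_3 := Ordinal (isT : (0 < 3)%N).
Definition i1 : 'I_3 := Ordinal (isT : (1 < 3)%N).
Definition i2 : 'I_3 := Ordinal (isT : (2 < 3)%N).

Lemma ord3P (P : 'I_3 -> Prop) : P i0 -> P i1 -> P i2 -> forall i, P i.
Proof.
move=> h0 h1 h2 [[|[|[|//]]] hi].
- by rewrite (_ : Ordinal hi = i0) //; apply: val_inj.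
- by rewrite (_ : Ordinal hi = i1) //; apply: val_inj.
- by rewrite (_ : Ordinal hi = i2) //; apply: val_inj.
Qed.

Lemma row3P a b : a 0 i0 = b 0 i0 -> a 0 i1 = b 0 i1 -> a 0 i2 = b 0 i2 -> a = b.
Proof. by move=> h0 h1 h2; apply/rowP; apply: ord3P. Qed.

Definition vec3 (x y z : K) : 'rV[K]_3 :=
  \row_j (if j == i0 then x else if j == i1 then y else z).

Lemma vec3E x y z :
  (vec3 x y z 0 i0 = x) * (vec3 x y z 0 i1 = y) * (vec3 x y z 0 i2 = z).
Proof. by rewrite !mxE. Qed.

Definition dot3 a b := a 0 i0 * b 0 i0 + a 0 i1 * b 0 i1 + a 0 i2 * b 0 i2.

Definition cross a b :=
  vec3 (a 0 i1 * b 0 i2 - a 0 i2 * b 0 i1)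
       (a 0 i2 * b 0 i0 - a 0 i0 * b 0 i2)
       (a 0 i0 * b 0 i1 - a 0 i1 * b 0 i0).

Definition det3 a b c := dot3 a (cross b c).

Lemma dot3_sumr I (r : seq I) (P : pred I) (F : I -> 'rV[K]_3) a :
  dot3 a (\sum_(i <- r | P i) F i) = \sum_(i <- r | P i) dot3 a (F i).
Proof. by rewrite /dot3 !summxE !mulr_sumr -!big_split. Qed.

Lemma dot3C a b : dot3 a b = dot3 b a.
Proof. by rewrite /dot3 ![a _ _ * _]mulrC. Qed.

Lemma dot3Zr x a b : dot3 a (x *: b) = x * dot3 a b.
Proof. by rewrite /dot3 !mxE; ring. Qed.

Lemma sum3E (F : 'I_3 -> K) : \sum_j F j = F i0 + F i1 + F i2.
Proof.
rewrite !big_ord_recl big_ord0 addr0 addrA.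
by congr (_ + _ + _); congr F; apply: val_inj.
Qed.

End Vec3.

Ltac vec3_ring :=
  rewrite /det3 /dot3 /cross ?vec3E ?mxE /=; ring.

Section AngularVelocity.
Variable K : fieldType.

Lemma angular_velocity (e1 e2 w m1 m2 : 'rV[K]_3) :
  det3 e1 e2 w != 0 -> dot3 m1 e1 = 0 -> dot3 m2 e2 = 0 ->
  dot3 m1 e2 + dot3 m2 e1 = 0 ->
  exists Om, m1 = cross Om e1 /\ m2 = cross Om e2.
Proof.
move=> D0 h1 h2 h12.
(* Cramer's rule in the basis [e1], [e2], [w]: each triple product of the unknown with two basis
   vectors contains [e1] or [e2], hence is given by [m1] or [m2]. *)
exists ((det3 e1 e2 w)^-1 *:
   (dot3 m1 e2 *: w - dot3 m1 w *: e2 + dot3 m2 w *: e1)).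
have sol (m x : 'rV[K]_3) : det3 e1 e2 w *: m = x -> m = (det3 e1 e2 w)^-1 *: x.
  by move=> <-; rewrite scalerA mulVf // scale1r.
have crossZ (y : K) (x e : 'rV[K]_3) : cross (y *: x) e = y *: cross x e.
  by apply: row3P; rewrite /cross !(vec3E, mxE); ring.
rewrite !crossZ; split; apply: sol.
- have -> : det3 e1 e2 w *: m1 =
     cross (dot3 m1 e2 *: w - dot3 m1 w *: e2 + dot3 m2 w *: e1) e1
     + dot3 m1 e1 *: cross e2 w.
    by apply: row3P; vec3_ring.
  by rewrite h1 scale0r addr0.
- have -> : det3 e1 e2 w *: m2 =
     cross (dot3 m1 e2 *: w - dot3 m1 w *: e2 + dot3 m2 w *: e1) e2
     - dot3 m2 e2 *: cross e1 w - (dot3 m1 e2 + dot3 m2 e1) *: cross w e2.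
    by apply: row3P; vec3_ring.
  by rewrite h2 h12 !scale0r !subr0.
Qed.

Lemma cross_eq0 (e1 e2 w Om : 'rV[K]_3) :
  det3 e1 e2 w != 0 -> cross Om e1 = 0 -> cross Om e2 = 0 -> Om = 0.
Proof.
move=> D0 c1 c2.
have d0 (e : 'rV[K]_3) : dot3 0 e = 0 by vec3_ring.
have : det3 e1 e2 w *: Om = dot3 (cross Om e1) e2 *: w
    - dot3 (cross Om e1) w *: e2 + dot3 (cross Om e2) w *: e1.
  by apply: row3P; vec3_ring.
rewrite c1 c2 !d0 !scale0r subr0 addr0 => /eqP.
by rewrite scaler_eq0 (negPf D0) /= => /eqP.
Qed.

Lemma triangle_angular_velocity (V : finType) (u m : V -> 'rV[K]_3) x y z w :
  det3 (u y - u x) (u z - u x) w != 0 ->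
  (forall p q, p \in [set x; y; z] -> q \in [set x; y; z] ->
    dot3 (m p - m q) (u p - u q) = 0) ->
  exists Om, forall p q, p \in [set x; y; z] -> q \in [set x; y; z] ->
    m q - m p = cross Om (u q - u p).
Proof.
move=> D0 fl.
have [xt yt zt] : [/\ x \in [set x; y; z], y \in [set x; y; z]
    & z \in [set x; y; z]] by rewrite !inE !eqxx ?orbT.
have [Om [h1 h2]] : exists Om, m y - m x = cross Om (u y - u x) /\
    m z - m x = cross Om (u z - u x).
  apply: (@angular_velocity _ _ w); [by []|exact: fl|exact: fl|].
  have -> : dot3 (m y - m x) (u z - u x) + dot3 (m z - m x) (u y - u x) =
      dot3 (m x - m y) (u x - u y) + dot3 (m x - m z) (u x - u z)
      - dot3 (m y - m z) (u y - u z) by vec3_ring.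
  by rewrite !fl // addr0 subr0.
exists Om => p q.
have H c : c \in [set x; y; z] -> m c - m x = cross Om (u c - u x).
  rewrite !inE => /orP[/orP[]|] /eqP-> //.
  by apply: row3P; vec3_ring.
move=> /H hv /H hw.
have -> : m q - m p = (m q - m x) - (m p - m x) by rewrite opprB addrA subrK.
by rewrite hv hw; apply: row3P; vec3_ring.
Qed.

End AngularVelocity.

(** * Infinitesimal rigidity of convex surfaces *)

Lemma card3P (V : finType) (t : {set V}) : #|t| = 3%N ->
  exists x y z, t = [set x; y; z].
Proof.
move=> h; have /set0Pn[x xt] : t != set0 by rewrite -card_gt0 h.
have /eqP/cards2P[y [z [_ e]]] : #|t :\ x| = 2%N.
  by move: h; rewrite (cardsD1 x) xt => -[].
by exists x, y, z; rewrite -(setD1K xt) e setUA.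
Qed.

Section ConvexSurface.
Variables (R : realFieldType) (V : finType) (Sf : {set {set V}}).
Variables (u m : V -> 'rV[R]_3) (o : 'rV[R]_3).
Local Notation T x y z := ([set x; y; z] \in Sf).

Hypothesis Sf3 : forall t, t \in Sf -> #|t| = 3%N.
Hypothesis Sf_edge : forall x y a, T x y a ->
  exists b, [/\ b != a, T x y b & forall c, T x y c -> c = a \/ c = b].
Hypothesis convex : forall x y z v, T x y z -> v \in cover Sf ->
  v \notin [set x; y; z] ->
  0 < det3 (u y - u x) (u z - u x) (u v - u x)
      * det3 (u y - u x) (u z - u x) (o - u x).
Hypothesis flex : forall x y z, T x y z -> dot3 (m x - m y) (u x - u y) = 0.

Let TC x y z : T x y z = T y x z.
Proof. by rewrite (setUC [set x] [set y]). Qed.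

Let TR x y z : T x y z = T y z x.
Proof. by rewrite -setUA setUC. Qed.

Let Tneq x y z : T x y z -> [/\ x != y, y != z & x != z].
Proof.
move=> /Sf3 h; split; apply/eqP => e; move: h; rewrite e.
- by rewrite setUid cards2; case: (_ != _).
- by rewrite -setUA setUid cards2; case: (_ != _).
- by rewrite setUAC setUid cards2; case: (_ != _).
Qed.

Let D x y z v := det3 (u y - u x) (u z - u x) (u v - u x).
Let Do x y z := det3 (u y - u x) (u z - u x) (o - u x).

Let TcovL x y z : T x y z -> x \in cover Sf.
Proof. by move=> h; apply/bigcupP; exists [set x; y; z]; rewrite // !inE eqxx. Qed.

Let convex' x y z v : T x y z -> v \in cover Sf -> v != x -> v != y -> v != z ->
  0 < D x y z v * Do x y z.
Proof.
move=> h hv n1 n2 n3; apply: convex => //.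
by rewrite !inE !negb_or n1 n2 n3.
Qed.

Let Do_neq0 x y z : T x y z -> Do x y z != 0.
Proof.
move=> h; have [b [nb hb _]] := Sf_edge h.
have [_ ny nx] := Tneq hb.
have hbc : b \in cover Sf by apply: (@TcovL b x y); rewrite TR.
have := convex' h hbc; rewrite eq_sym nx eq_sym ny nb => /(_ isT isT isT).
by apply: contraTneq => ->; rewrite mulr0 ltxx.
Qed.

(* Triangles oriented so as to be positive when seen from [o]. *)
Let pos x y z := T x y z && (0 < Do x y z).

Let DoR x y z : Do x y z = Do y z x.
Proof. by rewrite /Do; vec3_ring. Qed.
Let DoC x y z : Do x y z = - Do y x z.
Proof. by rewrite /Do; vec3_ring. Qed.

Let posR x y z : pos x y z = pos y z x.
Proof. by rewrite /pos TR DoR. Qed.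

Let pos_or x y z : T x y z -> pos x y z \/ pos y x z.
Proof.
move=> h; rewrite /pos (TC y) h /= (DoC y) oppr_gt0; have := Do_neq0 h.
by rewrite neq_lt => /orP[] ->; [right|left].
Qed.

Let pos_anti x y z : pos x y z -> ~~ pos y x z.
Proof.
move=> /andP[h1 h2]; rewrite negb_and -leNgt (DoC y) oppr_le0 (ltW h2).
by rewrite orbT.
Qed.

Let posT x y z : pos x y z -> T x y z.
Proof. by case/andP. Qed.

Let pos_D x y z v : pos x y z -> v \in cover Sf -> v != x -> v != y -> v != z ->
  0 < D x y z v.
Proof.
move=> /andP[h1 h2] hv n1 n2 n3.
by have := convex' h1 hv n1 n2 n3; rewrite pmulr_lgt0.
Qed.

(** By convexity [D x y a b] has the sign of [Do x y a], and [D x y b a] that of [Do x y b]. As [D]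
    changes sign when [a] and [b] are exchanged, triangles seen positively from [o] induce opposite
    directions on a common edge. *)
Let edge_opp x y a b : T x y a -> T x y b -> a != b -> pos x y a = pos y x b.
Proof.
move=> ha hb nab.
have [nxy nya nxa] := Tneq ha; have [_ nyb nxb] := Tneq hb.
have h1 : 0 < D x y a b * Do x y a.
  by apply: convex' => //; rewrite 1?eq_sym //; apply: (@TcovL b x y); rewrite TR.
have h2 : 0 < D x y b a * Do x y b.
  by apply: convex' => //; rewrite 1?eq_sym //; apply: (@TcovL a x y); rewrite TR.
rewrite /pos ha (TC y) hb /= (DoC y) oppr_gt0.
have e : D x y b a = - D x y a b by rewrite /D; vec3_ring.
move: h2; rewrite e mulNr oppr_gt0 => h2.
case: (ltgtP 0 (D x y a b)) => hD.
- by move: h1 h2; rewrite pmulr_rgt0 // pmulr_rlt0 // => -> ->.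
- move: h1 h2; rewrite nmulr_rgt0 // nmulr_rlt0 // => h1 h2.
  by rewrite ltNge (ltW h1) ltNge (ltW h2).
- by move: h1; rewrite -hD mul0r ltxx.
Qed.

Let pos_uniq x y a b : pos x y a -> pos x y b -> a = b.
Proof.
move=> ha hb; apply/eqP/contraT => nab.
have := edge_opp (posT ha) (posT hb) nab; rewrite ha => /esym.
by move/pos_anti; rewrite hb.
Qed.

Let pos_ex x y z : T x y z -> exists a, pos x y a.
Proof.
move=> h; have [b [nb hb _]] := Sf_edge h.
case: (pos_or h) => hp; first by exists z.
by exists b; rewrite (edge_opp hb h).
Qed.

Let Omega_ex : exists Om : {set V} -> 'rV[R]_3, forall t, t \in Sf ->
  forall x y, x \in t -> y \in t -> m y - m x = cross (Om t) (u y - u x).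
Proof.
suff /fin_all_exists : forall t, exists Om : 'rV[R]_3, t \in Sf ->
  forall x y, x \in t -> y \in t -> m y - m x = cross Om (u y - u x) by [].
move=> t; have [tS|tS] := boolP (t \in Sf); last by exists 0.
have [x [y [z et]]] := card3P (Sf3 tS).
rewrite et in tS *.
have [fxy fxz fyz] : [/\ dot3 (m x - m y) (u x - u y) = 0,
    dot3 (m x - m z) (u x - u z) = 0 & dot3 (m y - m z) (u y - u z) = 0].
  by split; [apply: flex tS|apply: (@flex x z y); rewrite setUAC
    |apply: (@flex y z x); rewrite -TR].
have [|p q|Om hOm] := @triangle_angular_velocity _ _ u m x y z (o - u x).
- exact: Do_neq0 tS.
- have sym r r' : dot3 (m r - m r') (u r - u r') = dot3 (m r' - m r) (u r' - u r).
    by vec3_ring.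
  have refl r : dot3 (m r - m r) (u r - u r) = 0 by vec3_ring.
  by rewrite !inE => /orP[/orP[]|] /eqP-> /orP[/orP[]|] /eqP->; rewrite ?refl //;
    rewrite sym.
by exists Om.
Qed.

Section Stress.
Variable Om : {set V} -> 'rV[R]_3.
Hypothesis OmE : forall t, t \in Sf -> forall x y, x \in t -> y \in t ->
  m y - m x = cross (Om t) (u y - u x).

(** Jump of the angular velocity across the edge from [x] to [y]; by [pos_uniq] each sum has at most
    one term, the triangle on that side. *)
Let J x y := \sum_(a | pos x y a) Om [set x; y; a]
           - \sum_(a | pos y x a) Om [set x; y; a].

Let JC x y : J y x = - J x y.
Proof. by rewrite /J opprB (setUC [set y] [set x]). Qed.

Let sumJ x : \sum_y J x y = 0.
Proof.
rewrite sumrB; apply/eqP; rewrite subr_eq0; apply/eqP.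
rewrite (exchange_big_dep xpredT) //=; apply: eq_bigr => a _.
rewrite (eq_bigl (fun y => pos a x y)) => [|y]; last by rewrite -posR.
by apply: eq_bigr => y _; rewrite setUAC.
Qed.

Let s x y := dot3 (J x y) (u y - u x) / dot3 (u y - u x) (u y - u x).

Let sC x y : s y x = s x y.
Proof.
have e : u x - u y = - (u y - u x) by rewrite opprB.
rewrite /s JC e; congr (_ / _); vec3_ring.
Qed.

Let J_non x y : ~~ [exists a, T x y a] -> J x y = 0.
Proof.
rewrite negb_exists => /forallP h.
rewrite /J !big1 ?subrr // => a /andP[]; first by rewrite TC (negPf (h a)).
by rewrite (negPf (h a)).
Qed.

(** Both triangles at an edge give its ends the same relative velocity, so the jump has zero cross
    product with the edge vector and is a multiple of it. *)
Let JE x y : J x y = s x y *: (u y - u x).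
Proof.
have [/existsP[a ha]|h] := boolP [exists a, T x y a]; last first.
  rewrite /s J_non //.
  have -> : dot3 0 (u y - u x) = 0 :> R by vec3_ring.
  by rewrite mul0r scale0r.
set e := u y - u x.
have e0 : dot3 e e != 0.
  have := Do_neq0 ha; apply: contra => e0.
  have ej j : e 0 j = 0.
    have := e0; rewrite /dot3 -!expr2 !paddr_eq0 ?addr_ge0 ?sqr_ge0 // !sqrf_eq0.
    by move: j; apply: ord3P => /andP[/andP[/eqP ? /eqP ?] /eqP ?].
  rewrite /Do -/e /det3 /dot3 !ej.
  by apply/eqP; ring.
have [b hb] := pos_ex ha.
have hc' : T y x a by rewrite TC.
have [c hc] := pos_ex hc'.
have Jbc : J x y = Om [set x; y; b] - Om [set x; y; c].
  rewrite /J (big_pred1 b) => [|z]; last first.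
    by apply/idP/eqP => [/pos_uniq|->//]; apply.
  rewrite (big_pred1 c) // => z.
  by apply/idP/eqP => [/pos_uniq|->//]; apply.
have hx z : x \in [set x; y; z] by rewrite !inE eqxx.
have hy z : y \in [set x; y; z] by rewrite !inE eqxx orbT.
have e1 := OmE (posT hb) (hx b) (hy b).
have e2 : m y - m x = cross (Om [set x; y; c]) (u y - u x).
  by apply: OmE (hx c) (hy c); rewrite TC; apply: posT.
have cr : cross (J x y) e = 0.
  rewrite Jbc -[RHS](subrr (m y - m x)) {1}e1 e2.
  by apply: row3P; vec3_ring.
have -> : J x y = (dot3 e e)^-1 *: (dot3 e e *: J x y).
  by rewrite scalerA mulVf // scale1r.
have -> : dot3 e e *: J x y = dot3 (J x y) e *: e + cross e (cross (J x y) e).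
  by apply: row3P; vec3_ring.
rewrite cr.
have -> : cross e 0 = 0 by apply: row3P; vec3_ring.
by rewrite addr0 scalerA /s mulrC.
Qed.

Let s_non x y : ~~ [exists a, T x y a] -> s x y = 0.
Proof.
move=> h; rewrite /s J_non //.
have -> : dot3 0 (u y - u x) = 0 :> R by vec3_ring.
by rewrite mul0r.
Qed.

Let w x := \sum_y s x y *: (m y - m x).

Let sum_dot_w : \sum_x dot3 (o - u x) (w x) = 0.
Proof.
pose f x y := s x y * dot3 (o - u x) (m y - m x).
have -> : \sum_x dot3 (o - u x) (w x) = \sum_x \sum_y f x y.
  apply: eq_bigr => x _; rewrite dot3_sumr; apply: eq_bigr => y _.
  by rewrite dot3Zr.
have h : \sum_x \sum_y f x y = - (\sum_x \sum_y f x y).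
  rewrite {2}exchange_big /= -sumrN; apply: eq_bigr => x _.
  rewrite -sumrN; apply: eq_bigr => y _; rewrite /f (sC x y).
  have [/existsP[a ha]|h] := boolP [exists a, T x y a]; last first.
    by rewrite s_non // !mul0r oppr0.
  rewrite -mulrN; congr (_ * _); have := flex ha => fl.
  rewrite -[LHS]subr0 -fl; vec3_ring.
by move/eqP: h; rewrite -addr_eq0 -mulr2n mulrn_eq0 /= => /eqP.
Qed.

Section Local.
Variable x : V.
Let U y := u y - u x.
Let O := o - u x.
Let nb y := [exists a, T x y a].

Let pos_nb y y' : pos x y y' -> nb y /\ nb y'.
Proof.
move=> /posT h; split; apply/existsP; first by exists y'.
by exists y; rewrite setUAC.
Qed.

Let nb_cov v : nb v -> v \in cover Sf /\ v != x.
Proof.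
move=> /existsP[a ha]; split; last by rewrite eq_sym; case: (Tneq ha).
by apply: (@TcovL v x a); rewrite TC.
Qed.

Let posU y y' v : pos x y y' -> nb v -> v != y -> v != y' ->
  0 < det3 (U y) (U y') (U v).
Proof. by move=> h /nb_cov[h1 h2] h3 h4; apply: (pos_D h). Qed.

Let posO y y' : pos x y y' -> 0 < det3 (U y) (U y') O.
Proof. by case/andP. Qed.

Let succ_ex y : nb y -> exists y', pos x y y'.
Proof. by move=> /existsP[a]; apply: pos_ex. Qed.

Let pred_ex y : nb y -> exists y', pos x y' y.
Proof.
move=> /existsP[a]; rewrite TC => /pos_ex[b hb].
by exists b; rewrite -posR.
Qed.

Let pred_uniq y y1 y2 : pos x y1 y -> pos x y2 y -> y1 = y2.
Proof. by rewrite -!(posR y x); apply: pos_uniq. Qed.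

Let pos_asym y y' : pos x y y' -> ~~ pos x y' y.
Proof. by rewrite posR => /pos_anti; rewrite -posR. Qed.

Let sumsU : \sum_y s x y *: U y = 0.
Proof. by rewrite -[RHS](sumJ x); apply: eq_bigr => y _; rewrite JE. Qed.

Section Neighbour.
Variables k k' k'' : V.
Hypothesis (pk' : pos x k k') (pk'' : pos x k'' k).

(* The functional [h] vanishes at [U k] and is positive at the other
   neighbours of [x]. Since [s x y * h y] is the divergence of [beta] on the
   cycle of neighbours, summation by parts turns [dot3 (U k) (w x)] into a sum
   of terms [- c * beta ^+ 2] with [0 < c]. *)
Let S := U k'' - U k'.
Let h v := det3 (U v) S (U k).

Let h_gt0 y : nb y -> y != k -> 0 < h y.
Proof.
move=> ny yk.
have -> : h y = det3 (U k'') (U k) (U y) + det3 (U k) (U k') (U y).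
  by rewrite /h /S; vec3_ring.
have [e|y1] := eqVneq y k''.
  have -> : det3 (U k'') (U k) (U y) = 0 by rewrite e; vec3_ring.
  rewrite add0r; apply: posU => //; rewrite e.
  by apply: contraTneq pk'' => ->; apply: pos_asym.
have [e|y2] := eqVneq y k'.
  have -> : det3 (U k) (U k') (U y) = 0 by rewrite e; vec3_ring.
  by rewrite addr0; apply: posU.
by apply: addr_gt0; apply: posU.
Qed.

Let hO_gt0 : 0 < det3 O S (U k).
Proof.
have -> : det3 O S (U k) = det3 (U k'') (U k) O + det3 (U k) (U k') O.
  by rewrite /S; vec3_ring.
by apply: addr_gt0; apply: posO.
Qed.

Let Om' y y' := Om [set x; y; y'] - Om [set x; k; k'].
Let Om'C y y' : Om' y y' = Om' y' y.
Proof. by rewrite /Om' setUAC. Qed.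

Let beta y y' := det3 (Om' y y') S (U k).
(** Velocity of [y] relative to [x], along [U k], in the frame rotating with the triangle [x k k'].
    The rotation drops out of [\sum_y s x y * g y] because [s] is in equilibrium at [x]. *)
Let g y := dot3 (U k) (m y - m x - cross (Om [set x; k; k']) (U y)).

Let gE y y' : pos x y y' -> g y = det3 (Om' y y') (U y) (U k).
Proof.
move=> /posT hT; rewrite /g (OmE hT (x := x) (y := y)) ?inE ?eqxx ?orbT //.
rewrite -/(U y) /Om'; vec3_ring.
Qed.

Let gE' y y' : pos x y' y -> g y = det3 (Om' y' y) (U y) (U k).
Proof.
move=> /posT hT; rewrite /g (OmE hT (x := x) (y := y)) ?inE ?eqxx ?orbT //.
rewrite -/(U y) /Om'; vec3_ring.
Qed.

Let sum_sg : \sum_y s x y * g y = dot3 (U k) (w x).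
Proof.
have e y : s x y * g y = dot3 (U k) (s x y *: (m y - m x))
    - dot3 (cross (U k) (Om [set x; k; k'])) (s x y *: U y).
  by rewrite !dot3Zr -mulrBr; congr (_ * _); rewrite /g; vec3_ring.
rewrite (eq_bigr _ (fun y _ => e y)) sumrB -!dot3_sumr sumsU.
rewrite [X in _ - X](_ : _ = 0) ?subr0 //; vec3_ring.
Qed.

Let sh y : s x y * h y =
  \sum_(y' | pos x y y') beta y y' - \sum_(y' | pos x y' y) beta y y'.
Proof.
have [ny|ny] := boolP (nb y); last first.
  rewrite s_non // mul0r !big1 ?subrr // => z hz.
    by case: (pos_nb hz) => _; rewrite (negPf ny).
  by case: (pos_nb hz); rewrite (negPf ny).
have [b hb] := succ_ex ny; have [c hc] := pred_ex ny.
rewrite (big_pred1 b) => [|z]; last first.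
  by apply/idP/eqP => [/pos_uniq|->//]; apply.
rewrite (big_pred1 c) => [|z]; last first.
  by apply/idP/eqP => [/pred_uniq|->//]; apply.
have eJ : s x y *: U y = Om [set x; y; b] - Om [set x; y; c].
  rewrite -JE /J (big_pred1 b) => [|z]; last first.
    by apply/idP/eqP => [/pos_uniq|->//]; apply.
  rewrite (big_pred1 c) // => z; rewrite posR.
  by apply/idP/eqP => [/pred_uniq|->//]; apply.
have -> : s x y * h y = det3 (s x y *: U y) S (U k) by rewrite /h; vec3_ring.
rewrite eJ /beta /Om'; vec3_ring.
Qed.

Let beta_k y' : pos x k y' -> beta k y' = 0.
Proof. by move=> /(pos_uniq pk') <-; rewrite /beta /Om' subrr; vec3_ring. Qed.

Let beta_k' y : pos x y k -> beta y k = 0.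
Proof.
move=> /(pred_uniq pk'') <-; have := sh k.
rewrite (big_pred1 k') => [|z]; last first.
  by apply/idP/eqP => [/pos_uniq|->//]; apply.
rewrite (big_pred1 k'') => [|z]; last first.
  by apply/idP/eqP => [/pred_uniq|->//]; apply.
(* Since [h] vanishes at [k], the flow [beta] has no divergence there, and its value zero on one
   edge at [k] carries over to the other. *)
have -> : h k = 0 by rewrite /h; vec3_ring.
rewrite beta_k // mulr0 sub0r => /esym/eqP; rewrite oppr_eq0 => /eqP <-.
by rewrite /beta Om'C.
Qed.

Let r y := g y / h y.

Let sgE y : s x y * g y =
  (\sum_(y' | pos x y y') beta y y' - \sum_(y' | pos x y' y) beta y y') * r y.
Proof.
rewrite -sh /r.
have [ny|ny] := boolP (nb y); last by rewrite s_non // !mul0r.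
have [->|yk] := eqVneq y k.
  have -> : g k = 0 by rewrite (gE pk') /Om' subrr; vec3_ring.
  by rewrite mul0r !mulr0.
by rewrite -mulrA [h y * _]mulrC divfK // gt_eqF // h_gt0.
Qed.

Let dot_w : dot3 (U k) (w x) =
  \sum_y \sum_(y' | pos x y y') beta y y' * (r y - r y').
Proof.
rewrite -sum_sg (eq_bigr _ (fun y _ => sgE y)).
under eq_bigr => y _ do rewrite mulrBl !mulr_suml.
rewrite sumrB [X in _ - X](exchange_big_dep xpredT) //= -sumrB.
apply: eq_bigr => y _; rewrite -sumrB; apply: eq_bigr => y' _.
by rewrite mulrBr /beta (Om'C y' y).
Qed.

(** Away from [k], [h y * g y' - h y' * g y] is [beta y y'] times a positive determinant, so
    [r y - r y'] is a negative multiple of [beta y y']. On the two edges at [k], where [h] vanishes,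
    [beta] is zero. *)
Let term y y' : pos x y y' ->
  beta y y' * (r y - r y') <= 0 /\
  (beta y y' * (r y - r y') = 0 -> beta y y' = 0).
Proof.
move=> hp; have [ny ny'] := pos_nb hp.
have [e|yk] := eqVneq y k.
  by move: hp; rewrite e => /beta_k ->; rewrite mul0r.
have [e|yk'] := eqVneq y' k.
  by move: hp; rewrite e => /beta_k' ->; rewrite mul0r.
have nk : nb k by case: (pos_nb pk').
have d0 : 0 < det3 (U y) (U y') (U k) by apply: posU; rewrite // eq_sym.
have h0 := h_gt0 ny yk; have h0' := h_gt0 ny' yk'.
have key : det3 (U y) (U y') (U k) * beta y y' = h y * g y' - h y' * g y.
  by rewrite (gE hp) (gE' hp) /beta /h; vec3_ring.
have -> : r y - r y' =
    - (det3 (U y) (U y') (U k) * beta y y') / (h y * h y').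
  by rewrite key /r; field; rewrite ?gt_eqF.
set c := det3 _ _ _ in d0 *.
have -> : beta y y' * (- (c * beta y y') / (h y * h y')) =
    - (c / (h y * h y') * beta y y' ^+ 2).
  by field; rewrite ?gt_eqF.
have c0 : 0 < c / (h y * h y') by rewrite divr_gt0 ?mulr_gt0.
split; first by rewrite oppr_le0 mulr_ge0 ?sqr_ge0 // ltW.
by move/eqP; rewrite oppr_eq0 mulf_eq0 (gt_eqF c0) /= sqrf_eq0 => /eqP.
Qed.

Lemma neighbour_dot_le0 : dot3 (U k) (w x) <= 0.
Proof.
rewrite dot_w; apply: sumr_le0 => y _; apply: sumr_le0 => y' hp.
by case: (term hp).
Qed.

Lemma neighbour_dot_eq0 : dot3 (U k) (w x) = 0 -> forall y, s x y = 0.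
Proof.
rewrite dot_w => h0.
have hb y y' : pos x y y' -> beta y y' = 0.
  move=> hp; case: (term hp) => _; apply.
  have inner z : \sum_(y' | pos x z y') beta z y' * (r z - r y') <= 0.
    by apply: sumr_le0 => z' hz; case: (term hz).
  have /eqP : - (\sum_y \sum_(y' | pos x y y') beta y y' * (r y - r y')) = 0.
    by rewrite h0 oppr0.
  rewrite -sumrN psumr_eq0 => [|z _]; last by rewrite oppr_ge0.
  move=> /allP/(_ y (mem_index_enum y)) /=.
  rewrite -sumrN psumr_eq0 => [|z hz]; last by rewrite oppr_ge0; case: (term hz).
  by move=> /allP/(_ y' (mem_index_enum y')) /=; rewrite hp oppr_eq0 => /eqP.
have hs y : y != k -> s x y = 0.
  move=> yk; have [ny|ny] := boolP (nb y); last by rewrite s_non.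
  have := sh y; rewrite [X in X - _]big1; last by move=> y' /hb.
  rewrite big1 => [/eqP|y' hp]; last by rewrite /beta Om'C; apply: hb.
  by rewrite subrr mulf_eq0 (gt_eqF (h_gt0 ny yk)) orbF => /eqP.
move=> y; have [->|/hs//] := eqVneq y k.
have := sumsU; rewrite (bigD1 k) //= big1 => [|z /hs ->]; last by rewrite scale0r.
rewrite addr0 => /eqP; rewrite scaler_eq0 => /orP[/eqP//|/eqP Uk].
have := posO pk'; have -> : det3 (U k) (U k') O = 0 by rewrite Uk; vec3_ring.
by rewrite ltxx.
Qed.

(** Fanning the polygon of neighbours from [k] cuts the cone at [x] into three-sided cones; the one
    found here contains the direction [O]. The quotient [t] strictly decreases from a neighbour to
    the next while both differ from [k], so the successor of a minimizer among the nonnegative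
    values is negative. *)
Lemma sign_change_ex : exists y y', [/\ pos x y y', 0 <= det3 (U y) O (U k)
  & det3 (U y') O (U k) < 0].
Proof.
pose P y := [&& nb y, y != k & 0 <= det3 (U y) O (U k)].
have Pk' : P k'.
  apply/and3P; split; first by case: (pos_nb pk').
    by apply: contraTneq pk' => ->; apply/negP => hp; have := pos_asym hp; rewrite hp.
  have -> : det3 (U k') O (U k) = det3 (U k) (U k') O by vec3_ring.
  by rewrite ltW // posO.
pose t y := det3 (U y) O (U k) / h y.
case: (Order.TotalTheory.arg_minP t Pk') => y /and3P[ny yk ty] ymin.
have [y' hp] := succ_ex ny.
exists y, y'; split=> //; rewrite ltNge; apply/negP => ty'.
have [e|yk'] := eqVneq y' k.
  move: hp ty; rewrite e => /(pred_uniq pk'') <-.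
  have -> : det3 (U k'') O (U k) = - det3 (U k'') (U k) O by vec3_ring.
  by rewrite leNgt oppr_lt0 posO.
have ny' : nb y' by case: (pos_nb hp).
have := ymin y'; rewrite /P ny' yk' ty' => /(_ isT).
rewrite /t ler_pdivrMr ?h_gt0 // mulrAC ler_pdivlMr ?h_gt0 // leNgt => /negP; apply.
have nk : nb k by case: (pos_nb pk').
have d0 : 0 < det3 (U y) (U y') (U k) by apply: posU; rewrite // eq_sym.
rewrite -subr_gt0; have := mulr_gt0 d0 hO_gt0; congr (0 < _).
by rewrite /h; vec3_ring.
Qed.

End Neighbour.

(** [O] is a nonnegative combination of [U y], [U y'] and [U k], each of which pairs nonpositively
    with [w x]. The coefficient of [U k] is positive, so in case of equality [neighbour_dot_eq0]
    applies to [k]. *)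
Lemma dot_jump_stress_le0 :
  dot3 O (w x) <= 0 /\ (dot3 O (w x) = 0 -> forall y, s x y = 0).
Proof.
have [/existsP[k nk]|hn] := boolP [exists k, nb k]; last first.
  have s0 y : s x y = 0 by apply: s_non; move/existsPn: hn; apply.
  split=> //; rewrite /w big1 => [|y _]; last by rewrite s0 scale0r.
  by rewrite [dot3 _ _](_ : _ = 0) //; vec3_ring.
have [k' pk'] := succ_ex nk; have [k'' pk''] := pred_ex nk.
have [y [y' [hp h1 h2]]] := sign_change_ex pk' pk''.
have le0 z : nb z -> dot3 (U z) (w x) <= 0.
  by move=> nz; have [b hb] := succ_ex nz; have [c hc] := pred_ex nz;
     exact: neighbour_dot_le0 hb hc.
have [ny ny'] := pos_nb hp.
have yk : y != k.
  apply: contraTneq h2 => e; move: hp; rewrite e => hp; rewrite -leNgt.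
  have -> : det3 (U y') O (U k) = det3 (U k) (U y') O by vec3_ring.
  by rewrite ltW // posO.
have yk' : y' != k.
  apply: contraTneq h2 => ->.
  by rewrite [det3 _ _ _](_ : _ = 0) ?ltxx //; vec3_ring.
have d0 : 0 < det3 (U y) (U y') (U k) by apply: posU; rewrite // eq_sym.
have c0 := posO hp.
have key : det3 (U y) (U y') (U k) * dot3 O (w x) =
    - det3 (U y') O (U k) * dot3 (U y) (w x)
    + det3 (U y) O (U k) * dot3 (U y') (w x)
    + det3 (U y) (U y') O * dot3 (U k) (w x) by vec3_ring.
have l1 : - det3 (U y') O (U k) * dot3 (U y) (w x) <= 0.
  by rewrite pmulr_rle0 ?oppr_gt0 // le0.
have l2 : det3 (U y) O (U k) * dot3 (U y') (w x) <= 0.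
  by rewrite mulr_ge0_le0 // le0.
have l3 : det3 (U y) (U y') O * dot3 (U k) (w x) <= 0.
  by rewrite pmulr_rle0 // le0.
split.
  rewrite -(pmulr_rle0 _ d0) key; lra.
move=> e0; apply: (neighbour_dot_eq0 pk' pk''); apply/eqP.
move: key; rewrite e0 mulr0 => key.
have : det3 (U y) (U y') O * dot3 (U k) (w x) = 0 by lra.
by move/eqP; rewrite mulf_eq0 (gt_eqF c0).
Qed.

End Local.

Lemma jump_stress_eq0 x y : s x y = 0.
Proof.
have h x0 : dot3 (o - u x0) (w x0) <= 0 by case: (dot_jump_stress_le0 x0).
have /eqP : - (\sum_x dot3 (o - u x) (w x)) = 0 by rewrite sum_dot_w oppr0.
rewrite -sumrN psumr_eq0 => [|z _]; last by rewrite oppr_ge0.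
move=> /allP/(_ x (mem_index_enum x)) /=; rewrite oppr_eq0 => /eqP.
by case: (dot_jump_stress_le0 x) => _ H /H.
Qed.

Lemma rigid_of_angular_velocities x y a b : T x y a -> T x y b ->
  dot3 (m a - m b) (u a - u b) = 0.
Proof.
move=> ha hb.
have [->|nab] := eqVneq a b; first by rewrite !subrr; vec3_ring.
have J0 : J x y = 0 by rewrite JE jump_stress_eq0 scale0r.
wlog hp : a b ha hb nab / pos x y a.
  move=> H; case: (pos_or ha) => hp; first exact: (H a b).
  have -> : dot3 (m a - m b) (u a - u b) = dot3 (m b - m a) (u b - u a).
    by vec3_ring.
  by apply: (H b a); rewrite 1?eq_sym // (edge_opp hb ha) // eq_sym.
have hq : pos y x b by rewrite -(edge_opp ha hb).
move: J0; rewrite /J (big_pred1 a) => [|z]; last first.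
  by apply/idP/eqP => [/pos_uniq|->//]; apply.
rewrite (big_pred1 b) => [/eqP|z]; last first.
  by apply/idP/eqP => [/pos_uniq|->//]; apply.
rewrite subr_eq0 => /eqP eOm.
have hx c : x \in [set x; y; c] by rewrite !inE eqxx.
have hc c : c \in [set x; y; c] by rewrite !inE eqxx orbT.
have ea := OmE ha (hx a) (hc a); have eb := OmE hb (hx b) (hc b).
have -> : m a - m b = (m a - m x) - (m b - m x) by rewrite opprB addrA subrK.
by rewrite ea eb eOm; vec3_ring.
Qed.

End Stress.

Lemma convex_surface_rigid x y a b : T x y a -> T x y b ->
  dot3 (m a - m b) (u a - u b) = 0.
Proof. by have [Om h] := Omega_ex; apply: (rigid_of_angular_velocities h). Qed.

End ConvexSurface.

(** * Generic surfaces in characteristic two *)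

Section CharTwo.
Variables (K : fieldType) (V : finType) (Sf : {set {set V}}).
Hypothesis K2 : 2%N \in [pchar K].
Hypothesis Sf3 : forall t, t \in Sf -> #|t| = 3%N.
Hypothesis Sf_edge : forall e : {set V}, #|e| = 2%N ->
  #|[set t in Sf | e \subset t]| \in [:: 0; 2]%N.
Variables (a mu : V -> 'rV[K]_3) (Om : {set V} -> 'rV[K]_3).
Hypothesis OmE : forall t, t \in Sf -> forall x y, x \in t -> y \in t ->
  mu y - mu x = cross (Om t) (a y - a x).
Hypothesis a_neq : forall x y, x != y -> a x 0 i0 != a y 0 i0.

(** In characteristic two sums are differences, so neither [J] nor [D] needs an orientation of
    triangles or edges. *)
Let J (e : {set V}) := \sum_(t in Sf | e \subset t) Om t.
Let D (e : {set V}) := \sum_(v in e) a v.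
Let s (e : {set V}) := J e 0 i0 / D e 0 i0.

Let oppK2 (x : K) : - x = x.
Proof. exact: oppr_pchar2. Qed.

Let addK2 (x : K) : x + x = 0.
Proof. exact: addrr_pchar2. Qed.

Let pairs_sum (t : {set V}) v (c : K) : #|t| = 3%N ->
  \sum_(e : {set V} | [&& #|e| == 2%N, e \subset t & v \in e]) c = 0.
Proof.
move=> t3; rewrite sumr_const.
have [vt|vt] := boolP (v \in t); last first.
  rewrite (_ : #|_| = 0%N) ?mulr0n //; apply: eq_card0 => e.
  apply/negbTE; rewrite unfold_in; apply/negP => /and3P[_ /subsetP h /h].
  by rewrite (negPf vt).
rewrite (_ : #|_| = 2%N) ?mulr2n //.
have c2 : #|(fun w => t :\ w) @: (t :\ v)| = 2%N.
  rewrite card_in_imset => [|x y /setD1P[_ xt] /setD1P[_ yt] /setP/(_ x)].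
    by move: t3; rewrite (cardsD1 v) vt => -[].
  by rewrite !inE eqxx xt andbT /=; case: eqVneq.
apply: etrans c2; apply: eq_card => e; rewrite unfold_in; apply/idP/imsetP.
  move=> /and3P[/eqP e2 et ve].
  have /cards1P[w ew] : #|t :\: e| == 1%N.
    by rewrite cardsD (setIidPr et) t3 e2.
  have /setDP[wt we] : w \in t :\: e by rewrite ew inE.
  exists w; first by rewrite !inE wt andbT; apply: contraNneq we => ->.
  by rewrite -ew setDDr setDv set0U (setIidPr et).
move=> [w /setD1P[wv wt] ->]; rewrite subsetDl !inE (eq_sym v) wv vt !andbT.
by move: t3; rewrite (cardsD1 w) wt add1n => -[->].
Qed.

Let edge_ends (e : {set V}) : #|e| = 2%N -> exists x y, x != y /\ e = [set x; y].
Proof. by move=> /eqP/cards2P. Qed.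

Let DE x y : x != y -> D [set x; y] = a y - a x.
Proof.
move=> xy; rewrite /D big_setU1 ?inE // big_set1.
by apply/rowP => j; rewrite !mxE oppK2 addrC.
Qed.

Let OmD t (e : {set V}) : t \in Sf -> e \subset t -> #|e| = 2%N ->
  cross (Om t) (D e) = \sum_(v in e) mu v.
Proof.
move=> tS et /edge_ends[x [y [xy ee]]]; rewrite ee DE // -OmE //.
- rewrite big_setU1 ?inE // big_set1.
  by apply/rowP => j; rewrite !mxE oppK2 addrC.
- by apply: (subsetP et); rewrite ee !inE eqxx.
- by apply: (subsetP et); rewrite ee !inE eqxx orbT.
Qed.

(** Quantified over the target monoid because it is applied to vectors, to products of their
    coordinates and, with indicators, to the counting of triangles. *)
Let JP (e : {set V}) : #|e| = 2%N ->
  (forall C : nmodType, forall F : {set V} -> C,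
    \sum_(t in Sf | e \subset t) F t = 0) \/ exists t t', [/\ t \in Sf, t' \in Sf,
  e \subset t, e \subset t' & forall C : nmodType, forall F : {set V} -> C,
   \sum_(t in Sf | e \subset t) F t = F t + F t'].
Proof.
move=> e2; have := Sf_edge e2; rewrite !inE => /orP[/eqP/cards0_eq h|].
  left=> C F; rewrite big_pred0 // => t.
  by have /setP/(_ t) := h; rewrite !inE.
move=> /cards2P[t [t' [tt h]]]; right; exists t, t'.
have ht : t \in [set t; t'] by rewrite !inE eqxx.
have ht' : t' \in [set t; t'] by rewrite !inE eqxx orbT.
rewrite -h !inE in ht ht'; have [/andP[? ?] /andP[? ?]] := (ht, ht').
split=> // C F; rewrite (eq_bigl (fun z => z \in [set t; t'])) => [|z].
  by rewrite big_setU1 ?inE // big_set1.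
by rewrite -h inE.
Qed.

Let D0 (e : {set V}) : #|e| = 2%N -> D e 0 i0 != 0.
Proof.
by move=> /edge_ends[x [y [xy ->]]]; rewrite DE // !mxE subr_eq0 a_neq // eq_sym.
Qed.

Let JE (e : {set V}) : #|e| = 2%N -> J e = s e *: D e.
Proof.
move=> e2; have D0e := D0 e2.
have [J0|[t [t' [tS t'S et et' h]]]] := JP e2.
  by rewrite /s /J J0 mxE mul0r scale0r.
have cr : cross (J e) (D e) = 0.
  rewrite /J h; have h1 := OmD tS et e2; have h2 := OmD t'S et' e2.
  have -> : cross (Om t + Om t') (D e) = cross (Om t) (D e) + cross (Om t') (D e).
    by apply: row3P; vec3_ring.
  by rewrite h1 h2; apply/rowP => j; rewrite !mxE addK2.
have c1 : cross (J e) (D e) 0 i1 = 0 by rewrite cr mxE.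
have c2 : cross (J e) (D e) 0 i2 = 0 by rewrite cr mxE.
move: c1 c2; rewrite /cross !vec3E => /eqP; rewrite subr_eq0 => /eqP c1 /eqP.
rewrite subr_eq0 => /eqP c2.
apply: row3P; rewrite !mxE /s; first by rewrite divfK.
  by rewrite mulrAC c2 mulfK.
by rewrite mulrAC -c1 mulfK.
Qed.

(* The jumps [J] of angular velocity form an equilibrium stress [s]; in
   characteristic two its quadratic pairing with the velocities takes this
   form, in which [s] only enters through squares. *)
Lemma char2_identity : \sum_(e : {set V} | #|e| == 2%N)
  s e ^+ 2 * (D e 0 i0 * D e 0 i1 * D e 0 i2) = 0.
Proof.
have term (e : {set V}) : #|e| = 2%N -> s e ^+ 2 * (D e 0 i0 * D e 0 i1 * D e 0 i2) =
    \sum_(t in Sf | e \subset t) Om t 0 i0 * Om t 0 i1 * D e 0 i2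
    + J e 0 i2 * \sum_(v in e) mu v 0 i2.
  move=> e2; have eJ := JE e2.
  have J0 : J e 0 i0 = s e * D e 0 i0 by rewrite eJ mxE.
  have J1 : J e 0 i1 = s e * D e 0 i1 by rewrite eJ mxE.
  have J2 : J e 0 i2 = s e * D e 0 i2 by rewrite eJ mxE.
  have -> : s e ^+ 2 * (D e 0 i0 * D e 0 i1 * D e 0 i2) =
    J e 0 i0 * J e 0 i1 * D e 0 i2 by rewrite J0 J1; ring.
  have [Je|[t [t' [tS t'S et et' h]]]] := JP e2.
    by rewrite /J !Je !mxE !mul0r addr0.
  have := OmD tS et e2 => /rowP/(_ i2); rewrite summxE => <-.
  rewrite (h K (fun t => Om t 0 i0 * Om t 0 i1 * D e 0 i2)) /cross !vec3E J2.
  have -> : s e * D e 0 i2 * (Om t 0 i0 * D e 0 i1 - Om t 0 i1 * D e 0 i0) =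
    (Om t 0 i0 * J e 0 i1 - Om t 0 i1 * J e 0 i0) * D e 0 i2.
    by rewrite J0 J1; ring.
  rewrite /J (h _ Om) !mxE oppK2.
  set z := Om t 0 i0 * Om t 0 i1 * D e 0 i2.
  by rewrite -[LHS]addr0 -(addK2 z) /z; ring.
rewrite (eq_bigr _ (fun e he => term e (eqP he))) big_split /=.
(* Each vertex of a triangle lies on two of its edges, so the edge vectors of a triangle sum to
   zero. *)
have -> : \sum_(e : {set V} | #|e| == 2%N)
    \sum_(t in Sf | e \subset t) Om t 0 i0 * Om t 0 i1 * D e 0 i2 = 0.
  rewrite (exchange_big_dep (mem Sf)) /= => [|e t _ /andP[]//].
  apply: big1 => t tS.
  rewrite (eq_bigl (fun e : {set V} => (#|e| == 2%N) && (e \subset t))); last first.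
    by move=> e; rewrite tS.
  rewrite -mulr_sumr.
  suff -> : \sum_(e : {set V} | (#|e| == 2%N) && (e \subset t)) D e 0 i2 = 0.
    by rewrite mulr0.
  rewrite (eq_bigr (fun e : {set V} => \sum_(v in e) a v 0 i2)); last first.
    by move=> e _; rewrite /D summxE.
  rewrite (exchange_big_dep xpredT) //=; apply: big1 => v _.
  rewrite -[RHS](pairs_sum v (a v 0 i2) (Sf3 tS)).
  by apply: eq_bigl => e; rewrite andbA.
rewrite add0r.
rewrite (eq_bigr (fun e : {set V} => \sum_(v in e) J e 0 i2 * mu v 0 i2)); last first.
  by move=> e _; rewrite mulr_sumr.
rewrite (exchange_big_dep xpredT) //=; apply: big1 => v _.
rewrite -mulr_suml.
(* Every triangle at [v] is met along two edges, so the jumps at [v] are in equilibrium. *)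
suff -> : \sum_(e : {set V} | (#|e| == 2%N) && (v \in e)) J e 0 i2 = 0.
  by rewrite mul0r.
rewrite (eq_bigr (fun e : {set V} => \sum_(t in Sf | e \subset t) Om t 0 i2)).
  rewrite (exchange_big_dep (mem Sf)) /= => [|e t _ /andP[]//].
  apply: big1 => t tS; rewrite -[RHS](pairs_sum v (Om t 0 i2) (Sf3 tS)).
  by apply: eq_bigl => e; rewrite tS /= [RHS]andbCA andbC.
by move=> e _; rewrite /J summxE.
Qed.

Lemma char2_stress_free : (forall e : {set V}, #|e| = 2%N -> s e = 0) ->
  forall t t' x y, t \in Sf -> t' \in Sf -> x != y -> x \in t -> y \in t ->
  x \in t' -> y \in t' -> Om t = Om t'.
Proof.
move=> hs t t' x y tS t'S xy xt yt xt' yt'.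
have e2 : #|[set x; y]| = 2%N by rewrite cards2 xy.
have sub (z : {set V}) : x \in z -> y \in z -> [set x; y] \subset z.
  by move=> hx hy; apply/subsetP => v; rewrite !inE => /orP[]/eqP->.
have [->//|tt] := eqVneq t t'.
have [h|[t1 [t2 [t1S t2S et1 et2 h]]]] := JP e2.
  have := h K (fun z => (z == t)%:R); rewrite (bigD1 t) ?tS ?sub //= eqxx.
  rewrite big1 => [|z /andP[_ /negPf->//]].
  by move/eqP; rewrite addr0 oner_eq0.
have := JE e2; rewrite hs // scale0r /J (h _ Om) => /eqP.
rewrite addr_eq0 => /eqP e12.
have {}e12 : Om t1 = Om t2 by rewrite e12; apply/rowP => j; rewrite mxE oppK2.
have in12 (z : {set V}) : z \in Sf -> [set x; y] \subset z -> z = t1 \/ z = t2.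
  move=> zS ez; have [/eqP z1|z1] := boolP (z == t1); first by left.
  have [/eqP z2|z2] := boolP (z == t2); first by right.
  (* For the indicator of [z] the sum over the triangles at the edge is at least one, while its
     expression through [t1] and [t2] is zero. *)
  have := h nat (fun v => (v == z)%N : nat).
  by rewrite (bigD1 z) ?zS ?ez //= eqxx eq_sym (negPf z1) eq_sym (negPf z2).
have [->|->] := in12 t tS (sub t xt yt);
 have [->|->] := in12 t' t'S (sub t' xt' yt') => //.
Qed.

End CharTwo.

(** * Independent coordinates over the field with two elements *)

Lemma frac_denom (R : idomainType) (x : {fraction R}) :
  exists2 q : R, q != 0 & exists f, tofrac q * x = tofrac f.
Proof.
elim/quotW: x => r; exists (frac r).2; first exact: denom_ratioP.
exists (frac r).1; unlock FracField.tofrac; rewrite -[LHS]FracField.pi_mul.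
apply/eqmodP; rewrite /= FracField.equivfE /FracField.mulf.
by rewrite !numden_Ratio ?oner_neq0 ?mul1r ?mulr1 ?denom_ratioP // mulrC.
Qed.

Lemma frac_common_denom (R : idomainType) (I : finType) (x : I -> {fraction R}) :
  exists2 q : R, q != 0 & exists f, forall i, tofrac q * x i = tofrac (f i).
Proof.
have /fin_all_exists[d hd] : forall i, exists d : R * R,
    d.1 != 0 /\ tofrac d.1 * x i = tofrac d.2.
  by move=> i; have [q q0 [f h]] := frac_denom (x i); exists (q, f).
exists (\prod_i (d i).1).
  by apply/prodf_neq0 => i _; case: (hd i).
exists (fun i => \prod_(j | j != i) (d j).1 * (d i).2) => i.
case: (hd i) => _ h.
by rewrite (bigD1 i) //= !tofracM -h; ring.
Qed.

Lemma mderiv_sum n (S : nzRingType) i I (r : seq I) (Q : pred I) (F : I -> {mpoly S[n]}) :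
  (\sum_(k <- r | Q k) F k)^`M(i) = \sum_(k <- r | Q k) (F k)^`M(i).
Proof. exact: linear_sum. Qed.

Section Generic.
Variable n : nat.
Notation P := {mpoly 'F_2[n * 3]}.
Notation K := {fraction P}.

Lemma pchar_F2mpoly : 2%N \in [pchar P].
Proof.
apply/andP; split=> //.
have -> : 2%:R = (2%:R : 'F_2)%:MP_[n * 3] :> P by rewrite mpolyC_nat.
by rewrite (_ : 2%:R = 0 :> 'F_2) ?mpolyC0 //; apply/eqP.
Qed.

Lemma pchar_F2frac : 2%N \in [pchar K].
Proof.
apply/andP; split=> //; rewrite -(rmorph_nat (@tofrac P)).
by rewrite (pcharf0 pchar_F2mpoly) rmorph0.
Qed.

Definition gen_pt (v : 'I_n) : 'rV[P]_3 := \row_j 'X_(mxvec_index v j).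
Definition frac_pt (v : 'I_n) : 'rV[K]_3 := \row_j tofrac (gen_pt v 0 j).

Lemma mderiv_gen_pt v w j k :
  (gen_pt v 0 j)^`M(mxvec_index w k) = ((v == w) && (j == k))%:R.
Proof.
rewrite mxE mderivX mnm1E.
have -> : (mxvec_index v j == mxvec_index w k) = (v == w) && (j == k).
  apply/eqP/andP => [|[/eqP-> /eqP->//]].
  move=> /(congr1 (fun x => enum_val (cast_ord (esym (mxvec_cast n 3)) x))).
  by rewrite /mxvec_index !cast_ordK !enum_rankK => -[-> ->].
have [/andP[/eqP-> /eqP->]|_] := boolP (_ && _).
  by rewrite (_ : (_ - _)%MM = 0%MM) ?mpolyX0 ?scale1r //; apply/mnmP => i; rewrite mnmBE subnn mnm0E.
by rewrite scale0r.
Qed.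

Lemma mderiv_sqr i (f h : P) : (f ^+ 2 * h)^`M(i) = f ^+ 2 * h^`M(i).
Proof.
rewrite mderivM expr2 mderivM [f^`M(i) * f]mulrC.
by rewrite (addrr_pchar2 pchar_F2mpoly) mul0r add0r.
Qed.

Lemma squarefree_indep (s : {set 'I_n} -> K) :
  \sum_(e : {set 'I_n} | #|e| == 2%N) s e ^+ 2 *
     ((\sum_(v in e) frac_pt v) 0 i0 * (\sum_(v in e) frac_pt v) 0 i1
      * (\sum_(v in e) frac_pt v) 0 i2) = 0 ->
  forall e : {set 'I_n}, #|e| = 2%N -> s e = 0.
Proof.
move=> h.
(* Multiplying by [q ^+ 2] turns the relation into one between polynomials in which the coefficients
   are still squares. *)
have [q q0 [f hf]] := frac_common_denom s.
pose H (e : {set 'I_n}) j := \sum_(v in e) gen_pt v 0 j.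
have HE (e : {set 'I_n}) j : (\sum_(v in e) frac_pt v) 0 j = tofrac (H e j).
  by rewrite summxE rmorph_sum; apply: eq_bigr => v _; rewrite mxE.
have h2 : \sum_(e : {set 'I_n} | #|e| == 2%N)
    f e ^+ 2 * (H e i0 * H e i1 * H e i2) = 0.
  apply/eqP; rewrite -tofrac_eq0 rmorph_sum /=; apply/eqP.
  apply: etrans (etrans _ (congr1 (fun z => tofrac q ^+ 2 * z) h)) (mulr0 _).
  rewrite /= mulr_sumr; apply: eq_bigr => e _.
  by rewrite !HE !rmorphM /= -!hf; ring.
move=> e /eqP/cards2P[x [y [xy ee]]].
have dH (z : {set 'I_n}) j w k : (H z j)^`M(mxvec_index w k) = ((w \in z) && (j == k))%:R.
  rewrite /H mderiv_sum.
  under eq_bigr => v _ do rewrite mderiv_gen_pt.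
  have [wz|wz] := boolP (w \in z).
    rewrite (bigD1 w) //= eqxx big1 ?addr0 // => v /andP[_ /negPf->//].
  by rewrite big1 // => v vz; case: eqP => // e'; rewrite -e' vz in wz.
have dN (k : nat) i : (k%:R : P)^`M(i) = 0 by rewrite -mpolyC_nat mderivC.
(* Two variables belong to [x] and the third to [y], so the derivative is 1 on sets containing both
   and 0 otherwise; among the pairs only [e] survives. *)
have dHHH (z : {set 'I_n}) : (H z i0 * H z i1 * H z i2)^`M(mxvec_index x i0)^`M(mxvec_index x i1)
    ^`M(mxvec_index y i2) = ((x \in z) && (y \in z))%:R.
  rewrite !(mderivM, dH, mderivD, mderiv0, dN) /= !andbF !andbT /=.
  by case: (x \in z); case: (y \in z); rewrite /=; ring.
have step i (G : {set 'I_n} -> P) :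
    \sum_(z : {set 'I_n} | #|z| == 2%N) f z ^+ 2 * G z = 0 ->
    \sum_(z : {set 'I_n} | #|z| == 2%N) f z ^+ 2 * (G z)^`M(i) = 0.
  move=> /(congr1 (mderiv i)); rewrite mderiv_sum mderiv0 => h3.
  by rewrite -[RHS]h3; apply: eq_bigr => z _; rewrite mderiv_sqr.
have := step (mxvec_index y i2) _ (step (mxvec_index x i1) _ (step (mxvec_index x i0) _ h2)).
under eq_bigr => z _ do rewrite dHHH.
rewrite (bigD1 e) /= ?ee ?cards2 ?xy // -ee big1 => [|z /andP[z2 ze]].
  rewrite addr0 !ee !inE !eqxx orbT mulr1 -ee => /eqP; rewrite sqrf_eq0 => /eqP fe.
  by apply/eqP; have /eqP := hf e; rewrite fe rmorph0 mulf_eq0 tofrac_eq0 (negPf q0).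
have [xz|] := boolP (x \in z); last by rewrite mulr0.
have [yz|] := boolP (y \in z); last by rewrite mulr0.
case/eqP: ze; apply/eqP; rewrite eq_sym eqEcard (eqP z2) ee cards2 xy leqnn andbT.
by apply/subsetP => v; rewrite !inE => /orP[]/eqP->.
Qed.
End Generic.

Section GenericSurface.
Variables (n : nat) (Sf : {set {set 'I_n}}).
Notation P := {mpoly 'F_2[n * 3]}.
Notation K := {fraction P}.
Hypothesis Sf3 : forall t, t \in Sf -> #|t| = 3%N.
Hypothesis Sf_edge : forall e : {set 'I_n}, #|e| = 2%N ->
  #|[set t in Sf | e \subset t]| \in [:: 0; 2]%N.
Variable mu : 'I_n -> 'rV[K]_3.
Let a := @frac_pt n.
Hypothesis flex : forall t x y, t \in Sf -> x \in t -> y \in t ->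
  dot3 (mu x - mu y) (a x - a y) = 0.

(** With the third basis vector as transversal, [a_indep] concerns a two by two minor, whose
    derivative in a coordinate of [y] and another of [z] is 1. *)
Let w : 'rV[K]_3 := vec3 0 0 1.

Let aE v j : a v 0 j = tofrac (gen_pt v 0 j).
Proof. by rewrite mxE. Qed.

Let a_neq x y : x != y -> a x 0 i0 != a y 0 i0.
Proof.
move=> xy; rewrite !aE tofrac_eq; apply/eqP.
move/(congr1 (mderiv (mxvec_index x i0))); rewrite !mderiv_gen_pt eqxx eq_sym.
by rewrite (negPf xy); apply/eqP; rewrite oner_neq0.
Qed.

Let a_indep x y z : x != y -> y != z -> x != z ->
  det3 (a y - a x) (a z - a x) w != 0.
Proof.
move=> xy yz xz.
have -> : det3 (a y - a x) (a z - a x) w = tofrac (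
    (gen_pt y 0 i0 - gen_pt x 0 i0) * (gen_pt z 0 i1 - gen_pt x 0 i1)
    - (gen_pt y 0 i1 - gen_pt x 0 i1) * (gen_pt z 0 i0 - gen_pt x 0 i0)).
  rewrite rmorphB !rmorphM !rmorphB /=.
  rewrite -!aE /det3 /dot3 /cross /w !vec3E !mxE; ring.
rewrite tofrac_eq0; apply/eqP.
move/(congr1 (mderiv (mxvec_index y i0))).
move/(congr1 (mderiv (mxvec_index z i1))); rewrite !mderiv0.
rewrite !(mderivB, mderivM, mderiv_gen_pt, mderivD) /= !andbF !andbT.
rewrite !eqxx (negPf xy) (negPf xz) (negPf yz) (eq_sym z y) (negPf yz) /=.
rewrite -!mpolyC_nat !mderivC mpolyC0 !(mul0r, mulr0, subr0, add0r, addr0, mul1r, mulr1).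
by apply/eqP; rewrite mpolyC1 oner_neq0.
Qed.

Lemma generic_surface_propagate t t' x y : t \in Sf -> t' \in Sf -> x != y ->
  x \in t -> y \in t -> x \in t' -> y \in t' ->
  (forall v, v \in t -> mu v = 0) -> forall v, v \in t' -> mu v = 0.
Proof.
have /fin_all_exists[Om OmE] : forall t, exists Om : 'rV[K]_3, t \in Sf ->
    forall x y, x \in t -> y \in t -> mu y - mu x = cross Om (a y - a x).
  move=> {t t'} {x y} t; have [tS|tS] := boolP (t \in Sf); last by exists 0.
  have [x [y [z et]]] := card3P (Sf3 tS).
  have [xt yt zt] : [/\ x \in t, y \in t & z \in t].
    by rewrite et !inE !eqxx ?orbT.
  have [xy yz xz] : [/\ x != y, y != z & x != z].
    move: (Sf3 tS); rewrite et => h; split; apply/eqP => e; move: h; rewrite e.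
    - by rewrite setUid cards2; case: (_ != _).
    - by rewrite -setUA setUid cards2; case: (_ != _).
    - by rewrite setUAC setUid cards2; case: (_ != _).
  have [|p q hp hq|Om hOm] := @triangle_angular_velocity _ _ a mu x y z w.
  - exact: a_indep.
  - by apply: flex tS _ _; rewrite et.
  by exists Om => _; rewrite et.
move=> tS t'S xy xt yt xt' yt' mu0 v vt'.
have eOm : Om t = Om t'.
  have hs := char2_stress_free (pchar_F2frac n) Sf_edge OmE a_neq.
  apply: (hs _ t t' x y) => //; apply: squarefree_indep.
  exact: (char2_identity (pchar_F2frac n) Sf3 Sf_edge OmE a_neq).
have Om0 : Om t = 0.
  have [z zt [xz yz]] : exists2 z, z \in t & x != z /\ y != z.
    have /card_gt0P[z] : (0 < #|t :\ x :\ y|)%N.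
      have := Sf3 tS; rewrite (cardsD1 x) xt (cardsD1 y) !inE eq_sym xy yt.
      by rewrite !add1n => -[->].
    rewrite !inE => /and3P[h1 h2 zt]; exists z => //.
    by rewrite eq_sym h2 eq_sym h1.
  apply: (cross_eq0 (a_indep xy yz xz)); first by rewrite -OmE // !mu0 // subrr.
  by rewrite -OmE // !mu0 // subrr.
have := OmE t' t'S x v xt' vt'; rewrite -eOm Om0 (mu0 x) // subr0 => ->.
by apply: row3P; vec3_ring.
Qed.

End GenericSurface.

(** * Transfer to generic real points *)

Section Transfer.
Variables (R : numFieldType) (N : nat) (q : 'I_N -> R).
Hypothesis q_indep : forall f : {mpoly rat[N]}, (map_mpoly ratr f).@[q] = 0 :> R -> f = 0.

Definition int_eval (K : comNzRingType) (h : 'I_N -> K) : {mpoly int[N]} -> K :=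
  mmap intr h.

Lemma int_eval_generic (g : {mpoly int[N]}) : int_eval q g = 0 -> g = 0.
Proof.
move=> g0.
have inj : injective (intr : int -> rat) := @intr_inj _.
have : map_mpoly intr g = 0 :> {mpoly rat[N]}.
  apply: q_indep; rewrite -g0 /int_eval.
  pose F (p : {mpoly int[N]}) : R := (map_mpoly ratr (map_mpoly intr p : {mpoly rat[N]})).@[q].
  have FD : {morph F : x y / x + y} by move=> x y; rewrite /F !rmorphD.
  have F0 : F 0 = 0 by rewrite /F !rmorph0.
  rewrite -/(F g) [g in F g]mpolyE [g in mmap _ _ g]mpolyE.
  rewrite (big_morph F FD F0) (big_morph _ (@mmapD _ _ _ _ _) (mmap0 _ _)).
  apply: eq_bigr => m _; rewrite /F.
  by rewrite !(map_mpolyZ, map_mpolyX) mevalZ mmapZ mevalX mmapX /= ratr_int.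
move/mpolyP => h; apply/mpolyP => m; have := h m.
by rewrite mcoeff_map_mpoly !mcoeff0 => /eqP; rewrite intr_eq0 => /eqP.
Qed.

(** Full rank at [h] singles out a maximal minor [\det B], an integer polynomial that does not
    vanish at [h]. It is then not the zero polynomial, hence does not vanish at the independent
    point [q] either. The characteristic of [K] is arbitrary. *)
Lemma generic_transfer (I E : finType) (c : I -> E -> {mpoly int[N]})
    (K : fieldType) (h : 'I_N -> K) :
  (forall u : I -> K, (forall e, \sum_i u i * int_eval h (c i e) = 0) ->
     forall i, u i = 0) ->
  forall u : I -> R, (forall e, \sum_i u i * int_eval q (c i e) = 0) ->
     forall i, u i = 0.
Proof.
move=> hK u hu.
pose A := \matrix_(i < #|I|, e < #|E|) c (enum_val i) (enum_val e).
have sumE (L : fieldType) (F : I -> L) : \sum_i F i = \sum_(i < #|I|) F (enum_val i).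
  exact: reindex (onW_bij _ (@enum_val_bij I)).
have full : row_full (map_mx (int_eval h) A)^T.
  rewrite /row_full mxrank_tr -/(row_free _); apply: inj_row_free => v v0.
  apply/rowP => i; rewrite mxE; have := hK (fun i => v 0 (enum_rank i)).
  move=> /(_ _ (enum_val i)); rewrite enum_valK; apply=> e.
  have /rowP/(_ (enum_rank e)) := v0; rewrite !mxE => v0e; rewrite sumE.
  apply: etrans v0e; apply: eq_bigr => k _.
  by rewrite !mxE enum_valK enum_rankK.
have := fullrowsub_unit full; set f := fullrankfun full => fu.
pose B := colsub f A.
have detB : \det B != 0.
  apply: contraTneq fu => B0; rewrite unitmxE unitfE -det_tr.
  have -> : (rowsub f (map_mx (int_eval h) A)^T)^T = map_mx (int_eval h) B.
    by apply/matrixP => i j; rewrite !mxE.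
  by rewrite det_map_mx B0 rmorph0 eqxx.
have detR : \det (map_mx (int_eval q) B) != 0.
  by rewrite det_map_mx; apply: contraNneq detB => /int_eval_generic->.
have Bu : map_mx (int_eval q) B \in unitmx by rewrite unitmxE unitfE.
pose w : 'rV[R]_#|I| := \row_i u (enum_val i).
have : w *m map_mx (int_eval q) B = 0.
  apply/rowP => j; rewrite !mxE -[RHS](hu (enum_val (f j))) sumE.
  by apply: eq_bigr => i _; rewrite !mxE.
move/(congr1 (fun z => z *m invmx (map_mx (int_eval q) B))).
rewrite mulmxK // mul0mx => w0 i.
by have /rowP/(_ (enum_rank i)) := w0; rewrite !mxE enum_rankK.
Qed.

End Transfer.

(** * Functions annihilated by all stresses *)

Lemma subset_between (T : finType) (A B : {set T}) k :
  A \subset B -> (#|A| <= k <= #|B|)%N ->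
  exists C : {set T}, [/\ A \subset C, C \subset B & #|C| = k].
Proof.
move=> AB; elim: k => [|k IH] /andP[h1 h2].
  by exists A; split=> //; apply/eqP; rewrite -leqn0.
move: h1; rewrite leq_eqVlt => /orP[/eqP h1|h1]; first by exists A.
have [|C [AC CB Ck]] := IH; first by rewrite -ltnS h1 ltnW.
have /subsetPn[x xB xC] : ~~ (B \subset C).
  by apply: contraTN h2 => /subset_leq_card; rewrite Ck -ltnNge ltnS.
exists (x |: C); split; first exact: subset_trans AC (subsetUr _ _).
- by rewrite subUset sub1set xB CB.
- by rewrite cardsU1 xC Ck.
Qed.

Section DotProduct.
Variables (K : comNzRingType) (m : nat).
Implicit Types x y : 'rV[K]_m.

Definition dotv x y : K := (x *m y^T) 0 0.

Lemma dotvE x y : dotv x y = \sum_j x 0 j * y 0 j.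
Proof. by rewrite /dotv mxE; apply: eq_bigr => j _; rewrite mxE. Qed.

Lemma dotvC x y : dotv x y = dotv y x.
Proof. by rewrite !dotvE; apply: eq_bigr => j _; rewrite mulrC. Qed.

Lemma dotvDr x y z : dotv x (y + z) = dotv x y + dotv x z.
Proof. by rewrite /dotv linearD mulmxDr mxE. Qed.

Lemma dotvNr x y : dotv x (- y) = - dotv x y.
Proof. by rewrite /dotv linearN mulmxN mxE. Qed.

Lemma dotvBr x y z : dotv x (y - z) = dotv x y - dotv x z.
Proof. by rewrite dotvDr dotvNr. Qed.

Lemma dotvZr a x y : dotv x (a *: y) = a * dotv x y.
Proof. by rewrite /dotv linearZ -scalemxAr mxE. Qed.

Lemma dotv_sumr I (r : seq I) (Q : pred I) (F : I -> 'rV[K]_m) x :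
  dotv x (\sum_(i <- r | Q i) F i) = \sum_(i <- r | Q i) dotv x (F i).
Proof. by rewrite /dotv linear_sum /= mulmx_sumr summxE. Qed.

Lemma dotv0r x : dotv x 0 = 0.
Proof. by rewrite /dotv trmx0 mulmx0 mxE. Qed.

Lemma dotv_skew (A : 'M[K]_m) x y : A^T = - A ->
  dotv x (y *m A) = - dotv y (x *m A).
Proof.
by move=> sk; rewrite [in RHS]dotvC /dotv trmx_mul sk mulNmx mulmxN mxE mulmxA.
Qed.

End DotProduct.

Lemma dotv_skew_diag (R : numDomainType) m (A : 'M[R]_m) x : A^T = - A ->
  dotv x (x *m A) = 0.
Proof.
move=> sk; have /eqP := dotv_skew x x sk.
by rewrite -addr_eq0 -mulr2n mulrn_eq0 /= => /eqP.
Qed.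

Section LinearIndependence.
Variables (K : fieldType) (m : nat) (V : finType) (P : V -> 'rV[K]_m).
Implicit Types F : {set V}.

Definition lin_indep F :=
  forall c : V -> K, \sum_(v in F) c v *: P v = 0 -> forall v, v \in F -> c v = 0.

Definition rows_of F : 'M[K]_(#|F|, m) := \matrix_(i < #|F|) P (enum_val i).

Lemma rows_of_free F : lin_indep F -> row_free (rows_of F).
Proof.
move=> ind; apply: inj_row_free => c c0; apply/rowP => i; rewrite mxE.
pose c' v := if insub (index v (enum F)) is Some i then c 0 i else 0.
have cE j : c' (enum_val j) = c 0 j.
  rewrite /c' (_ : index _ _ = j); last first.
    by rewrite /enum_val index_uniq ?enum_uniq // -cardE.
  by rewrite valK.
rewrite -cE; apply: ind; last exact: enum_valP.
rewrite big_enum_val /= -[RHS]c0 mulmx_sum_row; apply: eq_bigr => j _.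
by rewrite cE rowK.
Qed.

End LinearIndependence.

Lemma skew_ext (K : fieldType) m (V : finType) (P l : V -> 'rV[K]_m) (F : {set V}) :
  lin_indep P F ->
  (forall x y, x \in F -> y \in F -> dotv (P x) (l y) + dotv (P y) (l x) = 0) ->
  exists A : 'M[K]_m, A^T = - A /\ forall v, v \in F -> P v *m A = l v.
Proof.
move=> /rows_of_free/row_freeP[B]; set PM := rows_of P F => PB fl.
pose L := rows_of l F.
have [S ES] : exists S, S = PM *m L^T by exists (PM *m L^T).
have skS : S^T = - S.
  have SE i j : S i j = dotv (P (enum_val i)) (l (enum_val j)).
    by rewrite ES dotvE mxE; apply: eq_bigr => k _; rewrite !mxE.
  apply/matrixP => i j; apply/eqP.
  rewrite [S^T i j]mxE [(- S) i j]mxE !SE -addr_eq0.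
  by rewrite fl // enum_valP.
(* As [PM *m B] is the identity, [B *m L] has the right values on the rows of [PM]. Subtracting its
   transpose makes it skew, at the cost of an error [S *m B^T] on these rows, which the skew term
   [B *m S *m B^T] cancels. *)
exists (B *m L - L^T *m B^T + B *m S *m B^T); split.
  have trB (X Y : 'M[K]_m) : (X - Y)^T = X^T - Y^T by apply/matrixP=> i j; rewrite !mxE.
  have trD (X Y : 'M[K]_m) : (X + Y)^T = X^T + Y^T by apply/matrixP=> i j; rewrite !mxE.
  rewrite trD trB !trmx_mul !trmxK skS.
  by rewrite mulNmx mulmxN [RHS]opprD opprB mulmxA.
move=> v vF.
suff : PM *m (B *m L - L^T *m B^T + B *m S *m B^T) = L.
  move/(congr1 (row (enum_rank_in vF v))).
  by rewrite row_mul !rowK enum_rankK_in.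
by rewrite mulmxDr mulmxBr !mulmxA PB !mul1mx -ES subrK.
Qed.

(** * Propagation of trivial motions across ridges *)

Section StarRigidity.
Variables (R : realFieldType) (n d m : nat) (D : {set {set 'I_n}}).
Variable P : 'I_n -> 'rV[R]_m.

Definition adjacent_facets_span := forall a b (G : {set 'I_n}), a != b ->
  a \notin G -> b \notin G -> a |: G \in D -> b |: G \in D -> #|G| = d.-1 ->
  forall e, (forall v, v \in a |: (b |: G) -> dotv (P v) e = 0) -> e = 0.

(** Rigidity of the star of [rho] in the form in which it is used: a motion flexing no facet of the
    star also satisfies the edge equation for the two vertices opposite to a common ridge. *)
Definition rigid_stars := forall rho (l : 'I_n -> 'rV[R]_m), rho \in D ->
  #|rho| = (d - 3)%N ->
  (forall F : {set 'I_n}, F \in D -> #|F| = d -> rho \subset F ->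
    forall x y, x \in F -> y \in F -> dotv (P x) (l y) + dotv (P y) (l x) = 0) ->
  forall (G : {set 'I_n}) a b, rho \subset G -> #|G| = d.-1 -> a \notin G -> b \notin G ->
    a |: G \in D -> b |: G \in D -> dotv (P a) (l b) + dotv (P b) (l a) = 0.

End StarRigidity.

Section AffineLocality.
Variables (R : realFieldType) (n d m : nat) (D : {set {set 'I_n}}).
Variable P : 'I_n -> 'rV[R]_m.
Implicit Types (F G S H gam : {set 'I_n}).
Hypothesis d4 : (4 <= d)%N.
Hypothesis down : forall F G, F \in D -> G \subset F -> G \in D.
Hypothesis ridge : forall G, G \in D -> #|G| = d.-1 ->
  exists a b, [/\ a != b, a \notin G /\ b \notin G, a |: G \in D, b |: G \in D
    & forall c, c \notin G -> c |: G \in D -> c = a \/ c = b].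
Hypothesis indep : forall F, F \in D -> #|F| = d -> lin_indep P F.
Hypothesis adj_span : adjacent_facets_span d D P.
Hypothesis nomiss : forall S, S \notin D -> exists M : {set 'I_n}, [/\ M \subset S, M \notin D,
  forall v, v \in M -> M :\ v \in D & (#|M| <= d - 2)%N].
Hypothesis rigid : rigid_stars d D P.

Variable q : 'I_n -> R.

Lemma card_facet a G : #|G| = d.-1 -> a \notin G -> #|a |: G| = d.
Proof. by move=> Gd aG; rewrite cardsU1 aG Gd add1n prednK //; apply: leq_trans d4. Qed.

Lemma card_ridge F x : #|F| = d -> x \in F -> #|F :\ x| = d.-1.
Proof. by move=> <- xF; rewrite [in RHS](cardsD1 x) xF. Qed.

Lemma opposite_ex F x : F \in D -> #|F| = d -> x \in F ->
  exists2 a, a \notin F & a |: (F :\ x) \in D.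
Proof.
move=> FD Fd xF.
have GD : F :\ x \in D by apply: down FD _; apply: subD1set.
have [a [b [ab [aG bG] aD bD _]]] := ridge GD (card_ridge Fd xF).
have out c : c \notin F :\ x -> c != x -> c \notin F.
  by rewrite !inE => + cx; rewrite cx.
have [ax|ax] := eqVneq a x; last by exists a; rewrite ?out.
by exists b => //; apply: out => //; rewrite -ax eq_sym.
Qed.

Lemma opposite_uniq a b c G : #|G| = d.-1 -> a != b -> a \notin G -> b \notin G ->
  a |: G \in D -> b |: G \in D -> c \notin G -> c |: G \in D -> c = a \/ c = b.
Proof.
move=> Gd ab aG bG aD bD cG cD.
have GD : G \in D by apply: down aD _; apply: subsetUr.
have [a' [b' [_ _ _ _ h]]] := ridge GD Gd.
move: (h a aG aD) (h b bG bD) (h c cG cD) => [h1|h1] [h2|h2] [h3|h3];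
by move: ab; rewrite h1 h2 h3 ?eqxx //; auto.
Qed.

Section Flex.
Variables (z : 'I_n) (l : 'I_n -> 'rV[R]_m).
Hypothesis flex : forall x y, [set x; y] \in D ->
  dotv (P x) (l y) + dotv (P y) (l x) =
  (if x == z then q y else 0) + (if y == z then q x else 0).

Definition trivializes (A : 'M[R]_m) F := [forall v in F, P v *m A == l v].

Lemma trivP A F : reflect (forall v, v \in F -> P v *m A = l v) (trivializes A F).
Proof.
apply: (iffP forall_inP) => h v /h; first by move/eqP.
by move=> ->.
Qed.

Lemma flex_face F x y : F \in D -> z \notin F -> x \in F -> y \in F ->
  dotv (P x) (l y) + dotv (P y) (l x) = 0.
Proof.
move=> FD zF xF yF; rewrite flex; last first.
  by apply: down FD _; apply/subsetP => v; rewrite !inE => /orP[]/eqP->.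
have -> : (x == z) = false by apply: contraNF zF => /eqP<-.
have -> : (y == z) = false by apply: contraNF zF => /eqP<-.
by rewrite addr0.
Qed.

Lemma triv_adj A G a b : A^T = - A -> #|G| = d.-1 -> a \notin G -> b \notin G ->
  a != b -> a |: G \in D -> b |: G \in D -> z \notin a |: G -> z \notin b |: G ->
  trivializes A (a |: G) -> trivializes A (b |: G).
Proof.
move=> sk Gd aG bG ab aD bD za zb /trivP tA.
have GD : G \in D by apply: down aD _; apply: subsetUr.
have zG : z \notin G by apply: contra za; rewrite !inE orbC => ->.
(* The ridge [G] is already completed by [a] and [b], both different from [z]. *)
have zGD : z |: G \notin D.
  apply/negP => zGD; have [a' [b' [_ _ _ _ h]]] := ridge GD Gd.
  move: za zb; rewrite !inE !negb_or => /andP[za _] /andP[zb _].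
  have := h z zG zGD; have := h a aG aD; have := h b bG bD.
  move=> [eb|eb] [ea|ea] [ez|ez]; move: za zb ab;
    by rewrite ?ea ?eb ?ez eqxx.
have [M [MS MD Mdel Md]] := nomiss zGD.
have zM : z \in M.
  apply: contraR MD => zM; apply: down GD _; apply/subsetP => v vM.
  by have := subsetP MS v vM; rewrite !inE => /orP[/eqP e|//]; rewrite -e vM in zM.
have MG : M :\ z \subset G by rewrite subDset.
(* [M :\ z] has at most [d - 3] elements and is enlarged inside [G]. A face containing [rho] and [z]
   would contain [M], so the star of [rho] avoids [z]. *)
have [|rho [Mr rG rd]] := subset_between (k := (d - 3)%N) MG.
  have e3 : (d - 2 = (d - 3).+1)%N by clear -d4; lia.
  have e1 : (d - 3 <= d.-1)%N by clear -d4; lia.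
  by rewrite Gd e1 andbT; move: Md; rewrite (cardsD1 z) zM e3.
have star F : F \in D -> rho \subset F -> z \notin F.
  move=> FD rF; apply: contra MD => zF; apply: down FD _.
  by rewrite -(setD1K zM) subUset sub1set zF (subset_trans Mr).
have Nab : dotv (P a) (l b) + dotv (P b) (l a) = 0.
  apply: (rigid (down GD rG) rd _ rG Gd aG bG aD bD).
  by move=> F FD _ rF x y; apply: flex_face => //; apply: star.
(* The vector is orthogonal to the points of [G] by the edge equations, to [P b] by skewness and to
   [P a] by rigidity, and these points span. *)
have eb : l b - P b *m A = 0.
  apply: (adj_span ab aG bG aD bD Gd) => v; rewrite !inE dotvBr dotv_skew // opprK.
  have inaG c : c \in G -> c \in a |: G by rewrite !inE orbC => ->.
  case/or3P => [/eqP->|/eqP->|vG].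
  - by rewrite tA ?inE ?eqxx.
  - rewrite dotv_skew_diag // addr0.
    have /eqP := @flex_face (b |: G) b b bD zb (setU11 _ _) (setU11 _ _).
    by rewrite -mulr2n mulrn_eq0 /= => /eqP.
  - rewrite tA ?inaG //; apply: (@flex_face (b |: G)) => //; last by rewrite !inE eqxx.
    by rewrite !inE vG orbT.
apply/trivP => v; rewrite !inE => /orP[/eqP->|vG].
  by apply/esym/eqP; rewrite -subr_eq0 eb.
by apply: tA; rewrite !inE vG orbT.
Qed.

(* Count pairs (trivialized facet [F] around [gam] avoiding [z], vertex of [F]
   outside [gam]): each [F] contributes two, [a] contributes one, and every
   other vertex except [y] contributes an even number. *)
Lemma triv_around A gam a y H : A^T = - A -> #|gam| = (d - 2)%N -> z \notin gam ->
  a != y -> a \notin z |: gam -> y \notin z |: gam ->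
  a |: (z |: gam) \in D -> y |: (z |: gam) \in D ->
  H \in D -> #|H| = d -> a |: gam \subset H -> z \notin H -> trivializes A H ->
  exists H', [/\ H' \in D, #|H'| = d, y |: gam \subset H', z \notin H'
    & trivializes A H'].
Proof.
move=> sk gd zg ay az yz aD yD HD Hd aH zH tH.
pose C := [set F | [&& F \in D, #|F| == d, gam \subset F, z \notin F & trivializes A F]].
pose cnt u := #|[set F in C | u \in F]|.
have [/existsP[H']|] := boolP [exists H', (H' \in C) && (y \in H')].
  rewrite inE => /andP[/and5P[h1 /eqP h2 h3 h4 h5] yH']; exists H'; split=> //.
  by rewrite subUset sub1set yH'.
move=> /existsPn noH'; exfalso.
have d2 : (d - 2).+1 = d.-1 by clear -d4; lia.
have HC : H \in C.
  by rewrite inE HD Hd eqxx zH tH (subset_trans _ aH) // subsetUr.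
have notz u : u \notin z |: gam -> u != z /\ u \notin gam.
  by rewrite !inE negb_or => /andP.
have ridge_card u : u \notin gam -> #|u |: gam| = d.-1.
  by move=> ug; rewrite cardsU1 ug gd add1n d2.
have ext u F : u \notin gam -> F \in C -> u \in F ->
    exists2 c, c \notin u |: gam & F = c |: (u |: gam).
  move=> ug; rewrite inE => /and5P[FD /eqP Fd gF zF _] uF.
  have GF : u |: gam \subset F by rewrite subUset sub1set uF.
  have /cards1P[c ec] : #|F :\: (u |: gam)| == 1%N.
    by rewrite cardsD (setIidPr GF) ridge_card // Fd; apply/eqP; clear -d4; lia.
  have /setDP[cF cG] : c \in F :\: (u |: gam) by rewrite ec inE.
  exists c => //; apply/setP => v; have /setP/(_ v) := ec.
  rewrite in_setD in_set1 (in_setU1 v c) => <-.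
  by case: (boolP (v \in u |: gam)) => [/(subsetP GF) ->|_] /=; rewrite ?orbT ?orbF.
have zcnt u : u \notin gam -> u |: gam \notin D -> cnt u = 0%N.
  move=> ug uD; apply: eq_card0 => F; rewrite inE; apply: contraNF uD => /andP[FC uF].
  have [c _ eF] := ext u F ug FC uF; move: FC; rewrite inE => /andP[FD _].
  by apply: down FD _; rewrite eF subsetUr.
have even_cnt u : u \notin gam -> u != a -> ~~ odd (cnt u).
  move=> ug ua.
  have [->|uz] := eqVneq u z.
    rewrite /cnt eq_card0 // => F; rewrite !inE.
    by case: (z \in F); rewrite ?andbF.
  have [->|uy] := eqVneq u y.
    rewrite /cnt eq_card0 // => F; apply/negbTE; rewrite inE; exact: noH'.
  have [uD|uD] := boolP (u |: gam \in D); last by rewrite zcnt.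
  have [b1 [b2 [b12 [b1G b2G] b1D b2D hb]]] := ridge uD (ridge_card u ug).
  (* Only [a] and [y] complete the ridge [z |: gam], and [u] is neither. Hence both facets at
     [u |: gam] avoid [z], and [triv_adj] makes them trivialized together or not at all. *)
  have zuD : z |: (u |: gam) \notin D.
    apply/negP; rewrite setUCA => zuD.
    have zgD : z |: gam \in D by apply: down zuD _; apply: subsetUr.
    have [e1 [e2 [_ _ _ _ he]]] := ridge zgD (ridge_card z zg).
    have uzg : u \notin z |: gam by rewrite !inE negb_or uz.
    move: (he a az aD) (he y yz yD) (he u uzg zuD) => [h1|h1] [h2|h2] [h3|h3];
    by move: ay ua uy; rewrite h1 h2 h3 ?eqxx.
  have zb b : b |: (u |: gam) \in D -> z \notin b |: (u |: gam).
    move=> bD; apply: contra zuD => zb; apply: down bD _.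
    by rewrite subUset sub1set zb subsetUr.
  have bC b : b \notin u |: gam -> b |: (u |: gam) \in D ->
      (b |: (u |: gam) \in C) = trivializes A (b |: (u |: gam)).
    move=> bG bD; rewrite inE bD zb // card_facet ?ridge_card // eqxx /=.
    by rewrite (subset_trans _ (subsetUr _ _)) // subsetUr.
  have e12 : trivializes A (b1 |: (u |: gam)) = trivializes A (b2 |: (u |: gam)).
    apply/idP/idP.
      by apply: triv_adj => //; rewrite ?ridge_card ?zb.
    by apply: triv_adj => //; rewrite ?ridge_card ?zb // eq_sym.
  have neq : b1 |: (u |: gam) != b2 |: (u |: gam).
    apply: contra b1G => /eqP/setP/(_ b1); rewrite !inE eqxx (negPf b12) /=.
    by move=> <-.
  case t1 : (trivializes A (b1 |: (u |: gam))).
    rewrite /cnt (_ : [set F in C | u \in F] = [set b1 |: (u |: gam); b2 |: (u |: gam)]).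
      by rewrite cards2 neq.
    apply/setP => F; rewrite !inE -[_ && _ in LHS](andbT _); apply/idP/idP.
      rewrite andbT => /andP[h uF]; have FC : F \in C by rewrite inE.
      have [c cG eF] := ext u F ug FC uF.
      have cD : c |: (u |: gam) \in D by rewrite -eF; case/andP: h.
      by case: (hb c cG cD) => ec; rewrite eF ec eqxx ?orbT.
    rewrite andbT => /orP[] /eqP->.
      by have := bC b1 b1G b1D; rewrite inE t1 => ->; rewrite !inE eqxx orbT.
    by have := bC b2 b2G b2D; rewrite inE -e12 t1 => ->; rewrite !inE eqxx orbT.
  rewrite /cnt eq_card0 // => F; rewrite inE; apply/negbTE/negP => /andP[FC uF].
  have [c cG eF] := ext u F ug FC uF.
  have cD : c |: (u |: gam) \in D by rewrite -eF; move: FC; rewrite inE => /andP[].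
  have := bC c cG cD; rewrite -eF FC => /esym; rewrite eF.
  by case: (hb c cG cD) => ->; rewrite -?e12 t1.
have [az' ag] := notz a az.
(* One of the two facets at [a |: gam] contains [z], so only [H] is counted. *)
have cnta : cnt a = 1%N.
  have zaD : z |: (a |: gam) \in D by rewrite setUCA.
  have aGD : a |: gam \in D by apply: down zaD _; apply: subsetUr.
  have zaG : z \notin a |: gam by rewrite !inE negb_or eq_sym az'.
  have [b1 [b2 [b12 [b1G b2G] b1D b2D hb]]] := ridge aGD (ridge_card a ag).
  have key F : F \in C -> a \in F -> F = H.
    move=> FC aF; have [c cG eF] := ext a F ag FC aF.
    have aH' : a \in H by apply: (subsetP aH); rewrite setU11.
    have [c' c'G eH] := ext a H ag HC aH'.
    have cD : c |: (a |: gam) \in D by rewrite -eF; move: FC; rewrite inE => /andP[].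
    have c'D : c' |: (a |: gam) \in D by rewrite -eH.
    have cz : c != z.
      by move: FC; rewrite eF !inE => /and5P[_ _ _ h _]; apply: contra h => /eqP->; rewrite eqxx.
    have c'z : c' != z by apply: contra zH => /eqP<-; rewrite eH setU11.
    rewrite eF eH; congr (_ |: _).
    move: (hb c cG cD) (hb c' c'G c'D) (hb z zaG zaD) => [h1|h1] [h2|h2] [h3|h3];
    by move: cz c'z; rewrite h1 h2 ?h3 ?eqxx.
  rewrite /cnt (_ : [set F in C | a \in F] = [set H]) ?cards1 //.
  apply/setP => F; rewrite [in LHS]inE [in RHS]inE; apply/andP/eqP => [[FC aF]|->].
    exact: key.
  by split=> //; apply: (subsetP aH); rewrite setU11.
have total : (\sum_(u | u \notin gam) cnt u = 2 * #|C|)%N.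
  rewrite /cnt; under eq_bigr => u _ do rewrite -sum1_card.
  rewrite (exchange_big_dep (mem C)) /=; last by move=> u F _; rewrite inE => /andP[].
  rewrite mulnC -sum_nat_const; apply: eq_bigr => F FC.
  rewrite sum1_card -[2%N](_ : #|F :\: gam| = _).
    by apply: eq_card => u; rewrite unfold_in !inE; move: FC; rewrite inE => ->.
  move: FC; rewrite inE => /and5P[_ /eqP Fd gF _ _].
  by rewrite cardsD (setIidPr gF) Fd gd; clear -d4; lia.
have := congr1 odd total; rewrite mul2n odd_double (bigD1 a) //= cnta.
rewrite oddD /=.
suff -> : odd (\sum_(u | (u \notin gam) && (u != a)) cnt u) = false by [].
apply: (big_ind (fun k => odd k = false)) => //.
  by move=> k1 k2; rewrite oddD => -> ->.
by move=> u /andP[ug ua]; apply/negbTE/even_cnt.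
Qed.

End Flex.

Hypothesis flex_ex : forall z, exists l : 'I_n -> 'rV[R]_m,
  forall x y, [set x; y] \in D -> dotv (P x) (l y) + dotv (P y) (l x) =
    (if x == z then q y else 0) + (if y == z then q x else 0).

Lemma local_affine F x y a b : F \in D -> #|F| = d -> x \in F -> y \in F -> x != y ->
  a \notin F -> b \notin F -> a |: (F :\ y) \in D -> b |: (F :\ x) \in D ->
  exists e, forall v, v \in a |: (b |: F) -> q v = dotv (P v) e.
Proof.
move=> FD Fd xF yF xy aF bF aD bD.
have [z zFxy] : exists z, z \in F :\ x :\ y.
  apply/card_gt0P; have := card_ridge Fd xF; rewrite (cardsD1 y) !inE eq_sym xy yF.
  by clear -d4; lia.
have [zy [zx zF]] : z != y /\ z != x /\ z \in F.
  by move: zFxy; rewrite !inE => /and3P[-> -> ->].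
have [l flex] := flex_ex z.
have [c cF cD] := opposite_ex FD Fd zF.
pose H := c |: (F :\ z).
have cFz : c \notin F :\ z by rewrite !inE (negPf cF) andbF.
have Hd : #|H| = d by apply: card_facet => //; apply: card_ridge.
have cz : c != z by apply: contraNneq cF => ->.
have zH : z \notin H by rewrite !inE eqxx eq_sym (negPf cz).
have [A [sk tA]] := skew_ext (indep cD Hd) (fun u v => flex_face flex cD zH).
have tH : trivializes l A H by apply/trivP => v /tA.
(* [H] contains [u] and [gam]; going around [gam], which is [F :\ z :\ u], leads to a facet
   containing the vertex [w] opposite to [u]. *)
have around u w : u \in F -> u != z -> w \notin F ->
    w |: (F :\ u) \in D -> P w *m A = l w.
  move=> uF uz wF wD.
  pose gam := F :\ z :\ u.
  have zg : z |: gam = F :\ u.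
    rewrite /gam; apply/setP => t; rewrite !inE.
    by have [->|] := eqVneq t z; rewrite /= ?zF ?(eq_sym z u) ?uz.
  have gd : #|gam| = (d - 2)%N.
    have := card_ridge Fd zF; rewrite (cardsD1 u) !inE uz uF -/gam.
    by clear -d4; lia.
  have zgam : z \notin gam by rewrite !inE eqxx andbF.
  have uw : u != w by apply: contraNneq wF => <-.
  have uzg : u \notin z |: gam by rewrite zg !inE eqxx.
  have wzg : w \notin z |: gam by rewrite zg !inE (negPf wF) andbF.
  have uzgD : u |: (z |: gam) \in D by rewrite zg setD1K.
  have wzgD : w |: (z |: gam) \in D by rewrite zg.
  have uH : u |: gam \subset H.
    apply/subsetP => t; rewrite !inE => /orP[/eqP->|/and3P[_ -> ->]].
      by rewrite uz uF orbT.
    by rewrite orbT.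
  have [H' [H'D H'd wH' zH' tH']] :=
    triv_around flex sk gd zgam uw uzg wzg uzgD wzgD cD Hd uH zH tH.
  by move/trivP: tH'; apply; apply: (subsetP wH'); rewrite setU11.
have la : P a *m A = l a by apply: (around y) => //; rewrite eq_sym.
have lb : P b *m A = l b by apply: (around x) => //; rewrite eq_sym.
have lF v : v \in F -> v != z -> P v *m A = l v.
  by move=> vF vz; apply: tA; rewrite !inE vz vF orbT.
(* With [l v = P v *m A] and [A] skew, the equation of the edge [z v] becomes
   [q v = <P v, l z - P z *m A>]. For [v = z] it is the same equation with both sides doubled. *)
exists (l z - P z *m A) => v vin.
have [->|vz] := eqVneq v z.
  have sz := dotv_skew_diag (P z) sk.
  have zzD : [set z; z] \in D.
    by apply: down FD _; rewrite setUid sub1set.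
  have := flex z z zzD; rewrite eqxx dotvBr sz subr0; lra.
have lv : P v *m A = l v.
  by move: vin; rewrite !inE => /or3P[/eqP->|/eqP->|vF] //; apply: lF.
have zvD : [set z; v] \in D.
  have sub t w : t |: (F :\ w) \in D -> w != z -> [set z; t] \in D.
    move=> tD wz; apply: down tD _; apply/subsetP => u.
    by rewrite !inE => /orP[]/eqP->; rewrite ?eqxx // zF (eq_sym z w) wz orbT.
  move: vin; rewrite !inE => /or3P[/eqP->|/eqP->|vF].
  - by apply: sub aD _; rewrite eq_sym.
  - by apply: sub bD _; rewrite eq_sym.
  - by apply: down FD _; apply/subsetP => u; rewrite !inE => /orP[]/eqP->.
have := flex z v zvD; rewrite eqxx (negPf vz) addr0 -lv dotv_skew // dotvBr => <-.
by rewrite addrC.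
Qed.

Hypothesis empty_face : set0 \in D.
Hypothesis vertex_face : forall v, [set v] \in D.
Hypothesis pure : forall S, S \in D -> exists F : {set 'I_n}, [/\ F \in D, S \subset F & #|F| = d].
Hypothesis strongly_connected : forall Q : {set 'I_n} -> Prop,
  (forall G a b, #|G| = d.-1 -> a \notin G -> b \notin G -> a != b ->
     a |: G \in D -> b |: G \in D -> Q (a |: G) -> Q (b |: G)) ->
  forall F F', F \in D -> #|F| = d -> F' \in D -> #|F'| = d -> Q F -> Q F'.

Let span_eq G a b e e' : #|G| = d.-1 -> a != b -> a \notin G -> b \notin G ->
  a |: G \in D -> b |: G \in D ->
  (forall v, v \in a |: (b |: G) -> q v = dotv (P v) e) ->
  (forall v, v \in a |: (b |: G) -> q v = dotv (P v) e') -> e = e'.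
Proof.
move=> Gd ab aG bG aD bD h h'; apply/eqP; rewrite -subr_eq0; apply/eqP.
by apply: (adj_span ab aG bG aD bD Gd) => v vin; rewrite dotvBr -h // -h' // subrr.
Qed.

Lemma affine_from_stress : exists e, forall v, q v = dotv (P v) e.
Proof.
have [F0 [F0D _ F0d]] := pure empty_face.
have [x0 [y0 [x0F y0F xy0]]] : exists x0 y0, [/\ x0 \in F0, y0 \in F0 & x0 != y0].
  by apply/card_gt1P; rewrite F0d; apply: leq_trans d4.
have [a0 a0F a0D] := opposite_ex F0D F0d y0F.
have [b0 b0F b0D] := opposite_ex F0D F0d x0F.
have [e0 he0] := local_affine F0D F0d x0F y0F xy0 a0F b0F a0D b0D.
(* The invariant includes the vertices opposite to [F], so that the points already known when a
   ridge is crossed span and fix the functional. *)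
pose Q F := forall x a, x \in F -> a \notin F -> a |: (F :\ x) \in D ->
  forall v, v \in a |: F -> q v = dotv (P v) e0.
have Q0 : Q F0.
  move=> x a xF aF aD.
  have [y [c [yF yx cF cD hc]]] : exists y c, [/\ y \in F0, y != x, c \notin F0,
      c |: (F0 :\ y) \in D & forall v, v \in c |: F0 -> q v = dotv (P v) e0].
    have [xx0|xx0] := eqVneq x x0.
      exists y0, a0; split=> //; first by rewrite xx0 eq_sym.
      by move=> v vin; apply: he0; move: vin; rewrite !inE => /orP[]->; rewrite ?orbT.
    exists x0, b0; split=> //; first by rewrite eq_sym.
    by move=> v vin; apply: he0; move: vin; rewrite !inE => /orP[]->; rewrite ?orbT.
  have xy : x != y by rewrite eq_sym.
  have [e' he'] := local_affine F0D F0d xF yF xy cF aF cD aD.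
  have ee : e' = e0.
    apply: (@span_eq (F0 :\ y) c y) => //.
    - exact: card_ridge.
    - by apply: contraNneq cF => ->.
    - by rewrite !inE (negPf cF) andbF.
    - by rewrite !inE eqxx.
    - by rewrite setD1K.
    - move=> v; rewrite setD1K // => vin; apply: he'.
      by move: vin; rewrite !inE => /orP[]->; rewrite ?orbT.
    - by move=> v; rewrite setD1K //; apply: hc.
  by move=> v vin; rewrite -ee; apply: he'; rewrite !inE; move: vin; rewrite !inE =>
    /orP[]->; rewrite ?orbT.
have Qstep G x c : #|G| = d.-1 -> x \notin G -> c \notin G -> x != c ->
    x |: G \in D -> c |: G \in D -> Q (x |: G) -> Q (c |: G).
  move=> Gd xG cG xc xD cD QF.
  have old v : v \in x |: (c |: G) -> q v = dotv (P v) e0.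
    move=> vin; apply: (QF x c); rewrite ?setU11 //.
    - by rewrite !inE negb_or eq_sym xc.
    - by rewrite setU1K.
    - by rewrite setUCA.
  move=> x' a' x'F a'F a'D.
  have xF : x \notin c |: G by rewrite !inE negb_or xc.
  have xD' : x |: ((c |: G) :\ c) \in D by rewrite setU1K.
  have [ex|ex] := eqVneq x' c.
    move: a'D; rewrite ex setU1K // => a'D.
    have a'G : a' \notin G by apply: contra a'F; rewrite !inE orbC => ->.
    have [->|ea] := opposite_uniq Gd xc xG cG xD cD a'G a'D; first exact: old.
    by move: a'F; rewrite ea setU11.
  have Fd := card_facet Gd cG.
  have [e' he'] := local_affine cD Fd x'F (setU11 c G) ex xF a'F xD' a'D.
  have ee : e' = e0.
    apply: (span_eq Gd xc xG cG xD cD) => // v vin; apply: he'.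
    by move: vin; rewrite !inE => /or3P[]->; rewrite ?orbT.
  move=> v vin; rewrite -ee; apply: he'.
  by move: vin; rewrite !inE => /or3P[]->; rewrite ?orbT.
exists e0 => v.
have [F [FD vF Fd]] := pure (vertex_face v); rewrite sub1set in vF.
have [a aF aD] := opposite_ex FD Fd vF.
have QF := strongly_connected Qstep F0D F0d FD Fd Q0.
by apply: (QF v a) => //; rewrite !inE vF orbT.
Qed.

End AffineLocality.

(** * Stresses as polynomials *)

Section Duality.
Variable K : fieldType.

Lemma col_mulmx m n k (A : 'M[K]_(m, n)) (B : 'M[K]_(n, k)) j :
  col j (A *m B) = A *m col j B.
Proof. by rewrite !colE mulmxA. Qed.

Lemma annihilator_submx m n k (A : 'M[K]_(m, n)) (B : 'M[K]_(k, n)) :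
  (forall u : 'cV[K]_n, A *m u = 0 -> B *m u = 0) -> (B <= A)%MS.
Proof.
move=> h; rewrite submxE; apply/eqP/matrixP => i j.
have : B *m col j (cokermx A) = 0 by apply: h; rewrite -col_mulmx mulmx_coker col0.
by move/matrixP/(_ i 0); rewrite -col_mulmx !mxE.
Qed.

(** [S] may be infinite: its members are adjoined as rows as long as they raise the rank, which
    happens at most [n] times. *)
Lemma dual_span n (S : 'rV[K]_n -> Prop) (x : 'rV[K]_n) :
  (forall u : 'cV[K]_n, (forall s, S s -> s *m u = 0) -> x *m u = 0) ->
  exists k (c : 'I_k -> K) (f : 'I_k -> 'rV[K]_n),
    (forall i, S (f i)) /\ x = \sum_i c i *: f i.
Proof.
move=> h.
have [k [A [AS Amax]]] : exists k (A : 'M[K]_(k, n)),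
    (forall i, S (row i A)) /\ (forall s, S s -> (s <= A)%MS).
  suff : forall r k (A : 'M[K]_(k, n)), (n - \rank A <= r)%N ->
      (forall i, S (row i A)) -> exists k (A : 'M[K]_(k, n)),
    (forall i, S (row i A)) /\ (forall s, S s -> (s <= A)%MS).
    by move=> /(_ n 0 0); apply; [exact: leq_subr|case].
  elim=> [|r IH] k A hr AS.
    exists k, A; split=> // s _; apply: submx_full.
    by rewrite /row_full eqn_leq rank_leq_col -subn_eq0 -leqn0.
  have [all|] := pselect (forall s, S s -> (s <= A)%MS); first by exists k, A.
  move=> /existsNP[s /not_implyP[Ss /negP sA]].
  apply: (IH _ (col_mx s A)).
    suff : (\rank A < \rank (col_mx s A))%N by move: hr; clear; lia.
    rewrite ltn_neqAle mxrankS ?andbT; last by rewrite -addsmxE addsmxSr.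
    apply: contra sA => /eqP e.
    have AsA : (A <= col_mx s A)%MS by rewrite -addsmxE addsmxSr.
    have : (col_mx s A <= A)%MS by have [_ <-] := mxrank_leqif_sup AsA; rewrite e.
    by rewrite -addsmxE; apply: submx_trans; apply: addsmxSl.
  move=> i; rewrite -(splitK i); case: (split i) => j.
    by rewrite rowKu row_id // ord1.
  by rewrite rowKd.
have : (x <= A)%MS.
  rewrite submxE; apply/eqP/matrixP => i j.
  have : x *m col j (cokermx A) = 0.
    apply: h => s /Amax; rewrite submxE => /eqP sA.
    by rewrite -col_mulmx sA col0.
  by move/matrixP/(_ i 0); rewrite -col_mulmx !mxE.
move=> /submxP[c ->]; exists k, (fun i => c 0 i), (fun i => row i A).
by split=> //; rewrite mulmx_sum_row.
Qed.

(** The Fredholm alternative for the unknown [h]. *)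
Lemma linear_system_dual (I E : finType) (c : I -> E -> K) (b : I -> K) :
  (forall u : I -> K, (forall e, \sum_i u i * c i e = 0) -> \sum_i u i * b i = 0) ->
  exists h : E -> K, forall i, b i = \sum_e c i e * h e.
Proof.
move=> hu.
have sumE (T : finType) (F : T -> K) : \sum_i F i = \sum_(i < #|T|) F (enum_val i).
  exact: reindex (onW_bij _ (@enum_val_bij T)).
pose A := \matrix_(i < #|E|, j < #|I|) c (enum_val j) (enum_val i).
pose B : 'rV[K]_#|I| := \row_j b (enum_val j).
have : (B <= A)%MS.
  apply: annihilator_submx => u Au; apply/matrixP => i j; rewrite !mxE !ord1.
  have := hu (fun i => u (enum_rank i) 0) => h1.
  apply: etrans (h1 _).
    by rewrite [RHS]sumE; apply: eq_bigr => k _; rewrite !mxE enum_valK mulrC.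
  move=> e; have /matrixP/(_ (enum_rank e) 0) := Au; rewrite !mxE => h2.
  rewrite sumE; apply: etrans h2; apply: eq_bigr => k _.
  by rewrite !mxE enum_valK enum_rankK mulrC.
move=> /submxP[h hB]; exists (fun e => h 0 (enum_rank e)) => i.
have /rowP/(_ (enum_rank i)) := hB; rewrite !mxE enum_rankK => ->.
rewrite [RHS]sumE; apply: eq_bigr => k _; rewrite !mxE enum_rankK enum_valK.
by rewrite mulrC.
Qed.

End Duality.

Lemma sum_pair (V : nmodType) (I J : finType) (F : I * J -> V) :
  \sum_p F p = \sum_i \sum_j F (i, j).
Proof. by rewrite pair_bigA; apply: eq_bigr => -[]. Qed.

Section StressMatrix.
Variables (R : realFieldType) (n m : nat) (D : {set {set 'I_n}}).
Variable P : 'I_n -> 'rV[R]_m.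

Definition stress_matrix (W : 'M[R]_n) :=
  [/\ W^T = W, (forall x y, [set x; y]%SET \notin D -> W x y = 0)
    & (forall x, \sum_y W x y *: P y = 0)].

(** By the Fredholm alternative it is enough to test multipliers [u] orthogonal to all coefficients.
    The symmetrization [W] of such a [u] is a stress matrix, and the pairing of [u] with the
    right-hand side is the entry at [z] of [W] applied to [q]. *)
Lemma flex_of_annihilator (q : 'I_n -> R) :
  (forall W, stress_matrix W -> forall x, \sum_y W x y * q y = 0) ->
  forall z, exists l : 'I_n -> 'rV[R]_m,
    forall x y, [set x; y]%SET \in D -> dotv (P x) (l y) + dotv (P y) (l x) =
      (if x == z then q y else 0) + (if y == z then q x else 0).
Proof.
move=> hq z.
pose supp (e : 'I_n * 'I_n) := [set e.1; e.2]%SET \in D.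
pose c (e : 'I_n * 'I_n) (k : 'I_n * 'I_m) : R := if supp e then
  (if e.1 == k.1 then P e.2 0 k.2 else 0) + (if e.2 == k.1 then P e.1 0 k.2 else 0)
  else 0.
pose b (e : 'I_n * 'I_n) : R := if supp e then
  (if e.1 == z then q e.2 else 0) + (if e.2 == z then q e.1 else 0) else 0.
have [u hu|h hh] := @linear_system_dual R _ _ c b; last first.
  exists (fun v => \row_j h (v, j)) => x y xyD.
  have := hh (x, y); rewrite /b /c /supp /= xyD => ->.
  rewrite !dotvE; under [X in _ = X]eq_bigr => k _ do rewrite mulrDl.
  rewrite big_split /= [LHS]addrC; congr (_ + _).
    rewrite sum_pair /=.
    rewrite (bigD1 x) //= eqxx [X in _ + X]big1 => [|v vx].
      by rewrite addr0; apply: eq_bigr => j _; rewrite mxE.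
    by apply: big1 => j _; rewrite eq_sym (negPf vx) mul0r.
  rewrite sum_pair /=.
  rewrite (bigD1 y) //= eqxx [X in _ + X]big1 => [|v vx].
    by rewrite addr0; apply: eq_bigr => j _; rewrite mxE.
  by apply: big1 => j _; rewrite eq_sym (negPf vx) mul0r.
pose W := \matrix_(x, y) if supp (x, y) then u (x, y) + u (y, x) else 0.
have suppC x y : supp (x, y) = supp (y, x) by rewrite /supp /= finset.setUC.
have key (f : 'I_n -> R) v : \sum_y W v y * f y = \sum_e u e * (if supp e then
    (if e.1 == v then f e.2 else 0) + (if e.2 == v then f e.1 else 0) else 0).
  rewrite sum_pair /=.
  pose g x y := if supp (x, y) then u (x, y) else 0.
  transitivity (\sum_y g v y * f y + \sum_x g x v * f x).
    rewrite -big_split /=; apply: eq_bigr => y _; rewrite !mxE /g (suppC y v).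
    by case: (supp _); rewrite ?mul0r ?addr0 // mulrDl.
  transitivity (\sum_x \sum_y (if x == v then g x y * f y else 0)
      + \sum_x \sum_y (if y == v then g x y * f x else 0)).
    congr (_ + _).
      rewrite [RHS](bigD1 v) //= [X in _ + X]big1 => [|x xv].
        by rewrite addr0 eqxx.
      by apply: big1 => y _; rewrite (negPf xv).
    apply: eq_bigr => x _; rewrite (bigD1 v) //= [X in _ + X]big1 => [|y yv].
      by rewrite addr0 eqxx.
    by rewrite (negPf yv).
  rewrite -big_split /=; apply: eq_bigr => x _; rewrite -big_split /=.
  apply: eq_bigr => y _; rewrite /g; case: (supp _); last first.
    by rewrite !mul0r mulr0; case: ifP; case: ifP; rewrite addr0.
  by rewrite mulrDr; case: ifP; case: ifP; rewrite ?mulr0.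
have SW : stress_matrix W.
  split.
  - apply/matrixP => x y; by rewrite !mxE suppC addrC.
  - by move=> x y xyD; rewrite !mxE /supp /= (negPf xyD).
  - move=> x; apply/rowP => j; rewrite summxE mxE.
    under eq_bigr => y _ do rewrite mxE.
    by rewrite key; exact: (hu (x, j)).
by rewrite -[RHS](hq W SW z) key.
Qed.

End StressMatrix.

Section Homogenize.
Variables (K : comNzRingType) (d : nat).

Definition hat (x : 'rV[K]_d) : 'rV[K]_(d + 1) := row_mx x 1%:M.

Lemma hat_l x j : hat x 0 (lshift 1 j) = x 0 j.
Proof. by rewrite /hat row_mxEl. Qed.

Lemma hat_r x j : hat x 0 (rshift d j) = 1.
Proof. by rewrite /hat row_mxEr !mxE !ord1 eqxx. Qed.

Lemma hat_comb (I : finType) (c : I -> K) (x : I -> 'rV[K]_d) :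
  \sum_i c i *: hat (x i) = 0 <->
  (forall j, \sum_i c i * x i 0 j = 0) /\ \sum_i c i = 0.
Proof.
split=> [/rowP h|[h1 h2]].
  split=> [j|].
    have := h (lshift 1 j); rewrite summxE mxE => h'; rewrite -[RHS]h'.
    by apply: eq_bigr => i _; rewrite mxE hat_l.
  have := h (rshift d 0); rewrite summxE mxE => h'; rewrite -[RHS]h'.
  by apply: eq_bigr => i _; rewrite mxE hat_r mulr1.
apply/rowP => j; rewrite summxE mxE -(splitK j); case: (split j) => k /=.
  by rewrite -[RHS](h1 k); apply: eq_bigr => i _; rewrite mxE hat_l.
by rewrite -[RHS]h2; apply: eq_bigr => i _; rewrite mxE hat_r mulr1.
Qed.

End Homogenize.

Section Stresses.
Variables (R : realType) (n d : nat) (D : {set {set 'I_n}}) (p : 'I_n -> 'rV[R]_d).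
Local Notation P := (fun v => hat (p v)).

(** Division by 2 makes the partial derivatives exactly the rows of a symmetric [W]. *)
Definition stress_poly (W : 'M[R]_n) : {mpoly R[n]} :=
  \sum_x \sum_y (W x y / 2) *: ('X_x * 'X_y).

Lemma mderivXU x z : ('X_x : {mpoly R[n]})^`M(z) = (x == z)%:R.
Proof.
rewrite mderivX mnm1E; case: eqP => [->|_]; last by rewrite scale0r.
rewrite scale1r (_ : (_ - _)%MM = 0%MM) ?mpolyX0 //.
by apply/mnmP => i; rewrite mnmBE subnn mnm0E.
Qed.

Lemma stress_poly_deriv W z : W^T = W ->
  (stress_poly W)^`M(z) = \sum_y W z y *: 'X_y.
Proof.
move=> sW; have WC x y : W y x = W x y by rewrite -[in LHS]sW mxE.
rewrite /stress_poly mderiv_sum.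
under eq_bigr => x _ do rewrite mderiv_sum.
transitivity (\sum_x \sum_y ((x == z)%:R * (W x y / 2)) *: 'X_y
   + \sum_x \sum_y ((y == z)%:R * (W x y / 2)) *: 'X_x : {mpoly R[n]}).
  rewrite -big_split /=; apply: eq_bigr => x _; rewrite -big_split /=.
  apply: eq_bigr => y _; rewrite mderivZ mderivM !mderivXU scalerDr.
  congr (_ + _).
    by case: eqP => _; rewrite ?mul1r // !mul0r scaler0 scale0r.
  by case: eqP => _; rewrite ?mul1r ?mulr1 // mul0r mulr0 scaler0 scale0r.
have half (x y : 'I_n) : W x y = W x y / 2 + W x y / 2 by lra.
transitivity (\sum_y (W z y / 2) *: 'X_y + \sum_y (W z y / 2) *: 'X_y : {mpoly R[n]}).
  congr (_ + _).
    rewrite (bigD1 z) //= [X in _ + X]big1 => [|x xz].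
      by rewrite addr0; apply: eq_bigr => y _; rewrite eqxx mul1r.
    by apply: big1 => y _; rewrite (negPf xz) mul0r scale0r.
  apply: eq_bigr => x _; rewrite (bigD1 z) //= [X in _ + X]big1 => [|y yz].
    by rewrite addr0 eqxx mul1r WC.
  by rewrite (negPf yz) mul0r scale0r.
by rewrite -big_split /=; apply: eq_bigr => y _; rewrite -scalerDl -half.
Qed.

Lemma stress_poly_stress W : stress_matrix D P W -> affine_stress 2 D p (stress_poly W).
Proof.
move=> [sW supW eqW].
have lin (l : 'I_n -> R) : (forall y, \sum_z W y z * l z = 0) ->
    lin_deriv l (stress_poly W) = 0.
  move=> h; rewrite /lin_deriv.
  under eq_bigr => z _ do rewrite (stress_poly_deriv _ sW) scaler_sumr.
  rewrite exchange_big /=; apply: big1 => y _.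
  under eq_bigr => z _ do rewrite scalerA.
  rewrite -scaler_suml -[X in X *: _](_ : 0 = _) ?scale0r //.
  rewrite -[LHS](h y); apply: eq_bigr => z _.
  by rewrite mulrC -[in LHS]sW mxE.
have hW x := (hat_comb _ _).1 (eqW x).
split.
- apply: rpred_sum => x _; apply: rpred_sum => y _; apply: rpredZ.
  by rewrite -[2%N]/(1 + 1)%N; apply: dhomogM; rewrite dhomogX /= mdeg1.
- move=> mm; rewrite mcoeff_msupp => h; apply/negPn; apply: contra h => hm.
  apply/eqP; rewrite /stress_poly raddf_sum /=; apply: big1 => x _.
  rewrite raddf_sum /=; apply: big1 => y _.
  rewrite mcoeffZ -mpolyXD mcoeffX.
  case: eqP => [e|_]; last by rewrite mulr0.
  rewrite (supW x y) ?mul0r //; apply: contra hm => xyD.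
  suff -> : mon_supp mm = [set x; y]%SET by [].
  apply/setP => v; rewrite -e !inE mnmDE !mnm1E !(eq_sym _ v).
  by case: (v == x); case: (v == y).
- by move=> j; apply: lin => y; case: (hW y).
- by apply: lin => y; under eq_bigr => z _ do rewrite mulr1; case: (hW y).
Qed.

Lemma homog1_expand (lam : {mpoly R[n]}) : lam \is 1.-homog ->
  lam = \sum_v lam@_(U_(v)) *: 'X_v.
Proof.
move=> h; apply/mpolyP => mm; rewrite raddf_sum /=.
have [/mdeg1P[v /eqP->]|hm] := boolP (mdeg mm == 1%N).
  rewrite (bigD1 v) //= mcoeffZ mcoeffX eqxx mulr1 big1 ?addr0 // => w wv.
  rewrite mcoeffZ mcoeffX; case: eqP => [/mnmP/(_ w)|_]; last by rewrite mulr0.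
  by rewrite !mnm1E eqxx eq_sym (negPf wv).
rewrite (dhomog_nemf_coeff h) // big1 // => v _.
rewrite mcoeffZ mcoeffX; case: eqP => [e|]; last by rewrite mulr0.
by move: hm; rewrite -e mdeg1 eqxx.
Qed.

Lemma lin_deriv_linear (l c : 'I_n -> R) :
  lin_deriv l (\sum_v c v *: 'X_v : {mpoly R[n]}) = (\sum_v c v * l v)%:MP.
Proof.
rewrite /lin_deriv rmorph_sum /=; apply: eq_bigr => z _.
rewrite mderiv_sum (bigD1 z) //= big1 => [|x xz].
  by rewrite addr0 mderivZ mderivXU eqxx scalerA mulrC alg_mpolyC.
by rewrite mderivZ mderivXU (negPf xz) scaler0.
Qed.

Lemma affine_stress1P (c : 'I_n -> R) : (forall v, [set v]%SET \in D) ->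
  affine_stress 1 D p (\sum_v c v *: 'X_v) <-> \sum_v c v *: hat (p v) = 0.
Proof.
move=> vD; rewrite hat_comb; split=> [[_ _ h1 h2]|[h1 h2]].
  split=> [j|].
    have := h1 j; rewrite lin_deriv_linear => /eqP; rewrite mpolyC_eq0.
    by move/eqP.
  have := h2; rewrite lin_deriv_linear => /eqP; rewrite mpolyC_eq0.
  by under eq_bigr => z _ do rewrite mulr1; move/eqP.
split.
- by apply: rpred_sum => v _; apply: rpredZ; rewrite dhomogX /= mdeg1.
- move=> mm; rewrite mcoeff_msupp raddf_sum /= => h.
  have [/existsP[v /eqP ev]|/existsPn hm] := boolP [exists v : 'I_n, mm == U_(v)%MM].
    rewrite (_ : mon_supp mm = [set v]%SET) //.
    by apply/setP => w; rewrite !inE ev mnm1E (eq_sym w v); case: (v == w).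
  move: h; rewrite big1 ?eqxx // => v _; rewrite mcoeffZ mcoeffX eq_sym.
  by rewrite (negPf (hm v)) mulr0.
- by move=> j; rewrite lin_deriv_linear h1 mpolyC0.
- rewrite lin_deriv_linear; under eq_bigr => z _ do rewrite mulr1.
  by rewrite h2 mpolyC0.
Qed.

Lemma mon_supp_deriv (om : {mpoly R[n]}) v mm :
  mm \in msupp om^`M(v) -> (mm + U_(v))%MM \in msupp om.
Proof.
rewrite !mcoeff_msupp mcoeff_deriv; apply: contra => /eqP->.
by rewrite mul0rn.
Qed.

Lemma affine_stress_deriv om v : (forall F G : {set 'I_n}, F \in D -> G \subset F -> G \in D) ->
  affine_stress 2 D p om -> affine_stress 1 D p om^`M(v).
Proof.
move=> down [h1 h2 h3 h4].
have comm l : lin_deriv l om^`M(v) = (lin_deriv l om)^`M(v).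
  rewrite /lin_deriv mderiv_sum; apply: eq_bigr => z _.
  by rewrite mderivZ mderiv_comm.
split.
- apply/dhomogP => mm /mon_supp_deriv /(dhomogP _ _ _ h1) /=.
  by rewrite mdegD mdeg1 addn1 => -[].
- move=> mm /mon_supp_deriv /h2 hD; apply: down hD _.
  by apply/subsetP => w; rewrite !inE mnmDE; case: (mm w).
- by move=> j; rewrite comm h3 mderiv0.
- by rewrite comm h4 mderiv0.
Qed.

(** Differentiating stresses gives one inclusion. For the other, by [dual_span], a vector
    annihilating the rows of all stress matrices must annihilate every affine dependence; it does,
    being affine by assumption. *)
Lemma partials_span_eq :
  (forall F G : {set 'I_n}, F \in D -> G \subset F -> G \in D) ->
  (forall v, [set v]%SET \in D) ->
  (forall q : 'I_n -> R,
    (forall W, stress_matrix D P W -> forall x, \sum_y W x y * q y = 0) ->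
    exists e, forall v, q v = dotv (P v) e) ->
  partials_span (affine_stress 2 D p) = affine_stress 1 D p.
Proof.
move=> down vD aff; apply/seteqP; split=> lam.
  move=> [k [c [f [hf ->]]]].
  have hs i : affine_stress 1 D p (f i).
    by have [om hom [v ->]] := hf i; apply: affine_stress_deriv.
  have ex i : f i = \sum_v (f i)@_(U_(v)) *: 'X_v.
    by apply: homog1_expand; case: (hs i).
  have -> : \sum_(i < k) c i *: f i =
      \sum_v (\sum_(i < k) c i * (f i)@_(U_(v))) *: 'X_v.
    under eq_bigr => i _ do rewrite ex scaler_sumr.
    rewrite exchange_big /=; apply: eq_bigr => v _; rewrite scaler_suml.
    by apply: eq_bigr => i _; rewrite scalerA.
  apply/affine_stress1P => //.
  under eq_bigr => v _ do rewrite scaler_suml.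
  rewrite exchange_big /=; apply: big1 => i _.
  under eq_bigr => v _ do rewrite -scalerA.
  rewrite -scaler_sumr (_ : \sum_v _ = 0) ?scaler0 //.
  by apply/affine_stress1P => //; rewrite -ex.
move=> hlam; have lamE : lam = \sum_v lam@_(U_(v)) *: 'X_v.
  by apply: homog1_expand; case: hlam.
rewrite lamE in hlam; have /affine_stress1P dep := hlam.
pose x := \row_v lam@_(U_(v)).
pose S (s : 'rV[R]_n) := exists2 W, stress_matrix D P W & exists z, s = row z W.
have [u hu|k [c [f [fS xE]]]] := @dual_span R n S x.
  have [W hW z|e he] := aff (fun v => u v 0).
    have /matrixP/(_ 0 0) : row z W *m u = 0 by apply: hu; exists W => //; exists z.
    by rewrite !mxE => h; rewrite -[RHS]h; apply: eq_bigr => y _; rewrite mxE.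
  apply/matrixP => i j; rewrite !ord1 !mxE.
  transitivity (dotv e (\sum_v lam@_(U_(v)) *: hat (p v))).
    rewrite dotv_sumr; apply: eq_bigr => v _.
    by rewrite dotvZr !mxE he dotvC.
  by rewrite dep // dotv0r.
exists k, c, (fun i => \sum_v f i 0 v *: 'X_v); split=> [i|].
  have [W hW [z ->]] := fS i; exists (stress_poly W); first exact: stress_poly_stress.
  exists z; rewrite stress_poly_deriv; last by case: hW.
  by apply: eq_bigr => v _; rewrite mxE.
rewrite lamE; under [RHS]eq_bigr => i _ do rewrite scaler_sumr.
rewrite exchange_big /=; apply: eq_bigr => v _.
have /rowP/(_ v) := xE; rewrite mxE => ->; rewrite summxE scaler_suml.
by apply: eq_bigr => i _; rewrite scalerA mxE.
Qed.

End Stresses.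

(** * Recovering the points up to affine equivalence *)

Definition spanning (K : fieldType) (V : finType) m (P : V -> 'rV[K]_m) :=
  forall e, (forall v, dotv (P v) e = 0) -> e = 0.

(** Preservation of dependences yields a matrix [B] with [hat (p' v) = hat (p v) *m B]. It is
    invertible because the points [p'] span, and its last column is that of the identity because the
    points [p] span; its left blocks then give the affine map. *)
Lemma affine_equivalence (R : realType) n d (p p' : 'I_n -> 'rV[R]_d) :
  spanning (fun v => hat (p v)) -> spanning (fun v => hat (p' v)) ->
  (forall c : 'I_n -> R, \sum_v c v *: hat (p v) = 0 -> \sum_v c v *: hat (p' v) = 0) ->
  affinely_equivalent p p'.
Proof.
move=> sp sp' h.
pose PM (r : 'I_n -> 'rV[R]_d) := \matrix_v hat (r v).
have PMe r (e : 'rV[R]_(d + 1)) v : (PM r *m e^T) v 0 = dotv (hat (r v)) e.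
  by rewrite dotvE mxE; apply: eq_bigr => j _; rewrite !mxE.
have : ((PM p')^T <= (PM p)^T)%MS.
  apply: annihilator_submx => u pu.
  have comb r : (PM r)^T *m u = (\sum_v u v 0 *: hat (r v))^T.
    apply/matrixP => i j; rewrite !mxE summxE ord1; apply: eq_bigr => v _.
    by rewrite !mxE mulrC.
  rewrite comb h ?trmx0 //; apply: trmx_inj; rewrite -comb pu trmx0 //.
move=> /submxP[B0 eB0].
pose B := B0^T.
have eB : PM p' = PM p *m B.
  by apply: trmx_inj; rewrite eB0 trmx_mul /B trmxK.
have hB v : hat (p' v) = hat (p v) *m B.
  by have /(congr1 (row v)) := eB; rewrite row_mul !rowK.
have Bu : B \in unitmx.
  rewrite -unitmx_tr -row_free_unit; apply: inj_row_free => e eB'.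
  apply: sp' => v; rewrite -PMe eB -mulmxA (_ : B *m e^T = 0) ?mulmx0 ?mxE //.
  by apply: trmx_inj; rewrite trmx_mul trmxK eB' trmx0.
rewrite -[B]submxK in hB Bu.
set A := ulsubmx B in hB Bu; set u := ursubmx B in hB Bu.
set b := dlsubmx B in hB Bu; set c := drsubmx B in hB Bu.
have h2 v : p' v = p v *m A + b /\ 1%:M = p v *m u + c.
  have := hB v; rewrite /hat mul_row_block !mul1mx.
  by move/eq_row_mx.
have [u0 c1] : u^T = 0 /\ (c - 1%:M)^T = 0.
  apply/eq_row_mx; rewrite row_mx0; apply: sp => v.
  rewrite /dotv /hat tr_row_mx !trmxK mul_row_col mul1mx addrA.
  by case: (h2 v) => _ <-; rewrite subrr mxE.
exists A, b; split; last by move=> v; case: (h2 v).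
rewrite -row_free_unit; apply: inj_row_free => w wA.
have : row_mx w 0 *m block_mx A u b c = 0.
  rewrite mul_row_block !mul0mx !addr0 wA.
  have -> : u = 0 by apply: trmx_inj; rewrite u0 trmx0.
  by rewrite mulmx0 row_mx0.
move/(congr1 (fun x => x *m invmx (block_mx A u b c))).
by rewrite mulmxK // mul0mx => /eqP; rewrite row_mx_eq0 => /andP[/eqP].
Qed.

(** * Pseudomanifolds *)

Section Combinatorics.
Variables (n d : nat) (D : {set {set 'I_n}}).
Implicit Types (F G H S rho : {set 'I_n}).

(** Common ground of both cases: facets are recognized by cardinality, and the two facets at a ridge
    are given by their extra vertices. *)
Definition closed_pseudomanifold :=
  [/\ simplicial_complex D,
      (forall F, F \in D -> (#|F| <= d)%N),
      (forall S, S \in D -> exists F : {set 'I_n}, [/\ F \in D, S \subset F & #|F| = d])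
    & (forall G, G \in D -> #|G| = d.-1 ->
        exists a b, [/\ a != b, a \notin G /\ b \notin G, a |: G \in D, b |: G \in D
        & forall c, c \notin G -> c |: G \in D -> c = a \/ c = b])].

(** Strong connectivity of the star of [rho] as an induction principle, in place of explicit paths
    of facets. *)
Definition star_connected rho := forall Q : {set 'I_n} -> Prop,
  (forall G a b, rho \subset G -> #|G| = d.-1 -> a \notin G -> b \notin G -> a != b ->
     a |: G \in D -> b |: G \in D -> Q (a |: G) -> Q (b |: G)) ->
  forall F F', F \in D -> #|F| = d -> rho \subset F ->
    F' \in D -> #|F'| = d -> rho \subset F' -> Q F -> Q F'.

Lemma minimal_nonface : (forall F G, F \in D -> G \subset F -> G \in D) ->
  no_missing_face_of_dim_ge D (d - 2) -> (4 <= d)%N ->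
  forall S, S \notin D -> exists M : {set 'I_n}, [/\ M \subset S, M \notin D,
    forall v, v \in M -> M :\ v \in D & (#|M| <= d - 2)%N].
Proof.
move=> down nm d4 S SD.
have [M /minsetP[MD Mmin] MS] := @minset_exists _ (fun G => G \notin D) S SD.
have sub F : F \proper M -> F \in D.
  move=> FM; apply: contraT => FD; move: (FM); rewrite (Mmin F) ?properxx //.
  exact: proper_sub.
exists M; split=> //.
- by move=> v vM; apply: sub; rewrite properD1.
(* Dimension at least [d - 2] is cardinality at least [d - 1], whence the bound [d - 2] on
   [#|M|]. *)
- by have := nm M (conj MD sub); rewrite -leqNgt => h; clear -h; lia.
Qed.

Lemma facet_ext G F : F \in D -> #|F| = d -> (0 < d)%N -> #|G| = d.-1 -> G \subset F ->
  exists2 c, c \notin G & F = c |: G.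
Proof.
move=> FD Fd d0 Gd GF.
have /cards1P[c ec] : #|F :\: G| == 1%N.
  by rewrite cardsD (setIidPr GF) Gd Fd; apply/eqP; clear -d0; lia.
have /setDP[cF cG] : c \in F :\: G by rewrite ec finset.inE.
exists c => //; apply/setP => v; have /setP/(_ v) := ec.
rewrite finset.in_setD finset.in_set1 (finset.in_setU1 v c) => <-.
by case: (boolP (v \in G)) => [/(subsetP GF) ->|_] /=; rewrite ?orbT ?orbF.
Qed.

Definition link_facets rho := [set F :\: rho | F : {set 'I_n} in
  [set F : {set 'I_n} | [&& F \in D, #|F| == d & rho \subset F]]]%SET.

Lemma link_facetsP rho (t : {set 'I_n}) :
  reflect (exists F, [/\ F \in D, #|F| = d, rho \subset F & t = F :\: rho])
  (t \in link_facets rho).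
Proof.
apply: (iffP finset.imsetP) => [[F]|[F [h1 h2 h3 h4]]].
  by rewrite finset.inE => /and3P[h1 /eqP h2 h3] h4; exists F.
by exists F => //; rewrite finset.inE h1 h2 eqxx h3.
Qed.

Section Link.
Variable rho : {set 'I_n}.
Hypothesis d4 : (4 <= d)%N.
Hypothesis psD : closed_pseudomanifold.
Hypothesis rd : #|rho| = (d - 3)%N.

Lemma card_link_facet (t : {set 'I_n}) : t \in link_facets rho -> #|t| = 3%N.
Proof.
move=> /link_facetsP[F [_ Fd rF ->]]; rewrite cardsD (setIidPr rF) Fd rd.
move: d4; clear; lia.
Qed.

(** If [e] lies in a triangle, then [e :|: rho] is a ridge, and its two facets are the triangles at
    [e]. *)
Lemma link_facets_edge (e : {set 'I_n}) : #|e| = 2%N ->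
  #|[set t in link_facets rho | e \subset t]%SET| \in [:: 0; 2]%N.
Proof.
move=> e2; pose G := e :|: rho.
have Gsub (F : {set 'I_n}) : rho \subset F -> e \subset F :\: rho -> G \subset F.
  by move=> rF; rewrite subsetD => /andP[eF _]; rewrite subUset eF.
have [/existsP[t0 /andP[t0S et0]]|] := boolP [exists t, (t \in link_facets rho) && (e \subset t)]; last first.
  move=> /existsPn h; rewrite eq_card0 // => t; rewrite inE; apply/negbTE; exact: h.
have /link_facetsP[F1 [F1D F1d rF1 et1]] := t0S; rewrite et1 in et0.
have er : [disjoint e & rho] by move: et0; rewrite subsetD => /andP[].
have GF1 := Gsub F1 rF1 et0.
have GD : G \in D by case: psD => -[_ _ down] _ _ _; apply: down F1D GF1.
have Gd : #|G| = d.-1.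
  by rewrite /G cardsU (disjoint_setI0 er) cards0 subn0 e2 rd; move: d4; clear; lia.
case: psD => _ _ _ /(_ G GD Gd)[a [b [ab [aG bG] aD bD hc]]].
have ainr x : x \notin G -> x \notin rho by apply: contra => h; rewrite !inE h orbT.
have d0 : (0 < d)%N by apply: leq_trans d4.
have tE x : x \notin G -> (x |: G) :\: rho = x |: e.
  move=> xG; apply/setP => v; rewrite !inE.
  have [->|vx] := eqVneq v x; first by rewrite (ainr x xG).
  case: (boolP (v \in rho)) => vr; rewrite /= ?orbF //.
  by apply/esym/negbTE; apply: contraL vr => ve; rewrite (disjointFr er ve).
rewrite (_ : [set t in link_facets rho | e \subset t] = [set a |: e; b |: e]).
  rewrite cards2 (_ : a |: e != b |: e) //.
  apply: contra aG => /eqP/setP/(_ a); rewrite !inE eqxx (negPf ab) /=.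
  by move=> <-.
apply/setP => t; rewrite !inE; apply/andP/orP => [[/link_facetsP[F [FD Fd rF ->]] eF]|].
  have GF := Gsub F rF eF.
  have [c cG eFc] := facet_ext FD Fd d0 Gd GF.
  rewrite eFc tE //; rewrite eFc in FD.
  by case: (hc c cG FD) => ->; rewrite eqxx; [left|right].
have mem x : x \notin G -> x |: G \in D -> (x |: e \in link_facets rho) /\ e \subset x |: e.
  move=> xG xD; split; last exact: subsetUr.
  apply/link_facetsP; exists (x |: G); split=> //; last by rewrite tE.
    by rewrite cardsU1 xG Gd add1n prednK.
  by apply: subset_trans (subsetUr _ _); apply: subsetUr.
by case=> /eqP->; apply: mem.
Qed.

End Link.

Section Normal.
Hypothesis d4 : (4 <= d)%N.
Hypothesis nD : normal_pseudomanifold d D.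

Let down F G : F \in D -> G \subset F -> G \in D.
Proof. by case: nD => [[_ _ h] _ _ _]; apply: h. Qed.

Let ext_facet S : S \in D -> exists F : {set 'I_n}, [/\ facet D F, F \in D, S \subset F & #|F| = d].
Proof.
move=> SD; have [F Fm SF] := @maxset_exists _ (fun G => G \in D) S SD.
exists F; split=> //; first by case/maxsetP: Fm.
by case: nD => _ h _ _; apply: h.
Qed.

Let card_le F : F \in D -> (#|F| <= d)%N.
Proof. by move=> /ext_facet[H [_ _ FH <-]]; apply: subset_leq_card. Qed.

Let facetE F : facet D F = (F \in D) && (#|F| == d).
Proof.
apply/idP/andP => [Fm|[FD /eqP Fd]].
  split; first by case/maxsetP: Fm.
  by apply/eqP; case: nD => _ h _ _; apply: h.
apply/maxsetP; split=> // H HD FH; apply/esym/eqP; rewrite eqEcard FH /=.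
by rewrite Fd card_le.
Qed.

Lemma normal_closed_pseudomanifold : closed_pseudomanifold.
Proof.
split=> //; first by case: nD.
  by move=> S /ext_facet[F [_ h1 h2 h3]]; exists F.
move=> G GD Gd; case: nD => _ _ /(_ G GD Gd) /eqP/cards2P[F1 [F2 [F12 e]]] _.
have inF F : (F \in [set F1; F2]%SET) = [&& F \in D, #|F| == d & G \subset F].
  by rewrite -e finset.inE facetE andbA.
have d0 : (0 < d)%N by apply: leq_trans d4.
have /and3P[F1D /eqP F1d GF1] : [&& F1 \in D, #|F1| == d & G \subset F1].
  by rewrite -inF !finset.inE eqxx.
have /and3P[F2D /eqP F2d GF2] : [&& F2 \in D, #|F2| == d & G \subset F2].
  by rewrite -inF !finset.inE eqxx orbT.
have [a aG ea] := facet_ext F1D F1d d0 Gd GF1.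
have [b bG eb] := facet_ext F2D F2d d0 Gd GF2.
exists a, b; split; rewrite -?ea -?eb //.
  by apply: contraNneq F12 => ab; rewrite ea eb ab.
move=> c cG cD; have : c |: G \in [set F1; F2]%SET.
  rewrite inF cD finset.cardsU1 cG Gd add1n prednK // eqxx /=.
  exact: subsetUr.
have cinv x : x \notin G -> c |: G = x |: G -> c = x.
  move=> xG /setP/(_ c); rewrite !finset.inE eqxx (negPf cG) !orbF /=.
  by move=> /esym/eqP.
by rewrite !finset.inE => /orP[]/eqP; rewrite ?ea ?eb => h; [left|right]; apply: cinv.
Qed.

Lemma normal_star_connected rho : rho \in D -> star_connected rho.
Proof.
move=> rD; have [k] := ubnP (d - #|rho|); elim: k rho rD => // k IH rho rD hk.
move=> Q step F F' FD Fd rF F'D F'd rF' QF.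
have d0 : (0 < d)%N by apply: leq_trans d4.
have [rd|rd] := leqP #|rho| (d - 2); last first.
  have [er|er] := eqVneq #|rho| d.
    have eF H : #|H| = d -> rho \subset H -> H = rho.
      by move=> Hd rH; apply/esym/eqP; rewrite eqEcard rH Hd er leqnn.
    by rewrite (eF F') // -(eF F).
  have er' : #|rho| = d.-1.
    have := card_le rD; move: er rd d4; clear; lia.
  have [a aG ea] := facet_ext FD Fd d0 er' rF.
  have [b bG eb] := facet_ext F'D F'd d0 er' rF'.
  have [ab|ab] := eqVneq a b; first by rewrite eb -ab -ea.
  by rewrite eb; apply: (step rho a b); rewrite -?ea -?eb.
have pick H : #|H| = d -> rho \subset H -> exists2 x, x \in H & x \notin rho.
  move=> Hd rH; suff /subsetPn : ~~ (H \subset rho) by [].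
  apply/negP => /subset_leq_card; rewrite Hd; move: rd d4; clear; lia.
have star_x x : x \notin rho -> x |: rho \in D -> forall H H',
    H \in D -> #|H| = d -> x |: rho \subset H ->
    H' \in D -> #|H'| = d -> x |: rho \subset H' -> Q H -> Q H'.
  move=> xr xD H H' HD Hd rH H'D H'd rH'.
  apply: (IH (x |: rho)) => //.
    rewrite finset.cardsU1 xr; move: hk rd d4; clear; lia.
  move=> G a b rG; apply: step; apply: subset_trans rG; apply: subsetUr.
have [a aF ar] := pick F Fd rF; have [b bF br] := pick F' F'd rF'.
have lk x H : x \in H -> x \notin rho -> rho \subset H -> H \in D ->
    [set x]%SET \in link D rho /\ x |: rho \in D.
  move=> xH xr rH HD.
  have xD : x |: rho \in D by apply: down HD _; rewrite finset.subUset finset.sub1set xH.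
  by split=> //; rewrite finset.inE xD finset.disjoints1.
have [la aD] := lk a F aF ar rF FD; have [lb bD] := lk b F' bF br rF' F'D.
have /connectP[s sp sl] : connect (fun x y => [set x; y]%SET \in link D rho) a b.
  by case: nD => _ _ _ h; apply: (h rho rD rd).
have Qa H : H \in D -> #|H| = d -> a |: rho \subset H -> Q H.
  move=> HD Hd aH; apply: (star_x a ar aD F H) => //.
  by rewrite finset.subUset finset.sub1set aF.
have subx x H : x \in H -> rho \subset H -> x |: rho \subset H.
  by move=> xH rH; rewrite finset.subUset finset.sub1set xH.
suff : forall H, H \in D -> #|H| = d -> b |: rho \subset H -> Q H.
  by apply=> //; apply: subx.
move=> {F F' FD Fd rF F'D F'd rF' QF aF bF la lb}.
elim: s a ar aD sp sl Qa => [|c s IHs] a ar aD /=.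
  by move=> _ <-.
move=> /andP[ac sp] sl Qa; move: ac; rewrite finset.inE => /andP[acD dis].
have cr : c \notin rho.
  apply: contraL dis => cr; rewrite -finset.setI_eq0.
  by apply/finset.set0Pn; exists c; rewrite !finset.inE eqxx orbT cr.
have acr : [set a; c]%SET :|: rho = c |: (a |: rho).
  by rewrite -finset.setUA finset.setUCA.
have cD : c |: rho \in D.
  by apply: down acD _; rewrite acr finset.setUCA subsetUr.
have [H0 [_ H0D acH0 H0d]] := ext_facet acD.
rewrite acr in acH0.
have QH0 : Q H0 by apply: Qa => //; apply: subset_trans acH0; apply: subsetUr.
apply: (IHs c cr cD sp sl) => H HD Hd cH.
apply: (star_x c cr cD H0 H) => //.
by apply: subset_trans acH0; rewrite finset.setUCA subsetUr.
Qed.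

End Normal.
End Combinatorics.

(** * From rigid stars to the span of the partial derivatives *)

Lemma lin_indep_sub (K : fieldType) (V : finType) m (P : V -> 'rV[K]_m) (A B : {set V}) :
  A \subset B -> lin_indep P B -> lin_indep P A.
Proof.
move=> AB h c c0 v vA.
have := h (fun v => if v \in A then c v else 0) _ v (subsetP AB v vA).
rewrite vA; apply; rewrite (bigID (mem A)) /= [X in _ + X]big1 => [|w /andP[_ /negPf->]].
  rewrite addr0 -[RHS]c0; apply: eq_big => w; last by case/andP => _ ->.
  by apply: andb_idl; apply: (subsetP AB).
by rewrite scale0r.
Qed.

Lemma spanning_lin_indep (K : fieldType) (V : finType) m (P : V -> 'rV[K]_m) (B : {set V}) :
  #|B| = m -> (forall e, (forall v, v \in B -> dotv (P v) e = 0) -> e = 0) ->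
  lin_indep P B.
Proof.
move=> Bm sp c c0.
pose M : 'M[K]_(m) := \matrix_(i < m) P (enum_val (cast_ord (esym Bm) i)).
have Mu : M \in unitmx.
  rewrite -unitmx_tr -row_free_unit; apply: inj_row_free => e e0.
  apply: sp => v vB; pose i := cast_ord Bm (enum_rank_in vB v).
  have := congr1 (fun A : 'rV_m => A 0 i) e0; rewrite !mxE => h.
  rewrite dotvE -[RHS]h; apply: eq_bigr => j _.
  by rewrite !mxE mulrC /i cast_ordK enum_rankK_in.
pose w : 'rV[K]_m := \row_i c (enum_val (cast_ord (esym Bm) i)).
have wM : w *m M = 0.
  rewrite mulmx_sum_row -[RHS]c0 [RHS]big_enum_val /=.
  rewrite (reindex (cast_ord Bm)) /=; last first.
    by exists (cast_ord (esym Bm)) => i _; rewrite ?cast_ordK ?cast_ordKV.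
  by apply: eq_bigr => i _; rewrite rowK mxE cast_ordK.
have w0 : w = 0 by rewrite -(mulmxK Mu w) wM mul0mx.
move=> v vB; have /rowP/(_ (cast_ord Bm (enum_rank_in vB v))) := w0.
by rewrite !mxE cast_ordK enum_rankK_in.
Qed.

Section Core.
Variables (R : realType) (n d : nat) (D : {set {set 'I_n}}) (p : 'I_n -> 'rV[R]_d).
Local Notation P := (fun v => hat (p v)).
Hypothesis d4 : (4 <= d)%N.
Hypothesis psD : closed_pseudomanifold d D.
Hypothesis connD : star_connected d D set0.
Hypothesis spanD : adjacent_facets_span d D P.
Hypothesis rigidD : rigid_stars d D P.

Let down (F G : {set 'I_n}) : F \in D -> G \subset F -> G \in D.
Proof. by case: psD => -[_ _ h] _ _ _; apply: h. Qed.

Let d0 : (0 < d)%N.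
Proof. exact: leq_trans d4. Qed.

Let two_facets : exists a b (G : {set 'I_n}), [/\ a != b, a \notin G /\ b \notin G,
  a |: G \in D, b |: G \in D & #|G| = d.-1].
Proof.
case: psD => -[eD _ _] _ pure ridge.
have [F [FD _ Fd]] := pure _ eD.
have /card_gt0P[x xF] : (0 < #|F|)%N by rewrite Fd.
have GD : F :\ x \in D by apply: down FD _; apply: subD1set.
have Gd : #|F :\ x| = d.-1 by rewrite -Fd (cardsD1 x F) xF.
have [a [b [h1 h2 h3 h4 _]]] := ridge _ GD Gd.
by exists a, b, (F :\ x).
Qed.

Lemma spanning_hat : spanning P.
Proof.
have [a [b [G [ab [aG bG] aD bD Gd]]]] := two_facets.
by move=> e he; apply: (spanD ab aG bG aD bD Gd) => v _; apply: he.
Qed.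

(** [F] and a neighbour across a ridge have together [d + 1] points; they span a space of dimension
    [d + 1], hence are independent. *)
Lemma facet_indep (F : {set 'I_n}) : F \in D -> #|F| = d -> lin_indep P F.
Proof.
case: psD => _ _ _ ridge FD Fd.
have /card_gt0P[x xF] : (0 < #|F|)%N by rewrite Fd.
have GD : F :\ x \in D by apply: down FD _; apply: subD1set.
have Gd : #|F :\ x| = d.-1 by rewrite -Fd (cardsD1 x F) xF.
have [a [b [ab [aG bG] aD bD hc]]] := ridge _ GD Gd.
apply: (@lin_indep_sub _ _ _ _ _ (a |: (b |: (F :\ x)))).
  have xG : x \notin F :\ x by rewrite !inE eqxx.
  have xD : x |: (F :\ x) \in D by rewrite setD1K.
  apply/subsetP => v vF; rewrite !inE.
  by have [->|vx] := eqVneq v x;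
    [case: (hc x xG xD) => ->; rewrite eqxx ?orbT|rewrite vF /= !orbT].
apply: spanning_lin_indep; last exact: spanD.
rewrite cardsU1 in_setU1 negb_or ab aG /= cardsU1 bG Gd; move: d0; clear; lia.
Qed.

Lemma partials_span_stress : no_missing_face_of_dim_ge D (d - 2) ->
  partials_span (affine_stress 2 D p) = affine_stress 1 D p.
Proof.
move=> nm; case: psD => -[eD vD _] cD pure ridge.
apply: partials_span_eq => // q hq.
apply: (affine_from_stress d4 down ridge facet_indep spanD
  (minimal_nonface down nm d4) rigidD (flex_of_annihilator hq) eD vD pure).
move=> Q step F F' FD Fd F'D F'd; apply: connD => //; last 2 first.
- exact: sub0set.
- exact: sub0set.
by move=> G a b _; apply: step.
Qed.

End Core.

(** * Generic embeddings *)

Section GenericEmbedding.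
Variables (R : realType) (n d : nat) (p : 'I_n -> 'rV[R]_d).
Hypothesis gen_p : generic p.

(** Flattened by [mxvec] as in [generic], so that [generic p] is literally the independence assumed
    by [generic_transfer] for [coord_pt p]. *)
Definition coord_pt (K : nzRingType) (s : 'I_n -> 'rV[K]_d) (k : 'I_(n * d)) : K :=
  mxvec (\matrix_(v, j) s v 0 j) 0 k.

Definition coord_var v j : {mpoly int[n * d]} := 'X_(mxvec_index v j).

Lemma int_eval_coord (K : comNzRingType) (s : 'I_n -> 'rV[K]_d) v j :
  int_eval (coord_pt s) (coord_var v j) = s v 0 j.
Proof. by rewrite /int_eval mmapX mmap1U /coord_pt mxvecE mxE. Qed.

Lemma generic_spans (B : {set 'I_n}) : #|B| = d.+1 ->
  forall e, (forall v, v \in B -> dotv (hat (p v)) e = 0) -> e = 0.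
Proof.
move=> Bd e he.
pose c (i : 'I_(d + 1)) (v : 'I_n) : {mpoly int[n * d]} :=
  if v \in B then match split i with inl j => coord_var v j | inr _ => 1 end else 0.
have cE (K : fieldType) (s : 'I_n -> 'rV[K]_d) (u : 'I_(d + 1) -> K) v :
    \sum_i u i * int_eval (coord_pt s) (c i v) =
    if v \in B then dotv (hat (s v)) (\row_i u i) else 0.
  rewrite /c; case: (v \in B); last first.
    by rewrite big1 // => i _; rewrite /int_eval rmorph0 mulr0.
  rewrite dotvE; apply: eq_bigr => i _; rewrite !mxE mulrC; congr (_ * _).
  case: (split i) => j; first by rewrite int_eval_coord.
  by rewrite /int_eval rmorph1 mxE !ord1.
(* The standard simplex: the origin and the basis vectors, in the order of [enum B]. *)
pose s (v : 'I_n) : 'rV[rat]_d := \row_j (index v (enum B) == j.+1)%:R.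
have key (u : 'I_(d + 1) -> rat) :
    (forall v, \sum_i u i * int_eval (coord_pt s) (c i v) = 0) -> forall i, u i = 0.
  move=> hu.
  have val k (kd : (k < d.+1)%N) : exists2 v, v \in B & index v (enum B) = k.
    have kB : (k < size (enum B))%N by rewrite -cardE Bd.
    have /set0Pn[v0 _] : B != finset.set0 by rewrite -card_gt0 Bd.
    exists (nth v0 (enum B) k); first by rewrite -mem_enum mem_nth.
    by rewrite index_uniq ?enum_uniq.
  have hv v : v \in B -> \sum_j s v 0 j * u (lshift 1 j) + u (rshift d 0) = 0.
    move=> vB; have := hu v; rewrite cE vB dotvE big_split_ord big_ord1 /=.
    rewrite hat_r mul1r mxE => h; rewrite -[RHS]h; congr (_ + _).
    by apply: eq_bigr => j _; rewrite hat_l !mxE.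
  have u0 : u (rshift d 0) = 0.
    have [v vB ev] := val 0%N (ltn0Sn d); have := hv v vB.
    by rewrite big1 ?add0r // => j _; rewrite mxE ev mul0r.
  move=> i; rewrite -(splitK i); case: (split i) => j /=; last by rewrite (ord1 j).
  have [v vB ev] := val j.+1 (ltn_ord j); have := hv v vB.
  rewrite u0 addr0 (bigD1 j) //= big1 => [|k kj].
    by rewrite mxE ev eqxx mul1r addr0.
  by rewrite mxE ev eqSS (inj_eq val_inj) eq_sym (negPf kj) mul0r.
have := generic_transfer gen_p key (u := fun i => e 0 i).
move=> H; apply/rowP => i; rewrite mxE; apply: H => v.
rewrite (cE R p); case: ifP => // vB; rewrite -[RHS](he v vB).
by congr dotv; apply/rowP => j; rewrite mxE.
Qed.

Variable D : {set {set 'I_n}}.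
Hypothesis d4 : (4 <= d)%N.
Hypothesis psD : closed_pseudomanifold d D.
Hypothesis connD : forall rho, rho \in D -> star_connected d D rho.

Lemma generic_adjacent_facets_span : adjacent_facets_span d D (fun v => hat (p v)).
Proof.
move=> a b G ab aG bG aD bD Gd; apply: generic_spans.
rewrite cardsU1 in_setU1 negb_or ab aG /= cardsU1 bG Gd; move: d4; clear; lia.
Qed.

Section Star.
Variables (rho F0 : {set 'I_n}).
Hypothesis rD : rho \in D.
Hypothesis rd : #|rho| = (d - 3)%N.
Hypothesis F0D : F0 \in D.
Hypothesis F0d : #|F0| = d.
Hypothesis rF0 : rho \subset F0.

Definition star_edge x y :=
  [exists F : {set 'I_n}, [&& F \in D, #|F| == d, rho \subset F, x \in F & y \in F]].

Let star_edgeP x y : reflect (exists F : {set 'I_n},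
  [/\ F \in D, #|F| = d, rho \subset F, x \in F & y \in F]) (star_edge x y).
Proof.
apply: (iffP existsP) => -[F].
  by case/and5P => h1 /eqP h2 h3 h4 h5; exists F; split.
by case=> h1 h2 h3 h4 h5; exists F; rewrite h1 h2 eqxx h3 h4 h5.
Qed.

Let pinned x := (x \in F0) || ~~ star_edge x x.

(** Pinning a facet removes the trivial motions, so that rigidity becomes injectivity of a linear
    system, as [generic_transfer] requires. Vertices off the star are pinned too, so that the
    unknowns can range over all vertices. *)
Definition pinned_flex (K : fieldType) (s : 'I_n -> 'rV[K]_d) (u : 'I_n -> 'rV[K]_d) :=
  (forall x, pinned x -> u x = 0) /\
  (forall x y, star_edge x y -> dotv (u x - u y) (s x - s y) = 0).

Lemma pinned_flex_transfer (K : fieldType) (s : 'I_n -> 'rV[K]_d) :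
  (forall u, pinned_flex s u -> forall x, u x = 0) ->
  forall u, pinned_flex p u -> forall x, u x = 0.
Proof.
(* One unknown per velocity coordinate; one equation per pair of vertices, trivial unless the pair
   lies in a facet of the star, and one per pinned coordinate. *)
pose c (i : 'I_n * 'I_d) (e : ('I_n * 'I_n) + ('I_n * 'I_d)) : {mpoly int[n * d]} :=
  match e with
  | inl (x, y) => if star_edge x y then
      ((i.1 == x)%:R - (i.1 == y)%:R) * (coord_var x i.2 - coord_var y i.2) else 0
  | inr (x, j) => if pinned x then ((i.1 == x) && (i.2 == j))%:R else 0
  end.
have cl (L : fieldType) (s' : 'I_n -> 'rV[L]_d) (u : 'I_n * 'I_d -> L) x y :
    star_edge x y ->
    \sum_i u i * int_eval (coord_pt s') (c i (inl (x, y))) =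
    dotv ((\row_j u (x, j)) - (\row_j u (y, j))) (s' x - s' y).
  move=> xy; rewrite /c xy dotvE.
  rewrite sum_pair exchange_big /=; apply: eq_bigr => j _.
  have ev (b b' : bool) : int_eval (coord_pt s') ((b%:R - b'%:R) *
      (coord_var x j - coord_var y j)) = (b%:R - b'%:R) * (s' x 0 j - s' y 0 j).
    by rewrite -!int_eval_coord /int_eval rmorphM !rmorphB !rmorph_nat.
  under eq_bigr => v _ do rewrite /= ev mulrA [u _ * _]mulrBr.
  rewrite -mulr_suml !mxE sumrB; congr ((_ - _) * _).
    rewrite (bigD1 x) //= eqxx mulr1 big1 ?addr0 // => v /negPf->.
    by rewrite mulr0.
  rewrite (bigD1 y) //= eqxx mulr1 big1 ?addr0 // => v /negPf->.
  by rewrite mulr0.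
have cr (L : fieldType) (s' : 'I_n -> 'rV[L]_d) (u : 'I_n * 'I_d -> L) x j :
    pinned x ->
    \sum_i u i * int_eval (coord_pt s') (c i (inr (x, j))) = u (x, j).
  move=> px; rewrite /c px (bigD1 (x, j)) //= !eqxx /int_eval rmorph1 mulr1.
  rewrite big1 ?addr0 // => -[v k] /=; rewrite xpair_eqE => /negPf->.
  by rewrite rmorph0 mulr0.
move=> hK u [pu eu] x; apply/rowP => j; rewrite mxE.
have := @generic_transfer _ _ _ gen_p _ _ c K (coord_pt s).
move=> /(_ _ (fun i => u i.1 0 i.2)) H; apply: (H _ _ (x, j)).
  move=> w hw i.
  have pw : pinned_flex s (fun v => \row_j w (v, j)).
    split=> [v pv|v v' vv].
      by apply/rowP => k; rewrite !mxE -[RHS](hw (inr (v, k))) cr.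
    by rewrite -[RHS](hw (inl (v, v'))) cl.
  by have /rowP/(_ i.2) := hK _ pw i.1; rewrite !mxE -surjective_pairing.
move=> [[v v']|[v k]].
  have [vv|/negPf vv] := boolP (star_edge v v').
    rewrite cl // -[RHS](eu v v' vv).
    by congr dotv; congr (_ - _); apply/rowP => k; rewrite mxE.
  by rewrite big1 // => i _; rewrite /c vv /int_eval rmorph0 mulr0.
have [pv|/negPf pv] := boolP (pinned v).
  by rewrite cr //= pu // mxE.
by rewrite big1 // => i _; rewrite /c pv /int_eval rmorph0 mulr0.
Qed.

Let d3 : (3 <= d)%N.
Proof. exact: ltnW. Qed.

Let K := {fraction {mpoly 'F_2[n * 3]}}.
Let low (k : 'I_3) : 'I_d := widen_ord d3 k.

(* The vertices of [rho] go to the basis vectors beyond the first three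
   coordinates, so that flexes of the star pinned at [F0] are flexes of the link
   of [rho] placed generically in dimension three. *)
Definition special_pt (v : 'I_n) : 'rV[K]_d :=
  \row_j (if v \in rho then (j == (3 + index v (enum rho))%N :> nat)%:R
          else if (j < 3)%N then frac_pt v 0 (inord j) else 0).

Let sum_low (f : 'I_d -> K) (g : 'I_3 -> K) :
  \sum_j f j * (if (j < 3)%N then g (inord j) else 0) = \sum_k f (low k) * g k.
Proof.
rewrite -(eq_bigr _ (fun k _ => congr1 (fun x => f (low k) * g x) (inord_val k))).
rewrite -(big_ord_narrow d3 (F := fun j => f j * g (inord j))) /=.
rewrite [RHS]big_mkcond /=; apply: eq_bigr => j _.
by case: ifP => // _; rewrite mulr0.
Qed.

Section SpecialFlex.
Variable u : 'I_n -> 'rV[K]_d.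
Hypothesis uflex : pinned_flex special_pt u.
Let mu v : 'rV[K]_3 := \row_k u v 0 (low k).

Let Sf := link_facets d D rho.

Let SfP t := @link_facetsP n d D rho t.
Let Sf3 := @card_link_facet n d D rho d4 rd.
Let Sf_edge := @link_facets_edge n d D rho d4 psD rd.

Let flex_low t x y : t \in Sf -> x \in t -> y \in t ->
  dot3 (mu x - mu y) (frac_pt x - frac_pt y) = 0.
Proof.
move=> /SfP[F [FD Fd rF ->]] /setDP[xF xr] /setDP[yF yr].
have /(proj2 uflex) h : star_edge x y by apply/star_edgeP; exists F.
rewrite -[RHS]h dotvE.
transitivity (\sum_k (u x - u y) 0 (low k) * (frac_pt x - frac_pt y) 0 k).
  by rewrite sum3E /dot3 !mxE.
rewrite -(sum_low _ (fun k => (frac_pt x - frac_pt y) 0 k)).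
apply: eq_bigr => j _; congr (_ * _).
rewrite !mxE (negPf xr) (negPf yr); case: ifP => // _.
by rewrite subrr.
Qed.

Let mu_zero F : F \in D -> #|F| = d -> rho \subset F ->
  forall v, v \in F -> v \notin rho -> mu v = 0.
Proof.
move=> FD Fd rF.
pose Q (H : {set 'I_n}) := forall v, v \in H -> v \notin rho -> mu v = 0.
apply: (@connD rho rD Q _ F0 F) => //; last first.
  move=> v vF0 _; apply/rowP => k; rewrite mxE.
  by have -> := proj1 uflex v; rewrite ?mxE // /pinned vF0.
move=> G a b rG Gd aG bG ab aD bD QG v vF vr.
have Gr : #|G :\: rho| = 2%N.
  by rewrite cardsD (setIidPr rG) Gd rd; move: d4; clear; lia.
have /eqP/cards2P[x [y [xy exy]]] := Gr.
have inG z : z \in [set x; y] -> z \in G /\ z \notin rho.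
  by rewrite -exy => /setDP[].
have [xG xr] := inG x (set21 x y); have [yG yr] := inG y (set22 x y).
have inS c : c \notin G -> c |: G \in D -> (c |: G) :\: rho \in Sf.
  move=> cG cD; apply/SfP; exists (c |: G); split=> //.
    by rewrite cardsU1 cG Gd add1n prednK //; apply: leq_trans d4.
  by apply: subset_trans rG (subsetUr _ _).
have inU c z : z \in G -> z \notin rho -> z \in (c |: G) :\: rho.
  by move=> zG zr; rewrite !inE zr zG orbT.
apply: (generic_surface_propagate Sf3 Sf_edge flex_low (inS a aG aD) (inS b bG bD) xy
  (inU a x xG xr) (inU a y yG yr) (inU b x xG xr) (inU b y yG yr)).
  by move=> w /setDP[wF wr]; apply: QG.
by rewrite inE vr.
Qed.

Lemma special_flex_zero v : u v = 0.
Proof.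
have [/star_edgeP[F [FD Fd rF vF _]]|nv] := boolP (star_edge v v); last first.
  by apply: (proj1 uflex); rewrite /pinned nv orbT.
have [vr|vr] := boolP (v \in rho).
  by apply: (proj1 uflex); rewrite /pinned (subsetP rF0).
have mv := mu_zero FD Fd rF vF vr.
apply/rowP => j; rewrite mxE; have [j3|j3] := ltnP j 3.
  have /rowP/(_ (Ordinal j3)) := mv; rewrite !mxE => h; rewrite -[RHS]h.
  by congr (u v 0 _); apply: val_inj.
have jr : (j - 3 < size (enum rho))%N.
  by rewrite -cardE rd ltn_sub2r // (leq_ltn_trans j3).
(* [r] is the vertex of [rho] placed at the basis vector [j]. In the equation of the edge [v r] the
   low coordinates of [u v] are zero and [r] is pinned, which leaves only [- u v 0 j]. *)
pose r := nth v (enum rho) (j - 3).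
have rr : r \in rho by rewrite -mem_enum mem_nth.
have ir : index r (enum rho) = (j - 3)%N by rewrite index_uniq ?enum_uniq.
have er : star_edge v r by apply/star_edgeP; exists F; split=> //; apply: (subsetP rF).
have := proj2 uflex v r er.
rewrite (proj1 uflex r) ?subr0; last by rewrite /pinned (subsetP rF0).
rewrite dotvE.
have sE k : (special_pt v - special_pt r) 0 k =
    (if (k < 3)%N then frac_pt v 0 (inord k) else 0) - (k == (3 + (j - 3))%N :> nat)%:R.
  by rewrite /special_pt !mxE (negPf vr) rr ir.
under eq_bigr => k _ do rewrite sE mulrBr.
rewrite sumrB (sum_low (fun k => u v 0 k) (fun k => frac_pt v 0 k)) big1 => [|k _]; last first.
  by have /rowP/(_ k) := mv; rewrite !mxE => ->; rewrite mul0r.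
rewrite (bigD1 j) //= subnKC // eqxx mulr1 big1 => [|k kj].
  by rewrite addr0 sub0r => /eqP; rewrite oppr_eq0 => /eqP.
by rewrite (inj_eq val_inj) (negPf kj) mulr0.
Qed.

End SpecialFlex.
End Star.

Lemma generic_rigid_stars : rigid_stars d D (fun v => hat (p v)).
Proof.
move=> rho l rD rd flex G a b rG Gd aG bG aD bD.
have d0 : (0 < d)%N by apply: leq_trans d4.
pose F0 := a |: G.
have F0d : #|F0| = d by rewrite cardsU1 aG Gd add1n prednK.
have rF0 : rho \subset F0 by apply: subset_trans rG (subsetUr _ _).
have ind : lin_indep (fun v => hat (p v)) F0.
  by apply: facet_indep aD F0d; [exact: d4|exact: psD|exact: generic_adjacent_facets_span].
have [A [sk hA]] := skew_ext ind (flex F0 aD F0d rF0).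
pose l' v := l v - hat (p v) *m A.
have flex' F : F \in D -> #|F| = d -> rho \subset F -> forall x y, x \in F -> y \in F ->
    dotv (hat (p x)) (l' y) + dotv (hat (p y)) (l' x) = 0.
  move=> FD Fd rF x y xF yF; rewrite !dotvBr addrACA (flex F) // add0r.
  by rewrite (dotv_skew (hat (p x)) (hat (p y)) sk) opprK subrr.
(* The euclidean velocity: the last coordinate of [l'] is forced by the equation of a vertex with
   itself, and the other equations then say that [mu] preserves edge lengths to first order. *)
pose mu v : 'rV[R]_d := if star_edge rho v v then \row_j l' v 0 (lshift 1 j) else 0.
have hatdot x (y : 'rV[R]_(d + 1)) : dotv (hat x) y =
    dotv x (\row_j y 0 (lshift 1 j)) + y 0 (rshift d 0).
  rewrite !dotvE big_split_ord big_ord1 /= hat_r mul1r; congr (_ + _).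
  by apply: eq_bigr => j _; rewrite hat_l mxE.
have star x y : star_edge rho x y -> star_edge rho x x /\ star_edge rho y y.
  move=> /existsP[F /and5P[h1 h2 h3 h4 h5]].
  by split; apply/existsP; exists F; rewrite h1 h2 h3 ?h4 ?h5.
have flexs x y : star_edge rho x y ->
    dotv (hat (p x)) (l' y) + dotv (hat (p y)) (l' x) = 0.
  by move=> /existsP[F /and5P[h1 /eqP h2 h3 h4 h5]]; apply: (flex' F).
have last x : star_edge rho x x -> l' x 0 (rshift d 0) = - dotv (p x) (mu x).
  move=> xx; have := flexs x x xx; rewrite hatdot /mu xx; lra.
have pin : pinned_flex rho F0 p mu.
  split=> [x /orP[xF0|/negPf nx]|x y xy].
  - rewrite /mu; case: ifP => // _; apply/rowP => j.
    by rewrite [LHS]mxE /l' -(hA x xF0) subrr !mxE.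
  - by rewrite /mu nx.
  have [xx yy] := star x y xy; have := flexs x y xy; rewrite !hatdot !last //.
  have e v : star_edge rho v v -> \row_j l' v 0 (lshift 1 j) = mu v by rewrite /mu => ->.
  rewrite !e // !dotvBr ![dotv (mu x - _) _]dotvC !dotvBr.
  lra.
have mu0 := pinned_flex_transfer (fun u hu v => special_flex_zero rD rd aD F0d rF0 hu v) pin.
have l'0 x : star_edge rho x x -> l' x = 0.
  move=> xx; apply/rowP => j; rewrite [RHS]mxE -(splitK j).
  case: (split j) => k; rewrite /unsplit.
    by have /rowP/(_ k) := mu0 x; rewrite /mu xx !mxE.
  by rewrite (ord1 k) (last x xx) mu0 dotv0r oppr0.
have lA c : c \notin G -> c |: G \in D -> l c = hat (p c) *m A.
  move=> cG cD; apply/eqP; rewrite -subr_eq0; apply/eqP/l'0.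
  apply/existsP; exists (c |: G); rewrite cD cardsU1 cG Gd add1n prednK // eqxx setU11.
  by rewrite !andbT /=; apply: subset_trans rG (subsetUr _ _).
by rewrite lA // lA // (dotv_skew (hat (p a)) (hat (p b)) sk) addNr.
Qed.

End GenericEmbedding.

(** * Simplicial polytopes *)

Lemma surface_edge_opposite (V : finType) (Sf : {set {set V}}) :
  (forall t, t \in Sf -> #|t| = 3%N) ->
  (forall e : {set V}, #|e| = 2%N -> #|[set t in Sf | e \subset t]%SET| \in [:: 0; 2]%N) ->
  forall x y a, [set x; y; a]%SET \in Sf ->
  exists b, [/\ b != a, [set x; y; b]%SET \in Sf &
    forall c, [set x; y; c]%SET \in Sf -> c = a \/ c = b].
Proof.
move=> Sf3 edge x y a aS.
have notin c : [set x; y; c]%SET \in Sf -> x != y /\ c \notin [set x; y]%SET.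
  move=> /Sf3; rewrite setUC cardsU1 cards2.
  by case: (x != y); case: (c \in _).
have [xy axy] := notin a aS.
have e2 : #|[set x; y]%SET| = 2%N by rewrite cards2 xy.
pose ta := [set x; y; a]%SET.
have taS : ta \in [set t in Sf | [set x; y]%SET \subset t]%SET.
  by rewrite inE aS subsetUl.
have := edge _ e2; rewrite !inE => /orP[/eqP/cards0_eq h|/eqP h2].
  by move: taS; rewrite h inE.
have /cards1P[t' et'] : #|[set t in Sf | [set x; y]%SET \subset t]%SET :\ ta| == 1%N.
  by move: h2; rewrite (cardsD1 ta) taS add1n => -[->].
have : t' \in [set t in Sf | [set x; y]%SET \subset t]%SET :\ ta by rewrite et' inE.
rewrite in_setD1 inE => /and3P[t'ta t'S et].
have [b tb] : exists b, t' = [set x; y; b]%SET.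
  have /cards1P[b eb] : #|t' :\: [set x; y]%SET| == 1%N.
    by rewrite cardsD (setIidPr et) e2 (Sf3 _ t'S).
  exists b; apply/setP => v; have /setP/(_ v) := eb; rewrite in_setD in_set1 => ebv.
  rewrite [in RHS]in_setU in_set1 -ebv.
  by have := subsetP et v; case: (v \in [set x; y]%SET) => //= ->.
rewrite tb in t'S t'ta et'; exists b; split=> //.
  by apply: contra t'ta => /eqP->.
move=> c cS; have [_ cxy] := notin c cS.
have : [set x; y; c]%SET \in [set t in Sf | [set x; y]%SET \subset t]%SET.
  by rewrite inE cS subsetUl.
have inv z : [set x; y; c]%SET = [set x; y; z]%SET -> c = z.
  move=> /setP/(_ c); rewrite [in LHS]in_setU set11 orbT in_setU (negPf cxy) inE.
  by move=> /esym/eqP.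
rewrite -(setD1K taS) et' !inE => /orP[]/eqP/inv; auto.
Qed.

(** * Faces described by supporting functionals *)

Section Functionals.
Variables (R : realFieldType) (n m : nat) (P : 'I_n -> 'rV[R]_m).
Implicit Types (S F G : {set 'I_n}) (e f : 'rV[R]_m).

Lemma rows_of_annih S e : (rows_of P S *m e^T == 0) = [forall v in S, dotv (P v) e == 0].
Proof.
have ev i : (rows_of P S *m e^T) i 0 = dotv (P (enum_val i)) e.
  by rewrite dotvE mxE; apply: eq_bigr => j _; rewrite !mxE.
apply/eqP/forall_inP => [h v vS|h].
  by rewrite -(enum_rankK_in vS vS) -ev h mxE.
by apply/matrixP => i j; rewrite (ord1 j) ev mxE; apply/eqP/h/enum_valP.
Qed.

Definition annih S := kermx (rows_of P S)^T.

Lemma annihP S e : (e <= annih S)%MS = [forall v in S, dotv (P v) e == 0].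
Proof.
rewrite -rows_of_annih; apply/sub_kermxP/eqP => [h|h].
  by apply: trmx_inj; rewrite trmx_mul trmxK h trmx0.
by apply: trmx_inj; rewrite trmx_mul trmxK h trmx0.
Qed.

Lemma annih_rank S : lin_indep P S -> \rank (annih S) = (m - #|S|)%N.
Proof. by move=> /rows_of_free; rewrite mxrank_ker mxrank_tr /row_free => /eqP->. Qed.

Lemma lin_indep_card S : lin_indep P S -> (#|S| <= m)%N.
Proof. by move=> /rows_of_free; rewrite /row_free => /eqP <-; apply: rank_leq_col. Qed.

Lemma interpolate S (c : 'I_n -> R) : lin_indep P S ->
  exists e, forall v, v \in S -> dotv (P v) e = c v.
Proof.
move=> /rows_of_free/row_freeP[B PB].
exists (B *m \col_i c (enum_val i))^T => v vS.
have ev i (w : 'cV[R]_m) : (rows_of P S *m w) i 0 = dotv (P (enum_val i)) w^T.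
  by rewrite dotvE mxE; apply: eq_bigr => j _; rewrite !mxE.
have := ev (enum_rank_in vS v) (B *m \col_i c (enum_val i)).
by rewrite enum_rankK_in // => <-; rewrite mulmxA PB mul1mx mxE enum_rankK_in.
Qed.

Lemma annih_line S e f : lin_indep P S -> #|S|.+1 = m -> e != 0 ->
  (forall v, v \in S -> dotv (P v) e = 0) -> (forall v, v \in S -> dotv (P v) f = 0) ->
  exists c, f = c *: e.
Proof.
move=> ind Sm e0 he hf.
have eA : (e <= annih S)%MS by rewrite annihP; apply/forall_inP => v /he ->.
have fA : (f <= annih S)%MS by rewrite annihP; apply/forall_inP => v /hf ->.
have m1 : (m - #|S|)%N = 1%N by rewrite -Sm subSnn.
have : (annih S <= e)%MS.
  have [_ <-] := mxrank_leqif_sup eA.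
  by rewrite annih_rank // m1 rank_rV e0.
by move/(submx_trans fA)/sub_rVP.
Qed.

Lemma annih_transverse S e : lin_indep P S -> (#|S|.+1 < m)%N ->
  exists2 f, (forall v, v \in S -> dotv (P v) f = 0) & (forall c, f != c *: e).
Proof.
move=> ind Sm.
have : ~~ (annih S <= e)%MS.
  apply: contraL Sm => /mxrankS; rewrite annih_rank // rank_rV -leqNgt => h.
  by move: h; case: (e != 0); clear; lia.
move=> /row_subPn[i hi]; exists (row i (annih S)).
  have : (row i (annih S) <= annih S)%MS by apply: row_sub.
  by rewrite annihP => /forall_inP h v /h/eqP.
by move=> c; apply: contra hi => /eqP->; apply: scalemx_sub.
Qed.

Lemma annih_plane S e f g : lin_indep P S -> #|S|.+2 = m -> e != 0 ->
  (forall c, f != c *: e) -> (forall v, v \in S -> dotv (P v) e = 0) ->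
  (forall v, v \in S -> dotv (P v) f = 0) -> (forall v, v \in S -> dotv (P v) g = 0) ->
  exists a b, g = a *: e + b *: f.
Proof.
move=> ind Sm e0 fe he hf hg.
have eA : (e <= annih S)%MS by rewrite annihP; apply/forall_inP => v /he ->.
have fA : (f <= annih S)%MS by rewrite annihP; apply/forall_inP => v /hf ->.
have gA : (g <= annih S)%MS by rewrite annihP; apply/forall_inP => v /hg ->.
have efA : (e + f <= annih S)%MS by rewrite addsmx_sub eA.
have : (annih S <= e + f)%MS.
  have [_ <-] := mxrank_leqif_sup efA; rewrite eqn_leq (mxrankS efA) /=.
  have m2 : (m - #|S|)%N = 2%N by rewrite -Sm; clear; lia.
  rewrite annih_rank // m2.
  have : (\rank e < \rank (e + f))%N.
    rewrite ltn_neqAle mxrankS ?addsmxSl // andbT.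
    have [_ ->] := mxrank_leqif_sup (addsmxSl e f).
    rewrite addsmx_sub submx_refl /=; apply/negP => /sub_rVP[c ec].
    by have := fe c; rewrite ec eqxx.
  by rewrite rank_rV e0.
move/(submx_trans gA)/sub_addsmxP => [[u1 u2] /= ->].
exists (u1 0 0), (u2 0 0); congr (_ + _).
  by rewrite [u1]mx11_scalar mul_scalar_mx mxE eqxx mulr1n.
by rewrite [u2]mx11_scalar mul_scalar_mx mxE eqxx mulr1n.
Qed.

Lemma rows_of_comb S (y : 'rV[R]_m) : (y <= rows_of P S)%MS ->
  exists c : 'I_n -> R, y = \sum_(v in S) c v *: P v.
Proof.
move=> /submxP[t ->].
exists (fun v => if insub (index v (enum S)) is Some i then t 0 i else 0).
rewrite mulmx_sum_row [RHS]big_enum_val /=; apply: eq_bigr => j _; rewrite rowK.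
rewrite (_ : index _ _ = j) ?valK //.
by rewrite /enum_val index_uniq ?enum_uniq // -cardE.
Qed.

End Functionals.

Section PolytopeBoundary.
Variables (R : realFieldType) (n d m : nat) (D : {set {set 'I_n}}).
Variable P : 'I_n -> 'rV[R]_m.
Implicit Types (S F G : {set 'I_n}) (e f : 'rV[R]_m).
Hypothesis d4 : (4 <= d)%N.
Hypothesis md : m = d.+1.
Hypothesis spanP : spanning P.
(** Supporting hyperplanes in homogenized form: [e != 0] excludes the whole polytope as a face,
    while a positive constant functional yields the empty face. *)
Definition supports e S :=
  [/\ e != 0, (forall v, 0 <= dotv (P v) e) & forall v, (v \in S) = (dotv (P v) e == 0)].
Hypothesis faceP : forall S, S \in D <-> exists e, supports e S.
Hypothesis indP : forall S, S \in D -> lin_indep P S.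
Hypothesis vertexP : forall v, [set v]%SET \in D.
Hypothesis emptyP : finset.set0 \in D.

Lemma supports_pos e S v : supports e S -> v \notin S -> 0 < dotv (P v) e.
Proof. by case=> _ h1 h2 vS; rewrite lt_neqAle h1 andbT eq_sym -h2. Qed.

Lemma supports_zero e S v : supports e S -> v \in S -> dotv (P v) e = 0.
Proof. by case=> _ _ h2; rewrite h2 => /eqP. Qed.

Lemma face_of_functional e : e != 0 -> (forall v, 0 <= dotv (P v) e) ->
  [set v | dotv (P v) e == 0]%SET \in D.
Proof. by move=> e0 he; apply/faceP; exists e; split=> // v; rewrite inE. Qed.

Lemma polytope_down S S' : S \in D -> S' \subset S -> S' \in D.
Proof.
move=> SD S'S; have [->//|neS] := eqVneq S' S.
have [x xS xS'] : exists2 x, x \in S & x \notin S'.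
  by apply/subsetPn; apply: contra neS => SS; rewrite eqEsubset S'S.
have /faceP[e se] := SD.
have [f hf] := interpolate (fun v => (v \notin S')%:R) (indP SD).
(* [f] is 0 on [S'] and 1 on the rest of [S]; [N] is so large that [N *: e] outweighs [f] outside
   [S], with the summand 1 for strict positivity. *)
pose N := \sum_(v | v \notin S) (`|dotv (P v) f| + 1) / dotv (P v) e.
have pos v : v \notin S -> 0 < dotv (P v) (N *: e + f).
  move=> vS; have e0 := supports_pos se vS.
  have hN : (`|dotv (P v) f| + 1) / dotv (P v) e <= N.
    rewrite /N (bigD1 v) //= lerDl sumr_ge0 // => w /andP[wS _].
    by rewrite divr_ge0 ?addr_ge0 // ltW // (supports_pos se).
  have : `|dotv (P v) f| + 1 <= N * dotv (P v) e by rewrite -ler_pdivrMr.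
  rewrite dotvDr dotvZr; have := ler_norm (- dotv (P v) f); rewrite normrN; lra.
have onS v : v \in S -> dotv (P v) (N *: e + f) = (v \notin S')%:R.
  by move=> vS; rewrite dotvDr dotvZr (supports_zero se vS) mulr0 add0r hf.
apply/faceP; exists (N *: e + f); split.
- apply: contraTneq isT => h; have := onS x xS; rewrite h dotv0r xS' => /eqP.
  by rewrite eq_sym oner_eq0.
- move=> v; have [vS|vS] := boolP (v \in S); first by rewrite onS // ler0n.
  exact: ltW (pos v vS).
- move=> v; have [vS|vS] := boolP (v \in S).
    by rewrite onS //; case: (v \in S'); rewrite ?eqxx ?oner_eq0.
  rewrite (gt_eqF (pos v vS)); apply/negbTE; apply: contra vS.
  exact: (subsetP S'S).
Qed.

Lemma polytope_card_le S : S \in D -> (#|S| <= d)%N.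
Proof.
move=> SD; have := lin_indep_card (indP SD); rewrite md leq_eqVlt => /orP[/eqP h|//].
have /faceP[e se] := SD; case: (se) => e0 _ _.
have : (e <= annih P S)%MS.
  by rewrite annihP; apply/forall_inP => v vS; rewrite (supports_zero se vS).
have := annih_rank (indP SD); rewrite h -md subnn => /eqP; rewrite mxrank_eq0 => /eqP->.
by rewrite submx0 (negPf e0).
Qed.

(* Rotate a supporting functional about [S] until it meets another vertex. *)
Lemma polytope_enlarge S : S \in D -> (#|S| < d)%N ->
  exists S', [/\ S' \in D, S \subset S' & (#|S| < #|S'|)%N].
Proof.
move=> SD Sd; have /faceP[e se] := SD.
have [|f0 hf0 fe0] := annih_transverse e (indP SD); first by rewrite md ltnS.
have [f [hf fe [w0 hw0]]] : exists f, [/\ forall v, v \in S -> dotv (P v) f = 0,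
    forall c, f != c *: e & exists v, dotv (P v) f < 0].
  have [/existsP[v hv]|/existsPn hv] := boolP [exists v, dotv (P v) f0 < 0].
    by exists f0; split=> //; exists v.
  have [/existsP[v hv']|/existsPn hv'] := boolP [exists v, 0 < dotv (P v) f0].
    exists (- f0); split.
    - by move=> w wS; rewrite dotvNr hf0 ?oppr0.
    - by move=> c; apply: contra (fe0 (- c)) => /eqP h; rewrite scaleNr -h opprK.
    - by exists v; rewrite dotvNr oppr_lt0.
  have /eqP : f0 = 0.
    apply: spanP => v; apply/eqP; rewrite eq_le leNgt hv' /=.
    by rewrite leNgt hv.
  by rewrite -(scale0r e) (negPf (fe0 0)).
pose t v := dotv (P v) e / - dotv (P v) f.
case: (Order.TotalTheory.arg_minP (P := fun v => dotv (P v) f < 0) t hw0) => v hv vmin.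
have nS w : dotv (P w) f < 0 -> w \notin S by move=> h; apply: contraTN h => /hf ->; rewrite ltxx.
have tv : 0 < t v by rewrite divr_gt0 ?oppr_gt0 // (supports_pos se) // nS.
pose g := e + t v *: f.
have gE w : dotv (P w) g = dotv (P w) e + t v * dotv (P w) f by rewrite dotvDr dotvZr.
have g0 : g != 0.
  apply: contra (fe (- (t v)^-1)) => /eqP h.
  have -> : f = (t v)^-1 *: (g - e) by rewrite /g addrAC subrr add0r scalerA mulVf ?scale1r // gt_eqF.
  by rewrite h sub0r scalerN scaleNr.
have gpos w : 0 <= dotv (P w) g.
  rewrite gE; case: (se) => _ epos _; have := epos w => ew.
  have [fw|fw] := ltP (dotv (P w) f) 0; last by rewrite addr_ge0 // mulr_ge0 // ltW.
  have := vmin w fw; rewrite {2}/t ler_pdivlMr ?oppr_gt0 //; lra.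
exists [set w | dotv (P w) g == 0]%SET; split; first exact: face_of_functional.
  by apply/subsetP => w wS; rewrite inE gE (supports_zero se wS) hf // mulr0 addr0.
apply: proper_card; apply/properP; split.
  by apply/subsetP => w wS; rewrite inE gE (supports_zero se wS) hf // mulr0 addr0.
exists v; last exact: nS.
rewrite inE gE /t; apply/eqP; field; by rewrite lt_eqF.
Qed.

Lemma polytope_pure S : S \in D -> exists F, [/\ F \in D, S \subset F & #|F| = d].
Proof.
move=> SD; have [k] := ubnP (d - #|S|); elim: k S SD => // k IH S SD hk.
have := polytope_card_le SD; rewrite leq_eqVlt => /orP[/eqP Sd|Sd]; first by exists S.
have [S' [S'D SS' lt]] := polytope_enlarge SD Sd.
have [|F [FD S'F Fd]] := IH S' S'D; first by move: hk lt Sd; clear; lia.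
by exists F; split=> //; apply: subset_trans S'F.
Qed.

(** The functionals vanishing on [G] form a plane spanned by [e] and [f]. One that supports a facet
    at [G] vanishes where the ratio [r] of [f] to [e] is extremal, so the two facets come from the
    minimum and the maximum of [r]; [polytope_card_le] makes each extremal vertex unique. *)
Lemma polytope_ridge G : G \in D -> #|G| = d.-1 ->
  exists a b, [/\ a != b, a \notin G /\ b \notin G, a |: G \in D, b |: G \in D
    & forall c, c \notin G -> c |: G \in D -> c = a \/ c = b].
Proof.
move=> GD Gd; have /faceP[e se] := GD; have [e0 epos _] := se.
have G2 : #|G|.+2 = m by rewrite md Gd; move: d4; clear; lia.
have [|f hf fe] := annih_transverse e (indP GD); first by rewrite -G2.
have he v : v \in G -> dotv (P v) e = 0 by apply: supports_zero.
have [w0 w0G] : exists w, w \notin G.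
  apply/existsP; apply: contraNT e0 => /existsPn h; apply/eqP/spanP => v.
  by apply: he; have := h v; rewrite negbK.
pose r v := dotv (P v) f / dotv (P v) e.
case: (Order.TotalTheory.arg_minP (P := fun v => v \notin G) r w0G) => a aG amin.
case: (Order.TotalTheory.arg_maxP (P := fun v => v \notin G) r w0G) => b bG bmax.
have {}bmax v : v \notin G -> r v <= r b := bmax v.
have rE v : v \notin G -> dotv (P v) f = r v * dotv (P v) e.
  by move=> vG; rewrite /r divfK // gt_eqF // (supports_pos se).
have ab_lt : r a < r b.
  rewrite ltNge; apply/negP => h.
  have /eqP : f - r a *: e = 0.
    apply: spanP => v; rewrite dotvBr dotvZr.
    have [vG|vG] := boolP (v \in G); first by rewrite hf // he // mulr0 subrr.
    have -> : r a = r v by apply/eqP; rewrite eq_le amin // (le_trans (bmax v vG)).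
    by rewrite rE // subrr.
  by rewrite subr_eq0 (negPf (fe _)).
have ab : a != b by apply: contraTneq ab_lt => ->; rewrite ltxx.
have facet s x (g := s *: f - (s * r x) *: e) : s != 0 -> x \notin G ->
    (forall v, v \notin G -> 0 <= s * (r v - r x)) ->
    x |: G \in D /\ (forall c, c \notin G -> dotv (P c) g = 0 -> c = x).
  move=> s0 xG hs.
  have gE v : v \notin G -> dotv (P v) g = s * (r v - r x) * dotv (P v) e.
    by move=> vG; rewrite dotvBr !dotvZr rE //; ring.
  have gG v : v \in G -> dotv (P v) g = 0.
    by move=> vG; rewrite dotvBr !dotvZr hf // he // !mulr0 subr0.
  have g0 : g != 0.
    rewrite subr_eq0; apply: contra (fe (r x)) => /eqP h; apply/eqP.
    by rewrite -[LHS](scalerK s0) h scalerA mulrA mulVf // mul1r.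
  have gpos v : 0 <= dotv (P v) g.
    have [vG|vG] := boolP (v \in G); first by rewrite gG.
    by rewrite gE // mulr_ge0 ?hs.
  have SD := face_of_functional g0 gpos; set S := finset _ in SD.
  have GS : G \subset S by apply/subsetP => v vG; rewrite inE gG.
  have xS : x \in S by rewrite inE gE // subrr mulr0 mul0r.
  have eS : x |: G = S.
    apply/eqP; rewrite eqEcard finset.subUset finset.sub1set xS GS /=.
    rewrite cardsU1 xG Gd add1n prednK; first exact: polytope_card_le.
    by apply: leq_trans d4.
  rewrite eS; split=> // c cG hc; have : c \in S by rewrite inE hc.
  by rewrite -eS !inE (negPf cG) orbF => /eqP.
have [aD auniq] : a |: G \in D /\ (forall c, c \notin G ->
    dotv (P c) (1 *: f - (1 * r a) *: e) = 0 -> c = a).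
  apply: facet => //; first exact: oner_neq0.
  by move=> v vG; rewrite mul1r subr_ge0 amin.
have [bD buniq] : b |: G \in D /\ (forall c, c \notin G ->
    dotv (P c) ((-1) *: f - ((-1) * r b) *: e) = 0 -> c = b).
  apply: facet => //; first by rewrite oppr_eq0 oner_neq0.
  by move=> v vG; rewrite mulN1r opprB subr_ge0 bmax.
exists a, b; split=> // c cG cD; have /faceP[g sg] := cD.
have hg v : v \in G -> dotv (P v) g = 0.
  by move=> vG; apply: (supports_zero sg); rewrite !inE vG orbT.
have [al [be eg]] := annih_plane (indP GD) G2 e0 fe he hf hg.
have [g0 gpos _] := sg.
have gE v : v \notin G -> dotv (P v) g = (al + be * r v) * dotv (P v) e.
  by move=> vG; rewrite eg dotvDr !dotvZr rE //; ring.
have cc : al + be * r c = 0.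
  have : dotv (P c) g = 0 by apply: (supports_zero sg); rewrite setU11.
  rewrite gE // => /eqP; rewrite mulf_eq0 (gt_eqF (supports_pos se cG)) orbF.
  by move/eqP.
have mono v : v \notin G -> 0 <= be * (r v - r c).
  move=> vG; have := gpos v; rewrite gE // pmulr_lge0 ?(supports_pos se) //; lra.
have be0 : be != 0.
  apply: contra g0 => /eqP b0; move: cc; rewrite b0 mul0r addr0 => a0.
  by rewrite eg a0 b0 !scale0r addr0.
have rc v : dotv (P c) f = r c * dotv (P c) e by rewrite rE.
have [bpos|bneg|b00] := ltgtP 0 be; last by rewrite -b00 eqxx in be0.
  left; apply: auniq => //; rewrite dotvBr !dotvZr !mul1r rE //.
  have := mono a aG; rewrite pmulr_rge0 // subr_ge0 => h.
  have -> : r a = r c by apply/eqP; rewrite eq_le amin.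
  by rewrite subrr.
right; apply: buniq => //; rewrite dotvBr !dotvZr !mulN1r rE //.
have := mono b bG; rewrite nmulr_rge0 // subr_le0 => h.
have -> : r b = r c by apply/eqP; rewrite eq_le bmax // h.
by rewrite mulNr subrr.
Qed.

Lemma polytope_closed_pseudomanifold : closed_pseudomanifold d D.
Proof.
split; [split=> //; exact: polytope_down|exact: polytope_card_le|
  exact: polytope_pure|exact: polytope_ridge].
Qed.

Lemma polytope_adjacent_facets_span : adjacent_facets_span d D P.
Proof.
move=> a b G ab aG bG aD bD Gd f hf.
have Fd : #|a |: G|.+1 = m.
  by rewrite md cardsU1 aG Gd add1n prednK //; apply: leq_trans d4.
have /faceP[e se] := aD; have [e0 _ _] := se.
have [||c ef] := annih_line (indP aD) Fd e0 (f := f).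
- by move=> v; apply: supports_zero.
- move=> v vF; apply: hf; move: vF; rewrite !inE => /orP[]->; by rewrite ?orbT.
have bF : b \notin a |: G by rewrite !inE negb_or eq_sym ab.
have := hf b; rewrite !inE eqxx orbT => /(_ isT) /eqP.
rewrite ef dotvZr mulf_eq0 (gt_eqF (supports_pos se bF)) orbF => /eqP->.
by rewrite scale0r.
Qed.

(* Adjacency steps decrease the value at the barycentre of [F'] of the facet
   functional normalized at an interior point, as in the simplex method. *)
Lemma polytope_connected : star_connected d D finset.set0.
Proof.
pose o := \sum_v P v.
have /fin_all_exists[phi hphi] : forall F, exists e, F \in D ->
    supports e F /\ dotv o e = 1.
  move=> F; have [FD|FD] := boolP (F \in D); last by exists 0.
  have /faceP[e se] := FD; have [e0 epos ez] := se.
  have oe : 0 < dotv o e.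
    rewrite dotvC dotv_sumr lt_neqAle sumr_ge0 ?andbT => [|v _]; last by rewrite dotvC.
    apply: contra e0; rewrite eq_sym psumr_eq0 => [/allP h|v _]; last by rewrite dotvC.
    apply/eqP/spanP => v; apply/eqP; rewrite dotvC; exact: (h v (mem_index_enum v)).
  exists ((dotv o e)^-1 *: e) => _; split; last by rewrite dotvZr mulVf // gt_eqF.
  have oi : 0 < (dotv o e)^-1 by rewrite invr_gt0.
  split; first by rewrite scaler_eq0 (gt_eqF oi).
    by move=> v; rewrite dotvZr mulr_ge0 // ltW.
  by move=> v; rewrite ez dotvZr mulf_eq0 (gt_eqF oi).
move=> Q step F F0 FD Fd _ F0D F0d _.
pose x := \sum_(v in F0) P v.
pose mu F := dotv x (phi F).
have d0 : (0 < d)%N by apply: leq_trans d4.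
have muE H : mu H = \sum_(v in F0) dotv (P v) (phi H).
  by rewrite /mu dotvC dotv_sumr; apply: eq_bigr => v _; rewrite dotvC.
have improve H : H \in D -> #|H| = d -> H != F0 ->
    exists i b, [/\ i \in H, b \notin H, b |: (H :\ i) \in D & mu (b |: (H :\ i)) < mu H].
  move=> HD Hd HF0; apply: contrapT => none.
  have stuck i b : i \in H -> b \notin H -> b |: (H :\ i) \in D ->
      mu H <= mu (b |: (H :\ i)).
    by move=> iH bH bD; rewrite leNgt; apply/negP => lt; apply: none; exists i, b.
  have [sH oH] := hphi H HD; have [s0 o0] := hphi F0 F0D.
  (* [phi H] vanishes at [y], so [y] is a combination of the points of [H] with coefficients [tau].
     If no pivot improves, all [tau i] are nonnegative; then so is [phi F0] at [y], where its value
     is [- mu H], although [mu H] is positive. *)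
  pose y := x - mu H *: o.
  have yE e : dotv y e = dotv x e - mu H * dotv o e.
    by rewrite dotvC dotvBr dotvZr dotvC (dotvC e).
  have [tau ey] : exists tau : 'I_n -> R, y = \sum_(v in H) tau v *: P v.
    apply: rows_of_comb; apply: annihilator_submx => u /eqP hu.
    rewrite -[u]trmxK rows_of_annih in hu; move/forall_inP: hu => hu.
    have Hm : #|H|.+1 = m by rewrite md Hd.
    have [H0 _ _] := sH.
    have [||c ec] := annih_line (indP HD) Hm H0 (f := u^T).
    - by move=> v; apply: supports_zero.
    - by move=> v vH; apply/eqP/hu.
    have : dotv y u^T = 0 by rewrite ec dotvZr yE oH mulr1 subrr mulr0.
    rewrite /dotv trmxK => h; apply/matrixP => i j.
    by rewrite !ord1 h mxE.
  have yt e : dotv y e = \sum_(v in H) tau v * dotv (P v) e.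
    rewrite ey dotvC dotv_sumr; apply: eq_bigr => v _.
    by rewrite dotvZr dotvC.
  have tau0 i : i \in H -> 0 <= tau i.
    move=> iH; have [b bH bD] := opposite_ex polytope_down polytope_ridge HD Hd iH.
    have [sF' oF'] := hphi _ bD; have := stuck i b iH bH bD.
    set F' := b |: (H :\ i) in sF' oF' *.
    have iF' : i \notin F' by rewrite !inE eqxx orbF; apply: contraNneq bH => <-.
    have := yt (phi F' - phi H); rewrite (bigD1 i) //= big1 => [|v /andP[vH vi]].
      rewrite addr0 !dotvBr (supports_zero sH iH) subr0 !yE oF' oH => h1 h2.
      have : 0 <= tau i * dotv (P i) (phi F') by rewrite -h1 -/(mu F') -/(mu H); lra.
      by rewrite pmulr_lge0 // (supports_pos sF').
    rewrite dotvBr (supports_zero sH vH) (supports_zero sF') ?subrr ?mulr0 //.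
    by rewrite !inE vi vH orbT.
  have : 0 <= dotv y (phi F0).
    rewrite yt sumr_ge0 // => v vH; rewrite mulr_ge0 ?tau0 //.
    by case: s0.
  have mu00 : mu F0 = 0 by rewrite muE big1 // => v; apply: supports_zero.
  rewrite yE o0 mulr1 -/(mu F0) mu00 sub0r oppr_ge0 leNgt => /negP; apply.
  have /subsetPn[w wF0 wH] : ~~ (F0 \subset H).
    apply: contra HF0 => F0H; rewrite eq_sym eqEcard F0H Hd F0d leqnn //.
  rewrite muE (bigD1 w) //= ltr_pwDl ?(supports_pos sH) // sumr_ge0 // => v _.
  by case: sH.
have [k] := ubnP #|[set H | mu H < mu F]%SET|.
elim: k F FD Fd => // k IH F FD Fd hk QF.
have [<-//|neF] := eqVneq F F0.
have [i [b [iF bF bD lt]]] := improve F FD Fd neF.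
have Gd : #|F :\ i| = d.-1 by rewrite -Fd (cardsD1 i F) iF.
have bG : b \notin F :\ i by rewrite !inE (negPf bF) andbF.
apply: (IH (b |: (F :\ i))) => //.
- by rewrite cardsU1 bG Gd add1n prednK.
- rewrite -ltnS; apply: leq_trans hk; rewrite ltnS; apply: proper_card.
  apply/properP; split.
    by apply/subsetP => H; rewrite !inE => h; apply: lt_trans lt.
  by exists (b |: (F :\ i)); rewrite !inE ?lt ?ltxx.
apply: (step (F :\ i) i b) => //.
- exact: finset.sub0set.
- by rewrite !inE eqxx.
- by apply: contraNneq bF => <-.
- by rewrite setD1K.
- by rewrite setD1K.
Qed.

End PolytopeBoundary.

(** * Links in the boundary of a polytope as convex surfaces *)

Lemma det3_eq0 (K : fieldType) (a b c : 'rV[K]_3) : det3 a b c = 0 ->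
  exists g, [/\ g != 0, dot3 a g = 0, dot3 b g = 0 & dot3 c g = 0].
Proof.
move=> abc; pose F (x : 'rV[K]_3) (k : nat) : K := x 0 (inord k).
have FE x (i : 'I_3) : F x i = x 0 i by rewrite /F inord_val.
pose M : 'M[K]_3 := \matrix_(i, j) nth (fun=> 0) [:: F a; F b; F c] i j.
have detM : \det M^T = 0.
  rewrite det_tr -[RHS]abc /M (expand_det_row _ ord0) !big_ord_recl big_ord0.
  rewrite /cofactor !(expand_det_row _ ord0) !big_ord_recl !big_ord0.
  rewrite /cofactor !det_mx11 !mxE /= /det3 /dot3 /cross !vec3E -!FE.
  by rewrite /bump /=; ring.
have [g g0 gM] := det0P (introT eqP detM).
exists g; have h (i : 'I_3) : \sum_(j < 3) nth (fun=> 0) [:: F a; F b; F c] i j * g 0 j = 0.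
  have /rowP/(_ i) := gM; rewrite !mxE => h; rewrite -[RHS]h.
  by apply: eq_bigr => j _; rewrite !mxE mulrC.
have := (h i0, h i1, h i2); rewrite !sum3E -!FE /= => -[[h0 h1] h2].
by split=> //; rewrite /dot3 -!FE /=.
Qed.

(** The functionals vanishing on [S] form a space of dimension four. The rows of [Pi] span a
    complement of [c] in it; divided by [c], they are three affine coordinates on the quotient by
    the span of [S]. *)
Lemma annih_basis (R : realFieldType) n m (P : 'I_n -> 'rV[R]_m) (S : {set 'I_n}) c :
  lin_indep P S -> (#|S| + 4)%N = m -> c != 0 -> (forall v, v \in S -> dotv (P v) c = 0) ->
  exists Pi : 'M[R]_(3, m),
  [/\ forall v j, v \in S -> dotv (P v) (row j Pi) = 0,
      forall e, (forall v, v \in S -> dotv (P v) e = 0) ->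
        exists (f : 'rV[R]_3) f0, e = f *m Pi + f0 *: c
    & forall (f : 'rV[R]_3) f0, f *m Pi + f0 *: c = 0 -> f = 0].
Proof.
move=> ind Sm c0 hc.
have cA : (c <= annih P S)%MS by rewrite annihP; apply/forall_inP => v /hc ->.
pose X := (annih P S :\: c)%MS.
have capc : (annih P S :&: c :=: c)%MS by apply/capmx_idPr.
have X3 : \rank X = 3%N.
  have := mxrank_cap_compl (annih P S) c; rewrite capc rank_rV c0 annih_rank //.
  by rewrite -/X; move: Sm; clear; lia.
have [Pi eqPi] : exists Pi : 'M[R]_(3, m), (Pi :=: X)%MS.
  by rewrite -X3; exists (row_base X); apply: eq_row_base.
have Pifree : row_free Pi by rewrite /row_free eqPi X3.
have XA : (X <= annih P S)%MS by apply: diffmxSl.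
exists Pi; split.
- move=> v j vS; have : (row j Pi <= annih P S)%MS.
    by apply: submx_trans XA; rewrite -eqPi row_sub.
  by rewrite annihP => /forall_inP/(_ v vS)/eqP.
- move=> e he; have : (e <= annih P S)%MS by rewrite annihP; apply/forall_inP => v /he ->.
  rewrite -(addsmx_diff_cap_eq (annih P S) c) -/X => h.
  have : (e <= Pi + c)%MS.
    by apply: submx_trans h _; rewrite addsmxS ?eqPi ?capc.
  move/sub_addsmxP => [[f f0] /= ->]; exists f, (f0 0 0).
  by rewrite [f0]mx11_scalar mul_scalar_mx mxE eqxx mulr1n.
- move=> f f0 h; have : (f *m Pi <= X :&: c)%MS.
    rewrite sub_capmx -eqPi submxMl /= (_ : f *m Pi = (- f0) *: c) ?scalemx_sub //.
    by apply/eqP; rewrite scaleNr -addr_eq0 h.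
  rewrite /X capmx_diff submx0 => /eqP fPi.
  by apply: (row_free_inj Pifree); rewrite fPi mul0mx.
Qed.

Section PolytopeStars.
Variables (R : realFieldType) (n d m : nat) (D : {set {set 'I_n}}).
Variable P : 'I_n -> 'rV[R]_m.
Hypothesis d4 : (4 <= d)%N.
Hypothesis md : m = d.+1.
Hypothesis spanP : spanning P.
Hypothesis faceP : forall S, S \in D <-> exists e, supports P e S.
Hypothesis indP : forall S, S \in D -> lin_indep P S.
Hypothesis vertexP : forall v, [set v]%SET \in D.
Hypothesis emptyP : finset.set0 \in D.

Let psD : closed_pseudomanifold d D.
Proof. exact: (polytope_closed_pseudomanifold d4 md spanP faceP indP vertexP emptyP). Qed.

Let span_adj : adjacent_facets_span d D P.
Proof. exact: (polytope_adjacent_facets_span d4 md faceP indP). Qed.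

Section OneStar.
Variables (rho : {set 'I_n}) (l : 'I_n -> 'rV[R]_m).
Hypothesis rD : rho \in D.
Hypothesis rd : #|rho| = (d - 3)%N.
Hypothesis flex : forall F : {set 'I_n}, F \in D -> #|F| = d -> rho \subset F ->
  forall x y, x \in F -> y \in F -> dotv (P x) (l y) + dotv (P y) (l x) = 0.
Hypothesis l_rho : forall v, v \in rho -> l v = 0.

Let Sf := link_facets d D rho.

(* The quotient by the span of [rho], normalized by a functional [c] supporting
   [rho], places the link of [rho] as a convex surface [u] in dimension three. *)
Lemma star_opposite_pinned x y a b : [set x; y; a]%SET \in Sf -> [set x; y; b]%SET \in Sf ->
  dotv (P a) (l b) + dotv (P b) (l a) = 0.
Proof.
have /faceP[c sc] := rD; have [c0 _ _] := sc.
have cpos v : v \notin rho -> 0 < dotv (P v) c by apply: supports_pos.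
have r4 : (#|rho| + 4)%N = m by rewrite rd md; move: d4; clear; lia.
have [Pi [Pi_rho Pi_gen Pi_free]] :=
  annih_basis (indP rD) r4 c0 (fun v vr => supports_zero sc vr).
have Sf3 := @card_link_facet n d D rho d4 rd.
have Sfe := surface_edge_opposite Sf3 (@link_facets_edge n d D rho d4 psD rd).
pose cc v := dotv (P v) c.
pose u v : 'rV[R]_3 := \row_j (dotv (P v) (row j Pi) / cc v).
have mulPi v (f : 'rV[R]_3) : dotv (P v) (f *m Pi) = \sum_j f 0 j * dotv (P v) (row j Pi).
  by rewrite mulmx_sum_row dotv_sumr; apply: eq_bigr => j _; rewrite dotvZr.
have uE v (f : 'rV[R]_3) f0 : v \notin rho ->
    dotv (P v) (f *m Pi + f0 *: c) = cc v * (dot3 f (u v) + f0).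
  move=> vr; have cv : cc v != 0 by rewrite gt_eqF // cpos.
  rewrite dotvDr mulPi dotvZr sum3E -/(cc v) /dot3 !mxE; field.
  exact: cv.
have Sf_face t : t \in Sf -> exists F, [/\ F \in D, #|F| = d, rho \subset F & t = F :\: rho].
  by move/link_facetsP.
have cov v : v \in cover Sf -> v \notin rho /\ exists nu, l v = nu.1 *m Pi + nu.2 *: c.
  move=> /bigcupP[t /Sf_face[F [FD Fd rF ->]] /setDP[vF vr]]; split=> //.
  have [|f [f0 e]] := Pi_gen (l v).
    move=> w wr; have := flex FD Fd rF vF (subsetP rF w wr).
    by rewrite (l_rho wr) dotv0r add0r.
  by exists (f, f0).
have /fin_all_exists[nu hnu] : forall v, exists nu : 'rV[R]_3 * R, v \in cover Sf ->
    l v = nu.1 *m Pi + nu.2 *: c.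
  move=> v; have [/cov[_ [nu e]]|h] := boolP (v \in cover Sf); first by exists nu.
  by exists (0, 0).
have notr v : v \in cover Sf -> v \notin rho by case/cov.
(* [l v] is orthogonal to the points of [rho], hence has coordinates [nu v]. Division by [cc v]
   gives the velocity [mm v] belonging to [u v], and [k v] is fixed by the equation of [v] with
   itself. *)
pose mm v : 'rV[R]_3 := (cc v)^-1 *: (nu v).1.
pose k v := (nu v).2 / cc v.
have lE v w : v \in cover Sf -> w \in cover Sf ->
    dotv (P v) (l w) = cc v * cc w * (dot3 (mm w) (u v) + k w).
  move=> vS wS; rewrite hnu // uE ?notr // -mulrA; congr (_ * _).
  have cw : cc w != 0 by rewrite gt_eqF // cpos // notr.
  by rewrite /mm /k [in RHS]dot3C dot3Zr [in RHS]dot3C; field.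
have in_cov t v : t \in Sf -> v \in t -> v \in cover Sf.
  by move=> tS vt; apply/bigcupP; exists t.
have flexE t v w : t \in Sf -> v \in t -> w \in t ->
    dot3 (mm w) (u v) + k w + (dot3 (mm v) (u w) + k v) = 0.
  move=> tS vt wt; have vS := in_cov t v tS vt; have wS := in_cov t w tS wt.
  have [F [FD Fd rF et]] := Sf_face t tS.
  move: vt wt; rewrite et => /setDP[vF _] /setDP[wF _].
  have := flex FD Fd rF vF wF; rewrite !lE // [cc w * _]mulrC -mulrDr => /eqP.
  have cv : cc v != 0 by rewrite gt_eqF // cpos // notr.
  have cw : cc w != 0 by rewrite gt_eqF // cpos // notr.
  by rewrite !mulf_eq0 (negPf cv) (negPf cw) => /eqP.
have kE t v : t \in Sf -> v \in t -> k v = - dot3 (mm v) (u v).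
  by move=> tS vt; have := flexE t v v tS vt vt; lra.
have flex3 t v w : t \in Sf -> v \in t -> w \in t ->
    dot3 (mm v - mm w) (u v - u w) = 0.
  move=> tS vt wt; have := flexE t v w tS vt wt; rewrite (kE t) // (kE t v) // => h.
  have -> : dot3 (mm v - mm w) (u v - u w) = - (dot3 (mm w) (u v) - dot3 (mm w) (u w)
    + (dot3 (mm v) (u w) - dot3 (mm v) (u v))) by vec3_ring.
  by rewrite h oppr0.
pose N := \sum_(v | v \notin rho) (1 : R).
pose o := N^-1 *: \sum_(v | v \notin rho) u v.
have mem3 (x' y' z' : 'I_n) : [/\ x' \in [set x'; y'; z']%SET, y' \in [set x'; y'; z']%SET
    & z' \in [set x'; y'; z']%SET] by rewrite !inE !eqxx ?orbT.
have support t : t \in Sf -> exists f f0, [/\ forall v, v \in t -> dot3 f (u v) + f0 = 0,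
    forall v, v \in cover Sf -> v \notin t -> 0 < dot3 f (u v) + f0
    & 0 < dot3 f o + f0].
  move=> tS; have [F [FD Fd rF et]] := Sf_face t tS.
  have /faceP[e se] := FD.
  have [|f [f0 ee]] := Pi_gen e.
    by move=> v vr; apply: (supports_zero se); apply: (subsetP rF).
  have val v : v \notin rho -> dot3 f (u v) + f0 = dotv (P v) e / cc v.
    move=> vr; have cv : cc v != 0 by rewrite gt_eqF // cpos.
    by rewrite ee uE // mulrC mulKf.
  have vpos v : v \notin rho -> v \notin F -> 0 < dot3 f (u v) + f0.
    by move=> vr vF; rewrite val // divr_gt0 ?cpos // (supports_pos se).
  exists f, f0; split.
  - move=> v; rewrite et => /setDP[vF vr].
    by rewrite val // (supports_zero se vF) mul0r.
  - move=> v /notr vr; rewrite et !inE vr /=; exact: vpos.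
  - have [w wF] : exists w, w \notin F.
      have [e0 _ _] := se; apply/existsP; apply: contraNT e0 => /existsPn h.
      apply/eqP/spanP => v; apply: (supports_zero se); have := h v; by rewrite negbK.
    have wr : w \notin rho by apply: contra wF; apply: (subsetP rF).
    have N0 : 0 < N by rewrite /N (bigD1 w) //= ltr_pwDl ?ltr01 // sumr_ge0 // => *; exact: ler01.
    have -> : dot3 f o + f0 = N^-1 * \sum_(v | v \notin rho) (dot3 f (u v) + f0).
      rewrite big_split /= mulrDr /o dot3Zr dot3_sumr; congr (_ + _).
      have -> : \sum_(v | v \notin rho) f0 = N * f0.
        by rewrite /N mulr_suml; apply: eq_bigr => v _; rewrite mul1r.
      by rewrite mulKf // gt_eqF.
    rewrite mulr_gt0 ?invr_gt0 // (bigD1 w) //= ltr_pwDl ?vpos // sumr_ge0 // => v /andP[vr _].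
    rewrite val //; apply: divr_ge0; last exact/ltW/cpos.
    by case: se => _ h _; apply: h.
(* If the four points were coplanar, a nonzero functional would annihilate two adjacent facets,
   whose points span. *)
have flat x' y' z' b' : b' != z' -> [set x'; y'; z']%SET \in Sf -> [set x'; y'; b']%SET \in Sf ->
    det3 (u y' - u x') (u z' - u x') (u b' - u x') != 0.
  move=> bz zS bS; apply/eqP => /det3_eq0[g [g0 gy gz gb]].
  have gu v : v \in b' |: [set x'; y'; z']%SET -> dot3 g (u v) = dot3 g (u x').
    have sub w : dot3 (u w - u x') g = 0 -> dot3 g (u w) = dot3 g (u x').
      by move=> h; apply/eqP; rewrite -subr_eq0 -h; apply/eqP; vec3_ring.
    by rewrite !inE => /orP[/eqP->|/orP[/orP[]|]/eqP->] //; apply: sub.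
  have [F [FD Fd rF et]] := Sf_face _ zS; have [F' [F'D F'd rF' et']] := Sf_face _ bS.
  pose G := rho :|: [set x'; y']%SET.
  have FE (H : {set 'I_n}) z2 : rho \subset H -> [set x'; y'; z2]%SET = H :\: rho -> H = z2 |: G.
    move=> rH e; rewrite -[H](setID H rho) (setIidPr rH) -e /G.
    by rewrite finset.setUA finset.setUC.
  have eF := FE F z' rF et; have eF' := FE F' b' rF' et'.
  have notG z2 : [set x'; y'; z2]%SET \in Sf -> z2 \notin G.
    move=> z2S; have [_ _ z2t] := mem3 x' y' z2.
    rewrite !inE negb_or (notr _ (in_cov _ _ z2S z2t)) /=.
    have := Sf3 _ z2S; rewrite setUC cardsU1 cards2 !inE.
    by case: (_ || _); case: (x' != y').
  have zG := notG z' zS; have bG := notG b' bS.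
  have Gd : #|G| = d.-1 by move: Fd; rewrite eF cardsU1 zG add1n => <-.
  have e0 : g *m Pi + (- dot3 g (u x')) *: c = 0.
    apply: (@span_adj z' b' G); rewrite -?eF -?eF' // 1?eq_sym //.
    move=> v; have [vr|vr] := boolP (v \in rho) => vin.
      rewrite dotvDr mulPi dotvZr (supports_zero sc vr) mulr0 addr0 big1 // => j _.
      by rewrite Pi_rho // mulr0.
    rewrite uE // gu ?subrr ?mulr0 //.
    by move: vin; rewrite eF' /G !inE (negPf vr) /= => /or3P[]->; rewrite ?orbT.
  by have := Pi_free _ _ e0; move/eqP; rewrite (negPf g0).
have convex x' y' z' v : [set x'; y'; z']%SET \in Sf -> v \in cover Sf ->
    v \notin [set x'; y'; z']%SET -> 0 < det3 (u y' - u x') (u z' - u x') (u v - u x')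
      * det3 (u y' - u x') (u z' - u x') (o - u x').
  move=> tS vS vt; have [f [f0 [fz fpos fo]]] := support _ tS.
  have [xt yt zt] := mem3 x' y' z'.
  (* As affine functions of a point, the determinant and [f] with constant term [f0] both vanish at
     the vertices of the triangle, so they are proportional; they are compared at [u w] and at
     [o]. *)
  have key w : det3 (u y' - u x') (u z' - u x') (u w - u x') * (dot3 f o + f0) =
      det3 (u y' - u x') (u z' - u x') (o - u x') * (dot3 f (u w) + f0).
    have ex := fz _ xt; have ey := fz _ yt; have ez := fz _ zt.
    have id : det3 (u y' - u x') (u z' - u x') (u w - u x') * (dot3 f o + f0) -
      det3 (u y' - u x') (u z' - u x') (o - u x') * (dot3 f (u w) + f0) =
      (det3 (u y' - u x') (u z' - u x') (u w - u x')
        - det3 (u y' - u x') (u z' - u x') (o - u x')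
        - det3 (u y' - u x') (o - u x') (u w - u x')
        - det3 (o - u x') (u z' - u x') (u w - u x')) * (dot3 f (u x') + f0)
      + det3 (o - u x') (u z' - u x') (u w - u x') * (dot3 f (u y') + f0)
      + det3 (u y' - u x') (o - u x') (u w - u x') * (dot3 f (u z') + f0).
      by vec3_ring.
    by apply/eqP; rewrite -subr_eq0 id ex ey ez !mulr0 !addr0.
  have Do0 : det3 (u y' - u x') (u z' - u x') (o - u x') != 0.
    have [b' [bz bS _]] := Sfe x' y' z' tS.
    have := flat x' y' z' b' bz tS bS; apply: contra => /eqP o0.
    have := key b'; rewrite o0 mul0r => /eqP; rewrite mulf_eq0 (gt_eqF fo) orbF.
    by [].
  have := key v => /(congr1 (fun t => t * det3 (u y' - u x') (u z' - u x') (o - u x'))) h.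
  rewrite -(pmulr_lgt0 _ fo) mulrAC h mulrAC -expr2.
  by rewrite mulr_gt0 ?fpos // lt_neqAle sqr_ge0 andbT eq_sym sqrf_eq0.
move=> aS bS.
have fl x' y' z' : [set x'; y'; z']%SET \in Sf -> dot3 (mm x' - mm y') (u x' - u y') = 0.
  by move=> tS; have [xt yt _] := mem3 x' y' z'; apply: flex3 tS xt yt.
have := convex_surface_rigid Sf3 Sfe convex fl aS bS.
have [_ _ at_] := mem3 x y a; have [_ _ bt] := mem3 x y b.
rewrite !lE ?(in_cov _ _ aS at_) ?(in_cov _ _ bS bt) //.
rewrite (kE _ _ aS at_) (kE _ _ bS bt) => h.
have -> : cc a * cc b * (dot3 (mm b) (u a) - dot3 (mm b) (u b)) +
   cc b * cc a * (dot3 (mm a) (u b) - dot3 (mm a) (u a)) =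
   - (cc a * cc b) * dot3 (mm a - mm b) (u a - u b) by vec3_ring.
by rewrite h mulr0.
Qed.

End OneStar.

(** Subtracting a skew motion brings [rho] to rest without changing the edge expressions. *)
Lemma polytope_rigid_stars : rigid_stars d D P.
Proof.
move=> rho l rD rd flex G a b rG Gd aG bG aD bD.
have d0 : (0 < d)%N by apply: leq_trans d4.
have [F [FD rF Fd]] : exists F, [/\ F \in D, rho \subset F & #|F| = d].
  by case: psD => _ _ pure _; apply: pure.
have flex_rho x y : x \in rho -> y \in rho -> dotv (P x) (l y) + dotv (P y) (l x) = 0.
  by move=> xr yr; apply: (flex F) => //; apply: (subsetP rF).
have [A [sk hA]] := skew_ext (indP rD) flex_rho.
pose l' v := l v - P v *m A.
have shift x y : dotv (P x) (l' y) + dotv (P y) (l' x) =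
    dotv (P x) (l y) + dotv (P y) (l x).
  rewrite !dotvBr addrACA (dotv_skew (P x) (P y) sk) opprK subrr addr0 //.
have flex' H : H \in D -> #|H| = d -> rho \subset H -> forall x y, x \in H -> y \in H ->
    dotv (P x) (l' y) + dotv (P y) (l' x) = 0.
  by move=> HD Hd rH x y xH yH; rewrite shift; apply: (flex H).
have l'0 v : v \in rho -> l' v = 0 by move=> vr; rewrite /l' hA // subrr.
have Gr : #|G :\: rho| = 2%N.
  by rewrite cardsD (setIidPr rG) Gd rd; move: d4; clear; lia.
have /eqP/cards2P[x [y [xy exy]]] := Gr.
have inS c : c \notin G -> c |: G \in D -> [set x; y; c]%SET \in link_facets d D rho.
  move=> cG cD; apply/link_facetsP; exists (c |: G); split=> //.
  - by rewrite cardsU1 cG Gd add1n prednK.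
  - by apply: subset_trans rG (subsetUr _ _).
  have cr : c \notin rho by apply: contra cG; apply: (subsetP rG).
  rewrite -exy setUC; apply/setP => v; rewrite !inE.
  by have [->|] := eqVneq v c; rewrite ?cr.
rewrite -shift.
exact: (star_opposite_pinned rD rd flex' l'0 (inS a aG aD) (inS b bG bD)).
Qed.

End PolytopeStars.

(** * Convex hulls, their vertices and supporting hyperplanes *)

Section LinearProgramming.
Variables (R : realType) (d m : nat) (q : 'I_m -> 'rV[R]_d).

Definition halfspace_fun (a : 'rV[R]_d) (b : R) : 'rV[R]_(d + 1) := row_mx (- a) b%:M.

Lemma hat_halfspace a b x : dotv (hat x) (halfspace_fun a b) = b - dot a x.
Proof.
rewrite dotvE big_split_ord big_ord1 /= hat_r mul1r /halfspace_fun row_mxEr mxE eqxx.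
rewrite mulr1n addrC; congr (_ + _); rewrite /dot -sumrN; apply: eq_bigr => j _.
by rewrite hat_l row_mxEl mxE mulrN mulrC.
Qed.

Lemma halfspace_funP (e : 'rV[R]_(d + 1)) : exists a b, e = halfspace_fun a b.
Proof.
exists (- lsubmx e), (rsubmx e 0 0); rewrite /halfspace_fun opprK -[LHS]hsubmxK.
by congr row_mx; rewrite [LHS]mx11_scalar.
Qed.

Lemma hat_conv (w : 'I_m -> R) e : \sum_i w i = 1 ->
  dotv (hat (\sum_i w i *: q i)) e = \sum_i w i * dotv (hat (q i)) e.
Proof.
move=> w1; suff -> : hat (\sum_i w i *: q i) = \sum_i w i *: hat (q i).
  by rewrite dotvC dotv_sumr; apply: eq_bigr => i _; rewrite dotvZr dotvC.
apply/rowP => j; rewrite summxE -(splitK j); case: (split j) => k; rewrite /unsplit.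
  by rewrite hat_l summxE; apply: eq_bigr => i _; rewrite [LHS]mxE [RHS]mxE hat_l.
by rewrite hat_r -w1; apply: eq_bigr => i _; rewrite [RHS]mxE hat_r mulr1.
Qed.

Lemma conv_hull_gen i : conv_hull q (q i).
Proof.
exists (fun k => (k == i)%:R); split.
- by move=> k; rewrite ler0n.
- by rewrite (bigD1 i) //= eqxx big1 ?addr0 // => k /negPf->.
- rewrite (bigD1 i) //= eqxx scale1r big1 ?addr0 // => k /negPf->.
  by rewrite scale0r.
Qed.

(** Links the arbitrary generators [q] of a polytope to its vertices: a functional nonnegative at
    the vertices is then nonnegative on the whole polytope. *)
Lemma vertex_minimizes (e : 'rV[R]_(d + 1)) (i0 : 'I_m) :
  exists i, polytope_vertex (conv_hull q) (q i) /\
    forall k, dotv (hat (q i)) e <= dotv (hat (q k)) e.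
Proof.
pose val f i := dotv (hat (q i)) f.
pose mins f := [set i | [forall k, val f i <= val f k]]%SET.
have minP f i : i \in mins f -> forall k, val f i <= val f k.
  by rewrite inE => /forallP.
have ne f : exists i, i \in mins f.
  case: (Order.TotalTheory.arg_minP (i0 := i0) (P := xpredT) (val f) isT) => i _ h.
  by exists i; rewrite inE; apply/forallP => k; apply: h.
(* Perturb [f] until its minimum is attained at a single point. *)
suff : forall N f, (#|mins f| < N)%N -> (mins f \subset mins e) ->
    exists i, i \in mins e /\ polytope_vertex (conv_hull q) (q i).
  by case/(_ _ e (ltnSn _) (subxx _)) => i [/minP h1 h2]; exists i.
elim=> // N IH f fN fe; have [i imin] := ne f.
have [/existsP[k /andP[kmin neq]]|/existsPn same] :=
    boolP [exists k, (k \in mins f) && (q k != q i)].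
  have [g gneg] : exists g, val g i < val g k.
    have [j qj] : exists j, q k 0 j != q i 0 j.
      by apply/existsP; apply: contraR neq => /existsPn h; apply/eqP/rowP => j;
         have := h j; rewrite negbK => /eqP.
    have vE s : forall r, val (halfspace_fun (s *: delta_mx 0 j) 0) r = - s * q r 0 j.
      move=> r; rewrite /val hat_halfspace sub0r /dot (bigD1 j) //= big1 => [|t tj].
        by rewrite !mxE !eqxx mulr1 addr0 mulNr.
      by rewrite !mxE (negPf tj) andbF mulr0 mul0r.
    have [lt|gt|e'] := ltgtP (q i 0 j) (q k 0 j); last by rewrite e' eqxx in qj.
      by exists (halfspace_fun ((-1) *: delta_mx 0 j) 0); rewrite !vE opprK !mul1r.
    by exists (halfspace_fun (1 *: delta_mx 0 j) 0); rewrite !vE !mulN1r ltrN2.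
  (* For a positive [eps] at most [gap r] the perturbation keeps [r] strictly above [i]; the summand
     1 keeps the denominator positive and the inequality strict. *)
  pose gap r := (val f r - val f i) / (1 + `|val g i - val g r|).
  have gapd r : 0 < 1 + `|val g i - val g r| by rewrite ltr_pwDl.
  have gap0 r : r \notin mins f -> 0 < gap r.
    rewrite inE negb_forall => /existsP[t]; rewrite -ltNge => lt.
    rewrite divr_gt0 // subr_gt0; apply: le_lt_trans lt; exact: (minP f i imin).
  have [eps [eps0 heps]] : exists eps, 0 < eps /\ forall r, r \notin mins f -> eps <= gap r.
    have [/existsP[r0 r0n]|/existsPn none] := boolP [exists r, r \notin mins f].
      case: (Order.TotalTheory.arg_minP (P := fun r => r \notin mins f) gap r0n) => r rn h.
      by exists (gap r); split; [exact: gap0|exact: h].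
    by exists 1; split=> // r rn; have := none r; rewrite rn.
  pose f' := f + eps *: g.
  have valE r : val f' r = val f r + eps * val g r by rewrite /val dotvDr dotvZr.
  have lt_out r : r \notin mins f -> val f' i < val f' r.
    move=> rn; have := heps r rn; rewrite /gap ler_pdivlMr // => h.
    rewrite !valE -subr_gt0.
    have a1 := ler_norm (val g i - val g r).
    have a2 : eps * (val g i - val g r) <= eps * `|val g i - val g r| by rewrite ler_pM2l.
    lra.
  have sub : mins f' \subset mins f.
    apply/subsetP => r rmin; apply: contraT => /lt_out; rewrite ltNge.
    by rewrite (minP f' r rmin i).
  apply: (IH f'); last exact: subset_trans fe.
  rewrite -ltnS; apply: leq_trans fN; rewrite ltnS; apply: proper_card.
  apply/properP; split=> //; exists k => //; apply/negP => /minP/(_ i).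
  rewrite !valE leNgt => /negP; apply.
  have -> : val f k = val f i by apply/eqP; rewrite eq_le !(minP f).
  by rewrite ltrD2l ltr_pM2l.
exists i; split; first exact: (subsetP fe).
have [a [b ef]] := halfspace_funP f.
exists a, (dot a (q i)).
have mono x : conv_hull q x -> dot a x <= dot a (q i) /\
    (dot a x = dot a (q i) -> x = q i).
  move=> [w [w0 w1 ->]].
  have vdot y : dotv (hat y) f = b - dot a y by rewrite ef hat_halfspace.
  have gapE : dot a (q i) - dot a (\sum_k w k *: q k) = \sum_k w k * (val f k - val f i).
    have -> : dot a (q i) - dot a (\sum_k w k *: q k) =
      dotv (hat (\sum_k w k *: q k)) f - val f i by rewrite /val !vdot; ring.
    rewrite hat_conv //; under [RHS]eq_bigr => k _ do rewrite mulrBr.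
    by rewrite sumrB -mulr_suml w1 mul1r.
  have term0 k : 0 <= w k * (val f k - val f i) by rewrite mulr_ge0 // subr_ge0 (minP f i).
  split; first by rewrite -subr_ge0 gapE sumr_ge0.
  move=> eq; move: gapE; rewrite eq subrr => /esym/eqP.
  rewrite psumr_eq0 // => /allP h.
  rewrite -[RHS]scale1r -w1 scaler_suml; apply: eq_bigr => k _.
  have := h k (mem_index_enum k); rewrite mulf_eq0 => /orP[/eqP->|]; first by rewrite !scale0r.
  rewrite subr_eq0 => /eqP vk.
  have kmin : k \in mins f by rewrite inE; apply/forallP => r; rewrite vk; apply: (minP f i).
  by have := same k; rewrite kmin negbK => /eqP->.
split; first by move=> x /mono[].
apply/seteqP; split=> x /=.
  by move=> ->; split=> //; apply: conv_hull_gen.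
by move=> [/mono[_ h] /h].
Qed.

End LinearProgramming.

Section SimplicialPolytope.
Variables (R : realType) (d n : nat) (P : set 'rV[R]_d) (p : 'I_n -> 'rV[R]_d).
Variable D : {set {set 'I_n}}.
Hypothesis d0 : (0 < d)%N.
Hypothesis hP : simplicial_polytope P.
Hypothesis hp : natural_embedding P p.
Hypothesis hD : boundary_complex P p D.
Local Notation hp_ := (fun v => hat (p v)).

Let p_vertex v : polytope_vertex P (p v).
Proof. by case: hp => _ h; apply/h; exists v. Qed.

Let p_in v : P (p v).
Proof.
have [a [b [_ e]]] := p_vertex v.
by have : classical_sets.set1 (p v) (p v) by []; rewrite e => -[].
Qed.

Lemma nonneg_on_polytope e : (forall v, 0 <= dotv (hat (p v)) e) ->
  forall x, P x -> 0 <= dotv (hat x) e.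
Proof.
case: hP => [[m [q eP]] _ _] he x; rewrite {1}eP => -[w [w0 w1 ->]].
rewrite hat_conv // sumr_ge0 // => i _; rewrite mulr_ge0 //.
have [k [vk mink]] := vertex_minimizes q e i.
rewrite -eP in vk; case: hp => _ /(_ (q k)) [/(_ vk)[v pv] _].
by apply: le_trans (mink i); rewrite -pv.
Qed.

Lemma polytope_spanning : spanning hp_.
Proof.
move=> e he.
have on_P x : P x -> dotv (hat x) e = 0.
  move=> Px; apply/eqP; rewrite eq_le -oppr_ge0 -dotvNr.
  by rewrite !nonneg_on_polytope // => v; rewrite ?dotvNr he ?oppr0.
case: hP => _ [q aff qP] _.
have ind : lin_indep (fun i => hat (q i)) finset.setT.
  move=> c c0 v _; have := c0; rewrite (eq_bigl xpredT) => [|i]; last by rewrite inE.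
  move/hat_comb => [h1 h2]; apply: aff => //.
  by apply/rowP => j; rewrite summxE mxE -[RHS](h1 j); apply: eq_bigr => i _; rewrite mxE.
have : (e <= annih (fun i => hat (q i)) finset.setT)%MS.
  by rewrite annihP; apply/forall_inP => i _; rewrite on_P.
have r0 : (d + 1 - #|[set: 'I_d.+1]%SET|)%N = 0%N by rewrite cardsT card_ord addn1 subnn.
have /eqP := annih_rank ind; rewrite r0 mxrank_eq0 => /eqP->.
by rewrite submx0 => /eqP.
Qed.

(** Properness corresponds to [e != 0]: the zero functional cuts out all of [P], and one that cuts
    out [P] vanishes at all vertices, which span. *)
Lemma boundary_faceP S : S \in D <-> exists e, supports hp_ e S.
Proof.
split=> [/hD[F [[a [b [ab eF]]] FP] SF]|[e [e0 epos ez]]].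
  exists (halfspace_fun a b).
  have zE v : (v \in S) = (dotv (hat (p v)) (halfspace_fun a b) == 0).
    rewrite hat_halfspace subr_eq0; apply/idP/eqP => [/SF|h].
      by rewrite eF => -[_ ->].
    by apply/SF; rewrite eF; split=> //; apply/esym.
  split=> //; last by move=> v; rewrite hat_halfspace subr_ge0 ab.
  apply/eqP => h0; apply: FP; rewrite eF; apply/seteqP; split=> x /=; first by case.
  move=> Px; split=> //; have := hat_halfspace a b x.
  by rewrite h0 dotv0r => /esym/eqP; rewrite subr_eq0 => /eqP.
have [a [b ee]] := halfspace_funP e.
apply/hD; exists (fun x => P x /\ dot a x = b).
  split.
    exists a, b; split=> // x Px; have := nonneg_on_polytope epos Px.
    by rewrite ee hat_halfspace subr_ge0.
  move=> eP; move/eqP: e0; apply; apply: polytope_spanning => v.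
  have [_ h] : P (p v) /\ dot a (p v) = b by have := p_in v; rewrite -{1}eP.
  by rewrite ee hat_halfspace h subrr.
move=> v; rewrite ez ee hat_halfspace subr_eq0; split=> [/eqP->|[_ ->]] //.
Qed.

(** A vertex of [P] in the simplex [F] is one of the generators of [F], because its supporting
    hyperplane meets [P] in that vertex alone. So [S] embeds into a set of affinely independent
    points. *)
Lemma boundary_indep S : S \in D -> lin_indep hp_ S.
Proof.
move=> /hD[F Fprop SF]; have [a [b [ab eF]]] := Fprop.1.
have FsubP x : F x -> P x by rewrite eF => -[].
case: hP => _ _ /(_ F Fprop) [m [q [aff eq]]].
have qF i : F (q i) by rewrite eq; apply: conv_hull_gen.
have is_gen v : v \in S -> exists i, q i = p v.
  move=> /SF; rewrite {1}eq => -[w [w0 w1 pv]].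
  have [a' [b' [ab' e']]] := p_vertex v.
  have ev : dot a' (p v) = b'.
    by have : classical_sets.set1 (p v) (p v) by []; rewrite e' => -[].
  have /existsP[i wi] : [exists i, w i != 0].
    apply/existsP/not_existsP => h; move: w1; rewrite big1 => [/eqP|i _].
      by rewrite eq_sym oner_eq0.
    by apply/eqP; apply: contrapT => /negP; apply: h.
  exists i; suff : classical_sets.set1 (p v) (q i) by [].
  rewrite e'; split; first exact: FsubP.
  have gapE : \sum_k w k * dotv (hat (q k)) (halfspace_fun a' b') = 0.
    by rewrite -hat_conv // -pv hat_halfspace ev subrr.
  have term0 k : 0 <= w k * dotv (hat (q k)) (halfspace_fun a' b').
    by rewrite mulr_ge0 // hat_halfspace subr_ge0 ab' //; apply: FsubP.
  move/eqP: gapE; rewrite psumr_eq0 // => /allP/(_ i (mem_index_enum i)).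
  rewrite mulf_eq0 (negPf wi) hat_halfspace subr_eq0 => /eqP h.
  exact/esym.
(* [option] provides a value outside [S] even when ['I_m] is empty. *)
have /fin_all_exists[iota hiota] : forall v, exists i : option 'I_m,
    v \in S -> if i is Some k then q k = p v else False.
  move=> v; have [vS|vS] := boolP (v \in S); last by exists None.
  by have [i hi] := is_gen v vS; exists (Some i).
move=> c c0 v vS.
pose w i := \sum_(u | (u \in S) && (iota u == Some i)) c u.
have regroup (V : lmodType R) (f : 'rV[R]_d -> V) :
    \sum_i w i *: f (q i) = \sum_(u in S) c u *: f (p u).
  transitivity (\sum_i \sum_(u | (u \in S) && (iota u == Some i)) c u *: f (p u)).
    apply: eq_bigr => i _; rewrite /w scaler_suml; apply: eq_bigr => u /andP[uS /eqP ui].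
    by have := hiota u uS; rewrite ui => ->.
  rewrite (exchange_big_dep (mem S)) /=; last by move=> i u _ /andP[].
  apply: eq_bigr => u uS; have := hiota u uS; case eu : (iota u) => [k|//] _.
  rewrite (big_pred1 k) // => i; rewrite uS /=; apply/eqP/eqP => [[->]|->] //.
have [k ek] : exists k, iota v = Some k.
  by have := hiota v vS; case: (iota v) => [k _|//]; exists k.
have sum0 : \sum_i w i *: hat (q i) = 0 by rewrite (regroup _ (fun x => hat x)) c0.
have [h1 h2] := (hat_comb _ _).1 sum0.
have wk : w k = 0.
  apply: aff => //; apply/rowP => j; rewrite summxE mxE -[RHS](h1 j).
  by apply: eq_bigr => i _; rewrite mxE.
rewrite -wk /w (big_pred1 v) // => u; apply/andP/eqP => [[uS /eqP eu]|->]; last by rewrite vS ek.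
have := hiota u uS; have := hiota v vS; rewrite eu ek => -> /esym.
by case: hp => inj _ /inj.
Qed.

Lemma boundary_empty : finset.set0 \in D.
Proof.
apply/boundary_faceP; exists (halfspace_fun 0 1).
have one v : dotv (hat (p v)) (halfspace_fun 0 1) = 1.
  by rewrite hat_halfspace /dot big1 ?subr0 // => j _; rewrite mxE mul0r.
split; last by move=> v; rewrite one inE oner_eq0.
  apply/eqP => h; have := hat_halfspace (0 : 'rV[R]_d) 1 0.
  rewrite h dotv0r /dot big1 => [/eqP|j _]; last by rewrite mxE mul0r.
  by rewrite subr0 eq_sym oner_eq0.
by move=> v; rewrite one ler01.
Qed.

Lemma boundary_vertex v : [set v]%SET \in D.
Proof.
apply/hD; exists (classical_sets.set1 (p v)).
  split; first exact: p_vertex.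
  move=> eP; case: hP => _ [q aff qP] _.
  have qE i : q i = p v by have := qP i; rewrite -eP.
  pose i1 : 'I_d.+1 := Ordinal (d0 : (1 < d.+1)%N).
  pose w (i : 'I_d.+1) : R := (i == ord0)%:R - (i == i1)%:R.
  have sw : \sum_i w i = 0.
    rewrite sumrB (bigD1 ord0) //= big1 => [|i /negPf->//].
    by rewrite addr0 (bigD1 i1) //= big1 ?addr0 ?subrr // => i /negPf->.
  have := aff w sw; rewrite (eq_bigr (fun i => w i *: p v)) => [|i _]; last by rewrite qE.
  rewrite -scaler_suml sw scale0r => /(_ erefl ord0); rewrite /w eqxx.
  by move/eqP; rewrite (_ : ord0 == i1 = false) // subr0 oner_eq0.
move=> u; rewrite !inE; split=> [/eqP->//|h]; apply/eqP.
by case: hp => inj _; apply: inj.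
Qed.

End SimplicialPolytope.

(** * Both cases together *)

Lemma stress_hypotheses_rigid (R : realType) d n (D : {set {set 'I_n}})
    (p : 'I_n -> 'rV[R]_d) : (4 <= d)%N -> stress_hypotheses D p ->
  [/\ closed_pseudomanifold d D, star_connected d D finset.set0,
      adjacent_facets_span d D (fun v => hat (p v)) & rigid_stars d D (fun v => hat (p v))].
Proof.
move=> d4 [[[nD gen]|[P [hP hp hD]]] _].
  have psD := normal_closed_pseudomanifold d4 nD.
  have conn := normal_star_connected d4 nD.
  split=> //; first by apply: conn; case: psD => -[].
  - exact: generic_adjacent_facets_span.
  - exact: generic_rigid_stars.
have md := addn1 d.
have span := polytope_spanning hP hp; have face := boundary_faceP hP hp hD.
have ind := boundary_indep hP hp hD; have empt := boundary_empty hP hp hD.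
have vert := boundary_vertex (leq_trans (isT : (0 < 4)%N) d4) hP hp hD.
split.
- exact: (polytope_closed_pseudomanifold d4 md span face ind vert empt).
- exact: (polytope_connected d4 md span face ind).
- exact: (polytope_adjacent_facets_span d4 md face ind).
- exact: (polytope_rigid_stars d4 md span face ind vert empt).
Qed.

(** Determination by the 2-stresses is expressed through a second configuration with the same vertex
    labels, which may fall under the other of the two cases. *)
Theorem theorem5p1 (R : realType) (d n : nat) (D : {set {set 'I_n}})
    (p : 'I_n -> 'rV[R]_d) (hd : (4 <= d)%N) (hDp : stress_hypotheses D p) :
  partials_span (affine_stress 2 D p) = affine_stress 1 D p /\
  (forall (D' : {set {set 'I_n}}) (p' : 'I_n -> 'rV[R]_d),
     stress_hypotheses D' p' ->
     affine_stress 2 D p = affine_stress 2 D' p' ->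
     affine_stress 1 D p = affine_stress 1 D' p' /\
     affinely_equivalent p p').
Proof.
have part1 (E : {set {set 'I_n}}) (r : 'I_n -> 'rV[R]_d) : stress_hypotheses E r ->
    partials_span (affine_stress 2 E r) = affine_stress 1 E r.
  move=> h; have [h1 h2 h3 h4] := stress_hypotheses_rigid hd h.
  exact: partials_span_stress h.2.
split=> [|D' p' hDp' eq2]; first exact: part1.
have eq1 : affine_stress 1 D p = affine_stress 1 D' p'.
  by rewrite -!part1 // eq2.
split=> //.
have [psD _ spanD _] := stress_hypotheses_rigid hd hDp.
have [psD' _ spanD' _] := stress_hypotheses_rigid hd hDp'.
apply: affine_equivalence.
- exact: spanning_hat psD spanD.
- exact: spanning_hat psD' spanD'.
move=> c; rewrite -(@affine_stress1P _ _ _ D) ?eq1; last by case: psD => -[].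
by rewrite -(@affine_stress1P _ _ _ D') //; case: psD' => -[].
Qed.
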